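(* Let $K$ be a field and let $G$ be a finite simple graph without isolated vertices on the vertex set $\{x_1,\dots,x_n\}$, and suppose $G$ is locally triangle-free. Then $G$ is Gorenstein (i.e. $R/I(G)$ is a Gorenstein ring, where $R=K[x_1,\dots,x_n]$ and $I(G)=(x_ix_j\mid x_ix_j\in E(G))$ is the edge ideal) if and only if either $G$ is a triangle-free graph in $W_2$, or $G$ is isomorphic to one of $C_m^c$ for some $m\geqslant 6$, $Q_9$, $Q_{12}$, $P_{10}$ or $P_{12}$.
   Context: An independent set of $G$ is a set of pairwise non-adjacent vertices; $\alpha(G)$ is the maximum size of an independent set. $G$ is well-covered if all maximal independent sets have the same size. A well-covered graph $G$ is in $W_2$ if removing any vertex of $G$ leaves a well-covered graph with the same independence number as $G$. For $S\subseteq V(G)$, $N_G(S)$ is the set of vertices outside $S$ adjacent to some vertex of $S$, $N_G[S]=S\cup N_G(S)$, and $G_S$ is the induced subgraph $G\setminus N_G[S]$; $G_v=G_{\{v\}}$. $G$ is locally triangle-free if $G_v$ has no triangle for every vertex $v$. $C_m^c$ is the complement of the cycle on $m$ vertices. $Q_9$: vertices $a,b,c,a_1,a_2,b_1,b_2,c_1,c_2$; edges $ab,bc,ca,aa_1,aa_2,bb_1,bb_2,cc_1,cc_2,a_1c_1,c_1b_1,b_1a_2,a_2c_2,c_2b_2,b_2a_1$. $Q_{12}$: vertices $a,b,c,a_i,b_i,c_i$ ($i=1,2,3$); edges $ab,bc,ca$, $aa_i,bb_i,cc_i$ ($i=1,2,3$), and $a_1c_1,c_1b_1,b_1a_3,a_3c_3,c_3b_3,b_3a_2,a_2c_2,c_2b_2,b_2a_1$.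 $P_{10}$: vertices $a,b,c,x,y,a_1,b_1,b_2,c_1,c_2$; edges $ab,ac,aa_1,ax,ay,bc,bb_1,bb_2,cc_1,cc_2,xy,xb_2,xc_1,yb_1,yc_2,a_1b_1,a_1b_2,a_1c_1,a_1c_2,b_1c_1,b_2c_2$. $P_{12}$: vertices $a,b,c,d,x,y,z,t,a_1,b_1,c_1,c_2$; edges $ab,aa_1,ac,ad,ax,ay,bb_1,bc,bd,bt,bz,cx,cz,cc_1,cc_2,dy,dt,dc_1,dc_2,a_1b_1,a_1z,a_1t,a_1c_1,a_1c_2,b_1x,b_1y,b_1c_1,b_1c_2,xy,xt,xc_1,yz,yc_2,zt,zc_1,tc_2$. *)

(* Defs.v *)
From HB Require Import structures.
From mathcomp Require Import all_boot all_order all_algebra.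
From mathcomp Require Import generic_quotient ring_quotient ring.
From mathcomp Require Import boolp.
From mathcomp.multinomials Require Import mpoly.

Set Implicit Arguments.
Unset Strict Implicit.
Unset Printing Implicit Defensive.

Import GRing.Theory.

Local Open Scope ring_scope.
Local Open Scope quotient_scope.

Record sgraph (T : finType) := SGraph {
  adj :> rel T;
  adj_sym : ssrbool.symmetric adj;
  adj_irr : irreflexive adj
}.

Section Graphs.

Variables (T : finType) (G : sgraph T).

Definition no_isolated := forall x, exists y, G x y.

Definition independent (S : {set T}) : bool :=
  [forall x in S, forall y in S, ~~ G x y].

Definition indep_number : nat := (\max_(S : {set T} | independent S) #|S|)%N.

Definition well_covered :=
  forall S S', maxset independent S -> maxset independent S' -> #|S| = #|S'|.

Definition triangle_free := forall x y z, ~~ [&& G x y, G y z & G z x].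

Definition nbhd (S : {set T}) : {set T} :=
  [set x | (x \notin S) && [exists y in S, G x y]].

Definition closed_nbhd (S : {set T}) : {set T} := S :|: nbhd S.

Section Induced.

Variable S : {set T}.

Definition induced_adj : rel {x : T | x \in S} := fun x y => G (val x) (val y).

Fact induced_sym : ssrbool.symmetric induced_adj.
Proof. by move=> x y; apply: adj_sym. Qed.

Fact induced_irr : irreflexive induced_adj.
Proof. by move=> x; apply: adj_irr. Qed.

Definition induced := SGraph induced_sym induced_irr.

End Induced.

Definition compl_adj : rel T := fun x y => (x != y) && ~~ G x y.

Fact compl_sym : ssrbool.symmetric compl_adj.
Proof. by move=> x y; rewrite /compl_adj eq_sym adj_sym. Qed.

Fact compl_irr : irreflexive compl_adj.
Proof. by move=> x; rewrite /compl_adj eqxx. Qed.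

Definition compl := SGraph compl_sym compl_irr.

End Graphs.

Definition del_vertex (T : finType) (G : sgraph T) (v : T) :=
  induced G (~: [set v]).

Definition local_graph (T : finType) (G : sgraph T) (S : {set T}) :=
  induced G (~: closed_nbhd G S).

Definition in_W2 (T : finType) (G : sgraph T) :=
  well_covered G /\
  forall v, well_covered (del_vertex G v) /\
            indep_number (del_vertex G v) = indep_number G.

Definition locally_triangle_free (T : finType) (G : sgraph T) :=
  forall v, triangle_free (local_graph G [set v]).

Definition graph_iso (T T' : finType) (G : sgraph T) (H : sgraph T') :=
  exists2 f : T -> T', bijective f & forall x y, H (f x) (f y) = G x y.

Section SymmetrizedRelation.

Variables (n : nat) (r : rel nat).

Definition symrel_adj : rel 'I_n :=
  fun i j => (i != j) && (r i j || r j i).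

Fact symrel_sym : ssrbool.symmetric symrel_adj.
Proof. by move=> i j; rewrite /symrel_adj eq_sym orbC. Qed.

Fact symrel_irr : irreflexive symrel_adj.
Proof. by move=> i; rewrite /symrel_adj eqxx. Qed.

Definition graph_of_rel := SGraph symrel_sym symrel_irr.

End SymmetrizedRelation.

Definition graph_of_edges (n : nat) (E : seq (nat * nat)) : sgraph 'I_n :=
  graph_of_rel n (fun i j => (i, j) \in E).

(* This is the m-cycle only for m >= 3. *)
Definition cycle_graph (m : nat) : sgraph 'I_m :=
  graph_of_rel m (fun i j => j == i.+1 %% m)%N.

Definition Q9 : sgraph 'I_9 :=
  let a := 0%N in let b := 1%N in let c := 2%N in
  let a1 := 3%N in let a2 := 4%N in
  let b1 := 5%N in let b2 := 6%N in
  let c1 := 7%N in let c2 := 8%N in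
  graph_of_edges 9
    [:: (a, b); (b, c); (c, a);
        (a, a1); (a, a2); (b, b1); (b, b2); (c, c1); (c, c2);
        (a1, c1); (c1, b1); (b1, a2); (a2, c2); (c2, b2); (b2, a1)].

Definition Q12 : sgraph 'I_12 :=
  let a := 0%N in let b := 1%N in let c := 2%N in
  let a1 := 3%N in let a2 := 4%N in let a3 := 5%N in
  let b1 := 6%N in let b2 := 7%N in let b3 := 8%N in
  let c1 := 9%N in let c2 := 10%N in let c3 := 11%N in
  graph_of_edges 12
    [:: (a, b); (b, c); (c, a);
        (a, a1); (a, a2); (a, a3);
        (b, b1); (b, b2); (b, b3);
        (c, c1); (c, c2); (c, c3);
        (a1, c1); (c1, b1); (b1, a3); (a3, c3); (c3, b3); (b3, a2);
        (a2, c2); (c2, b2); (b2, a1)].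

Definition P10 : sgraph 'I_10 :=
  let a := 0%N in let b := 1%N in let c := 2%N in
  let x := 3%N in let y := 4%N in
  let a1 := 5%N in
  let b1 := 6%N in let b2 := 7%N in
  let c1 := 8%N in let c2 := 9%N in
  graph_of_edges 10
    [:: (a, b); (a, c); (a, a1); (a, x); (a, y);
        (b, c); (b, b1); (b, b2); (c, c1); (c, c2);
        (x, y); (x, b2); (x, c1); (y, b1); (y, c2);
        (a1, b1); (a1, b2); (a1, c1); (a1, c2);
        (b1, c1); (b2, c2)].

Definition P12 : sgraph 'I_12 :=
  let a := 0%N in let b := 1%N in let c := 2%N in let d := 3%N in
  let x := 4%N in let y := 5%N in let z := 6%N in let t := 7%N in
  let a1 := 8%N in let b1 := 9%N in
  let c1 := 10%N in let c2 := 11%N in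
  graph_of_edges 12
    [:: (a, b); (a, a1); (a, c); (a, d); (a, x); (a, y);
        (b, b1); (b, c); (b, d); (b, t); (b, z);
        (c, x); (c, z); (c, c1); (c, c2);
        (d, y); (d, t); (d, c1); (d, c2);
        (a1, b1); (a1, z); (a1, t); (a1, c1); (a1, c2);
        (b1, x); (b1, y); (b1, c1); (b1, c2);
        (x, y); (x, t); (x, c1); (y, z); (y, c2);
        (z, t); (z, c1); (t, c2)].

Definition ideal_gen (A : comNzRingType) (X : A -> Prop) (a : A) : Prop :=
  exists2 s : seq (A * A),
    forall p, p \in s -> X p.2 & a = \sum_(p <- s) p.1 * p.2.

(* [idealr A] is the type of proper ideals; the unit ideal is generated by 1 *)
(* and hence imposes no condition.                                           *)
Definition noetherian (A : comNzRingType) :=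
  forall I : idealr A, exists s : seq A,
    forall a, a \in I <-> ideal_gen (fun g => g \in s) a.

Definition maximal_ideal (A : comNzRingType) (m : idealr A) :=
  forall J : idealr A, {subset m <= J} -> {subset J <= m}.

Module Localization.
Section Localization.

Variables (A : comNzRingType) (p : prime_idealr A).

Fact denom_key1 : 1 \notin p.
Proof. by rewrite idealr1. Qed.

Fact denom_keyM (s t : A) : s \notin p -> t \notin p -> s * t \notin p.
Proof. by move=> sp tp; rewrite prime_idealrM negb_or sp. Qed.

Definition dom := (A * {s : A | s \notin p})%type.

Implicit Types x y z : dom.

Definition den : dom -> A := fun x => sval x.2.

Definition mkfrac (a s : A) (sp : s \notin p) : dom := (a, exist _ s sp).

Lemma denP x : den x \notin p. Proof. exact: valP x.2. Qed.

(* a / s = b / t iff u (a t - b s) = 0 for some u outside p. *)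
Definition equivl x y : bool :=
  `[< exists2 u, u \notin p & u * (x.1 * den y) = u * (y.1 * den x) >].

Lemma equivl_refl : reflexive equivl.
Proof. by move=> x; apply/asboolP; exists 1; rewrite ?denom_key1. Qed.

Lemma equivl_sym : ssrbool.symmetric equivl.
Proof. by move=> x y; apply/asboolP/asboolP => -[u up e]; exists u. Qed.

Lemma equivl_trans : transitive equivl.
Proof.
move=> y x z /asboolP[u up e] /asboolP[v vp f]; apply/asboolP.
exists (u * v * den y); first by rewrite !denom_keyM ?denP.
transitivity (v * den z * (u * (x.1 * den y))); first by ring.
rewrite e.
transitivity (u * den x * (v * (y.1 * den z))); first by ring.
by rewrite f; ring.
Qed.

Canonical equivl_equiv := EquivRel equivl equivl_refl equivl_sym equivl_trans.

Definition type := {eq_quot equivl}.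

HB.instance Definition _ : EqQuotient _ equivl type := EqQuotient.on type.
HB.instance Definition _ := Choice.on type.

Lemma eqP_pi x y :
  (\pi_type x = \pi_type y) <->
  exists2 u, u \notin p & u * (x.1 * den y) = u * (y.1 * den x).
Proof.
split=> [/eqmodP /asboolP //|h].
by apply/eqmodP; apply/asboolP.
Qed.

Lemma repr_pi x : exists2 u, u \notin p &
  u * ((repr (\pi_type x)).1 * den x) = u * (x.1 * den (repr (\pi_type x))).
Proof. by apply/eqP_pi; rewrite reprK. Qed.

Definition addl x y : dom :=
  mkfrac (x.1 * den y + y.1 * den x) (denom_keyM (denP x) (denP y)).
Definition oppl x : dom := mkfrac (- x.1) (denP x).
Definition mull x y : dom :=
  mkfrac (x.1 * y.1) (denom_keyM (denP x) (denP y)).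

Definition add := lift_op2 type addl.
Definition opp := lift_op1 type oppl.
Definition mul := lift_op2 type mull.

Definition tolocal := lift_embed type (fun a => mkfrac a denom_key1).
Canonical tolocal_pi_morph := PiEmbed tolocal.

Lemma pi_add : {morph \pi : x y / addl x y >-> add x y}.
Proof.
move=> x y; unlock add; apply/eqP_pi => /=.
have [u up e] := repr_pi x; have [v vp f] := repr_pi y.
exists (u * v); first exact: denom_keyM.
set x' := repr _ in e *; set y' := repr _ in f *.
rewrite /den /= in e f; rewrite /addl /mull /den /=.
transitivity (v * sval y.2 * sval y'.2 * (u * (x.1 * sval x'.2)) +
              u * sval x.2 * sval x'.2 * (v * (y.1 * sval y'.2))).
  by ring.
by rewrite -e -f; ring.
Qed.
Canonical pi_add_morph := PiMorph2 pi_add.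

Lemma pi_opp : {morph \pi : x / oppl x >-> opp x}.
Proof.
move=> x; unlock opp; apply/eqP_pi => /=.
have [u up e] := repr_pi x; exists u => //.
by rewrite /den /= in e; rewrite /oppl /den /= !mulNr !mulrN e.
Qed.
Canonical pi_opp_morph := PiMorph1 pi_opp.

Lemma pi_mul : {morph \pi : x y / mull x y >-> mul x y}.
Proof.
move=> x y; unlock mul; apply/eqP_pi => /=.
have [u up e] := repr_pi x; have [v vp f] := repr_pi y.
exists (u * v); first exact: denom_keyM.
set x' := repr _ in e *; set y' := repr _ in f *.
rewrite /den /= in e f; rewrite /addl /mull /den /=.
transitivity ((u * (x.1 * sval x'.2)) * (v * (y.1 * sval y'.2))); first by ring.
by rewrite -e -f; ring.
Qed.
Canonical pi_mul_morph := PiMorph2 pi_mul.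

Lemma pi_eq x y : x.1 * den y = y.1 * den x -> \pi_type x = \pi_type y.
Proof. by move=> e; apply/eqP_pi; exists 1; rewrite ?denom_key1 ?e. Qed.

Lemma addA : associative add.
Proof.
elim/quotW=> x; elim/quotW=> y; elim/quotW=> z; rewrite !piE.
by apply: pi_eq; rewrite /addl /oppl /mull /den /=; ring.
Qed.

Lemma addC : commutative add.
Proof.
elim/quotW=> x; elim/quotW=> y; rewrite !piE.
by apply: pi_eq; rewrite /addl /oppl /mull /den /=; ring.
Qed.

Lemma add0_l : left_id (tolocal 0) add.
Proof.
elim/quotW=> x; rewrite !piE.
by apply: pi_eq; rewrite /addl /oppl /mull /den /=; ring.
Qed.

Lemma addN_l : left_inverse (tolocal 0) opp add.
Proof.
elim/quotW=> x; rewrite !piE.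
by apply: pi_eq; rewrite /addl /oppl /mull /den /=; ring.
Qed.

HB.instance Definition _ := GRing.isZmodule.Build type addA addC add0_l addN_l.

Lemma mulA : associative mul.
Proof.
elim/quotW=> x; elim/quotW=> y; elim/quotW=> z; rewrite !piE.
by apply: pi_eq; rewrite /addl /oppl /mull /den /=; ring.
Qed.

Lemma mulC : commutative mul.
Proof.
elim/quotW=> x; elim/quotW=> y; rewrite !piE.
by apply: pi_eq; rewrite /addl /oppl /mull /den /=; ring.
Qed.

Lemma mul1_l : left_id (tolocal 1) mul.
Proof.
elim/quotW=> x; rewrite !piE.
by apply: pi_eq; rewrite /addl /oppl /mull /den /=; ring.
Qed.

Lemma mul_addl : left_distributive mul add.
Proof.
elim/quotW=> x; elim/quotW=> y; elim/quotW=> z; rewrite !piE.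
by apply: pi_eq; rewrite /addl /oppl /mull /den /=; ring.
Qed.

Lemma nonzero1 : tolocal 1 != 0 :> type.
Proof.
apply/eqP; rewrite !piE => /eqP_pi[u up] /=.
by rewrite /den /= mul0r mulr0 !mulr1 => u0; rewrite u0 idealr0 in up.
Qed.

HB.instance Definition _ :=
  GRing.Zmodule_isComNzRing.Build type mulA mulC mul1_l mul_addl nonzero1.

End Localization.
End Localization.
HB.export Localization.

Definition localization (A : comNzRingType) (p : prime_idealr A) :
  comNzRingType := Localization.type p.

Definition injective_module (A : nzRingType) (E : lmodType A) :=
  forall (M N : lmodType A) (i : {linear M -> N}) (f : {linear M -> E}),
    injective i -> exists g : {linear N -> E}, forall x, g (i x) = f x.

(* M has an injective resolution                                            *)
(*   0 -> M -> E 0 -> E 1 -> ... -> E d -> 0.                               *)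
Definition finite_injective_dimension (A : nzRingType) (M : lmodType A) :=
  exists (d : nat) (E : nat -> lmodType A) (eps : {linear M -> E 0%N})
         (delta : forall k, {linear E k -> E k.+1}),
  [/\ forall k, injective_module (E k),
      injective eps,
      forall y, delta 0%N y = 0 <-> exists x, y = eps x,
      forall k y, delta k.+1 y = 0 <-> exists x, y = delta k x
    & forall k, (d < k)%N -> forall x : E k, x = 0].

(* Maximality is tested against all proper ideals; since maximal ideals are *)
(* prime, letting p range over [prime_idealr A] loses none of them.         *)
Definition gorenstein_ring (A : comNzRingType) :=
  noetherian A /\
  forall p : prime_idealr A, maximal_ideal p ->
    finite_injective_dimension (localization p)^o.

Section EdgeIdeal.

Variables (K : fieldType) (n : nat) (G : sgraph 'I_n).

Definition edge_monomial (q : {mpoly K[n]}) : Prop :=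
  exists i j : 'I_n, G i j /\ q = 'X_i * 'X_j.

Definition edge_ideal : {pred {mpoly K[n]}} :=
  fun q => `[< ideal_gen edge_monomial q >].

Fact edge_ideal_closed : idealr_closed edge_ideal.
Proof.
split.
- by apply/asboolP; exists [::]; rewrite ?big_nil.
- apply/negP => /asboolP[s sX /(congr1 (meval (fun=> 0)))].
  rewrite rmorph1 rmorph_sum /= big_seq big1.
    by move/eqP; rewrite oner_eq0.
  move=> q qs; have [i [j [_ ->]]] := sX _ qs.
  by rewrite !mevalM !mevalXU !mulr0.
- move=> a q r /asboolP[s sX ->] /asboolP[t tX ->]; apply/asboolP.
  exists ([seq (a * u.1, u.2) | u <- s] ++ t).
    move=> u; rewrite mem_cat => /orP[/mapP[v vs ->]|]; first exact: (sX v).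
    exact: tX.
  rewrite big_cat big_map mulr_sumr /=; congr (_ + _).
  by apply: eq_bigr => u _; rewrite mulrA.
Qed.

HB.instance Definition _ :=
  isIdealr.Build {mpoly K[n]} edge_ideal edge_ideal_closed.

Definition gorenstein_graph := gorenstein_ring {ideal_quot edge_ideal}.

End EdgeIdeal.

(* Main.v *)
(* Sufficiency.  A certificate is a family of vertex sets U, containing the complements of
   the maximal independent sets, such that each nonempty U in it has a vertex t for which
   U' = U - t and U' + N(t) are in it and every element of A killed by U' + N(t) is x_t times
   one killed by U', where A = R/I(G).  Build a coinduced coresolution of A, with E_k = Hom_K(A, C_k)
   and C_(k+1) = E_k / C_k.  Along the family, elements of C_k killed by U lift to elements of
   E_(k-1) killed by U; at the complement of a facet S this combines with the finite global
   dimension of K[S], so that maps A/P_S -> C_n extend, and filtering by the primes P_S makes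
   C_n injective.  For a triangle-free graph in W_2 the sets X + N(F), with F independent and
   X an independent set missing N[F], form a certificate; for C_m^c complements of intervals
   do; the sporadic graphs have computed ones.

   Necessity.  Let G_F be what is left after deleting N[F] for an independent F, and localize
   A at the maximal ideal of the indicator point of F.  Finite injective dimension makes high
   Ext groups into the local ring vanish, and comparing syzygies shifts this vanishing down.
   It follows that G_F is not a join of two parts unless it is K_2, and that certain
   complement paths ending in a leaf do not occur in G_F.  Combinatorially this forces all
   G_F to be pure and without isolated vertices, so G is in W_2.  If G moreover contains a
   triangle, then for alpha = 2 the complement is a cycle; for alpha = 3 the complement is
   locally a 4- or 5-cycle, hence a closed surface whose vertices have degree 4 or 5, and an
   exhaustive search leaves Q_9, P_10 and P_12; for alpha >= 4 the vertices missing both ends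
   of an edge of a triangle determine the graph, which is Q_12. *)
From HB Require Import structures.
Require Import Defs.
From mathcomp Require Import all_boot all_order all_algebra.
From mathcomp Require Import generic_quotient ring_quotient ring zify.
From mathcomp Require Import boolp.
From mathcomp Require classical_sets.
From mathcomp.multinomials Require Import mpoly.

Set Implicit Arguments.
Unset Strict Implicit.
Unset Printing Implicit Defensive.
Import Order.TTheory GRing.Theory.
Local Open Scope ring_scope.
Local Open Scope quotient_scope.

(** * Injective modules and cosyzygies *)

(** The definition of Gorenstein offers only finite injective dimension of each localization: no
    grading, no depth, no canonical module. Both directions therefore handle injective resolutions
    directly. For sufficiency, coinduction from K produces injective modules by linear algebra
    alone, and the independent monomials, a K-basis of A, make every extension problem explicit. All
    cosyzygies are formed over A, even those of a localization L of A; Schanuel's lemma compares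
    them with cosyzygies over L, where the dimension is wanted. For necessity no Ext group is
    formed: its vanishing means that cocycles into the given resolution are coboundaries. The shift
    rests on pairs of ideals of L, each a direct summand of the syzygies of the other, so vanishing
    in one high degree descends to Ext^1. At that point a homomorphism on syzygies must be given by
    coefficients, and its values on two explicit syzygies are contradictory. *)

Section Submodules.
Variable R : nzRingType.

Definition submodule (M : lmodType R) (P : M -> Prop) :=
  P 0 /\ forall a x y, P x -> P y -> P (a *: x + y).

(** A homomorphism on a submodule is a total function, arbitrary elsewhere, so functions obtained by
    choice serve directly. *)
Definition lin_on (M N : lmodType R) (P : M -> Prop) (f : M -> N) :=
  forall a x y, P x -> P y -> f (a *: x + y) = a *: f x + f y.

Lemma submoduleZ (M : lmodType R) (P : M -> Prop) a x :
  submodule P -> P x -> P (a *: x).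
Proof. by move=> [P0 PD] Px; rewrite -[_ *: _]addr0; apply: PD. Qed.

Lemma submoduleD (M : lmodType R) (P : M -> Prop) x y :
  submodule P -> P x -> P y -> P (x + y).
Proof. by move=> [P0 PD] Px Py; rewrite -[x]scale1r; apply: PD. Qed.

Lemma submoduleN (M : lmodType R) (P : M -> Prop) x :
  submodule P -> P x -> P (- x).
Proof. by move=> sP Px; rewrite -scaleN1r; apply: submoduleZ. Qed.

Lemma submoduleB (M : lmodType R) (P : M -> Prop) x y :
  submodule P -> P x -> P y -> P (x - y).
Proof. by move=> sP Px Py; apply: submoduleD => //; apply: submoduleN. Qed.

Lemma lin_on0 (M N : lmodType R) (P : M -> Prop) (f : M -> N) :
  submodule P -> lin_on P f -> f 0 = 0.
Proof.
move=> [P0 _] lf; have := lf 1 0 0 P0 P0; rewrite !scale1r addr0.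
by move/eqP; rewrite -[X in X == _]addr0 (inj_eq (addrI _)) => /eqP <-.
Qed.

Lemma lin_onZ (M N : lmodType R) (P : M -> Prop) (f : M -> N) a x :
  submodule P -> lin_on P f -> P x -> f (a *: x) = a *: f x.
Proof.
move=> sP lf Px; have [P0 _] := sP.
by have := lf a x 0 Px P0; rewrite addr0 (lin_on0 sP lf) addr0.
Qed.

Lemma lin_onD (M N : lmodType R) (P : M -> Prop) (f : M -> N) x y :
  lin_on P f -> P x -> P y -> f (x + y) = f x + f y.
Proof. by move=> lf Px Py; have := lf 1 x y Px Py; rewrite !scale1r. Qed.

Definition linear_fun_of (M N : lmodType R) (f : M -> N) (lf : linear f) := f.
HB.instance Definition _ (M N : lmodType R) (f : M -> N) (lf : linear f) :=
  GRing.isLinear.Build R M N *:%R (linear_fun_of lf) lf.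
Definition mkLinear (M N : lmodType R) (f : M -> N) (lf : linear f) :
  {linear M -> N} := linear_fun_of lf.

Lemma lin_onT (M N : lmodType R) (P : M -> Prop) (f : {linear M -> N}) :
  lin_on P f.
Proof. by move=> a x y _ _; rewrite linearP. Qed.

Section SubmoduleType.
Variables (M : lmodType R) (P : M -> Prop) (sP : submodule P).

(** The proof occurs in the term so that the structure built from it can be inferred from the
    predicate; [qequiv], [res_scalars] and [edge_lift] carry an argument for the same reason. *)
Definition submodule_pred (_ : submodule P) : {pred M} := fun x => `[<P x>].

Lemma submodule_predP x : reflect (P x) (x \in submodule_pred sP).
Proof. exact: asboolP. Qed.

Fact submodule_pred_closed : submod_closed (submodule_pred sP).
Proof.
split=> [|a x y /submodule_predP Px /submodule_predP Py]; apply/submodule_predP.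
  by case: sP.
by case: sP => _; apply.
Qed.
HB.instance Definition _ :=
  GRing.isSubmodClosed.Build R M (submodule_pred sP) submodule_pred_closed.

Definition submodule_type := {x : M | x \in submodule_pred sP}.
HB.instance Definition _ := SubChoice.on submodule_type.
HB.instance Definition _ := [SubChoice_isSubLmodule of submodule_type by <:].

End SubmoduleType.

Lemma injective_extend (E N : lmodType R) (P : N -> Prop) (f : N -> E) :
  injective_module E -> submodule P -> lin_on P f ->
  exists g : {linear N -> E}, forall x, P x -> g x = f x.
Proof.
move=> injE sP lf; pose T : lmodType R := submodule_type sP.
have lv : linear (val : T -> N) by move=> a x y; rewrite linearP.
have lfv : linear (f \o (val : T -> N)).
  by move=> a x y; rewrite /comp lv lf //; apply/(submodule_predP sP)/valP.
have [g gE] := injE T N (mkLinear lv) (mkLinear lfv) val_inj.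
by exists g => x /(submodule_predP sP) Px; have := gE (Sub x Px).
Qed.

End Submodules.

Section QuotientModule.
Variables (R : nzRingType) (M : lmodType R) (P : M -> Prop) (sP : submodule P).

Definition qequiv (_ : submodule P) (x y : M) : bool := `[<P (x - y)>].

Lemma qequiv_refl : reflexive (qequiv sP).
Proof. by move=> x; apply/asboolP; rewrite subrr; case: sP. Qed.
Lemma qequiv_sym : ssrbool.symmetric (qequiv sP).
Proof.
by move=> x y; apply/asboolP/asboolP => h; rewrite -opprB; apply: submoduleN.
Qed.
Lemma qequiv_trans : transitive (qequiv sP).
Proof.
move=> y x z /asboolP h1 /asboolP h2; apply/asboolP.
by have -> : x - z = (x - y) + (y - z); [rewrite subrKA | apply: submoduleD].
Qed.
Canonical qequiv_equiv := EquivRel (qequiv sP) qequiv_refl qequiv_sym qequiv_trans.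

Definition quotm := {eq_quot (qequiv sP)}.
HB.instance Definition _ : EqQuotient _ (qequiv sP) quotm := EqQuotient.on quotm.
HB.instance Definition _ := Choice.on quotm.

Definition qpi (x : M) : quotm := \pi_quotm x.

Lemma qpiP x y : qpi x = qpi y <-> P (x - y).
Proof. by split=> [/eqmodP /asboolP //|h]; apply/eqmodP/asboolP. Qed.

Lemma qpi_repr (u : quotm) : qpi (repr u) = u.
Proof. exact: reprK. Qed.

Lemma qreprP x : P (repr (qpi x) - x).
Proof. by apply/qpiP; rewrite qpi_repr. Qed.

Definition qadd (u v : quotm) := qpi (repr u + repr v).
Definition qopp (u : quotm) := qpi (- repr u).
Definition qscale a (u : quotm) := qpi (a *: repr u).

Lemma qaddE x y : qadd (qpi x) (qpi y) = qpi (x + y).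
Proof.
apply/qpiP; rewrite opprD addrACA.
by apply: submoduleD => //; apply: qreprP.
Qed.
Lemma qoppE x : qopp (qpi x) = qpi (- x).
Proof.
by apply/qpiP; rewrite opprK addrC -opprB; apply: submoduleN => //; apply: qreprP.
Qed.
Lemma qscaleE a x : qscale a (qpi x) = qpi (a *: x).
Proof. by apply/qpiP; rewrite -scalerBr; apply: submoduleZ => //; apply: qreprP. Qed.

Lemma qaddA : associative qadd.
Proof.
by move=> u v w; rewrite -[u]qpi_repr -[v]qpi_repr -[w]qpi_repr !qaddE addrA.
Qed.
Lemma qaddC : commutative qadd.
Proof. by move=> u v; rewrite -[u]qpi_repr -[v]qpi_repr !qaddE addrC. Qed.
Lemma qadd0 : left_id (qpi 0) qadd.
Proof. by move=> u; rewrite -[u]qpi_repr !qaddE add0r. Qed.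
Lemma qaddN : left_inverse (qpi 0) qopp qadd.
Proof. by move=> u; rewrite -[u]qpi_repr qoppE !qaddE addNr. Qed.
HB.instance Definition _ := GRing.isZmodule.Build quotm qaddA qaddC qadd0 qaddN.

Lemma qscaleA a b u : qscale a (qscale b u) = qscale (a * b) u.
Proof. by rewrite -[u]qpi_repr !qscaleE scalerA. Qed.
Lemma qscale1 : left_id 1 qscale.
Proof. by move=> u; rewrite -[u]qpi_repr !qscaleE scale1r. Qed.
Lemma qscaleDr : right_distributive qscale +%R.
Proof.
move=> a u v; rewrite -[u]qpi_repr -[v]qpi_repr.
by rewrite [LHS](congr1 (qscale a) (qaddE _ _)) !qscaleE [RHS]qaddE scalerDr.
Qed.
Lemma qscaleDl u : {morph qscale^~ u : a b / a + b}.
Proof. by move=> a b; rewrite -[u]qpi_repr !qscaleE [RHS]qaddE scalerDl. Qed.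
HB.instance Definition _ :=
  GRing.Zmodule_isLmodule.Build R quotm qscaleA qscale1 qscaleDr qscaleDl.

Lemma qpi_linear : linear qpi.
Proof. by move=> a x y; rewrite -qaddE -(qscaleE a x). Qed.
HB.instance Definition _ := GRing.isLinear.Build R M quotm *:%R qpi qpi_linear.

Lemma qpi_eq0 x : qpi x = 0 <-> P x.
Proof. by rewrite (qpiP x 0) subr0. Qed.

Lemma qpi_surj u : exists x, qpi x = u.
Proof. by exists (repr u); rewrite qpi_repr. Qed.

End QuotientModule.

Section Restriction.
Variables (A B : nzRingType) (phi : {rmorphism A -> B}).

Definition res_scalars (_ : {rmorphism A -> B}) (M : lmodType B) : Type := M.
HB.instance Definition _ (M : lmodType B) := GRing.Zmodule.on (res_scalars phi M).

Definition rscale (M : lmodType B) (a : A) (x : res_scalars phi M) :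
  res_scalars phi M := phi a *: (x : M).
Lemma rscaleA (M : lmodType B) a b (x : res_scalars phi M) :
  rscale a (rscale b x) = rscale (a * b) x.
Proof. by rewrite /rscale scalerA rmorphM. Qed.
Lemma rscale1 (M : lmodType B) : left_id 1 (@rscale M).
Proof. by move=> x; rewrite /rscale rmorph1 scale1r. Qed.
Lemma rscaleDr (M : lmodType B) : right_distributive (@rscale M) +%R.
Proof. by move=> a x y; rewrite /rscale scalerDr. Qed.
Lemma rscaleDl (M : lmodType B) x : {morph (@rscale M)^~ x : a b / a + b}.
Proof. by move=> a b; rewrite /rscale rmorphD scalerDl. Qed.
HB.instance Definition _ (M : lmodType B) :=
  GRing.Zmodule_isLmodule.Build A (res_scalars phi M)
    (@rscaleA M) (@rscale1 M) (@rscaleDr M) (@rscaleDl M).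

Lemma res_scaleE (M : lmodType B) (a : A) (x : M) :
  a *: (x : res_scalars phi M) = (phi a *: x : M).
Proof. by []. Qed.

End Restriction.

(** * Baer's criterion *)

Section Baer.
Variables (R : nzRingType) (E : lmodType R) (Cl : (R -> Prop) -> Prop).
Hypothesis ext_ideal : forall (J : R^o -> Prop) (h : R^o -> E),
  submodule J -> Cl J -> lin_on J h -> exists e, forall r, J r -> h r = r *: e.
Hypothesis enough_elements : forall (N : lmodType R) (D : N -> Prop),
  submodule D -> (exists n, ~ D n) ->
  exists2 n, ~ D n & Cl (fun r => D (r *: n)).

(** Testing ideals of the class [Cl] is enough because every proper submodule can be enlarged by an
    element whose colon ideal is in [Cl]; Zorn's lemma does the rest. *)
Theorem baer : injective_module E.
Proof.
move=> M N i f inji.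
(* Partial extensions are graphs in N * E, which avoids varying domains; the second clause makes a
   graph single-valued. *)
pose graph_ext (Ga : N * E -> Prop) := [/\ submodule (Ga : (N * E)%type -> Prop),
  forall e, Ga (0, e) -> e = 0 & forall x, Ga (i x, f x)].
pose T := {Ga | graph_ext Ga}.
pose le (s t : T) : bool := `[<forall z, sval s z -> sval t z>].
have t0 : T.
  exists (fun z => exists x, z = (i x, f x)); split=> [|e [x [ix ->]]|x].
  - split=> [|a _ _ [x ->] [y ->]]; first by exists 0; rewrite !linear0.
    by exists (a *: x + y); rewrite !linearP.
  - by rewrite (inji x 0) ?linear0.
  - by exists x.
have [||A totA|[Ga [sGa Ga0 Gaf]] maxG] := @classical_sets.ZL_preorder T t0 le.
- by move=> t; apply/asboolP.
- by move=> r s t /asboolP rs /asboolP st; apply/asboolP => z /rs /st.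
- have [[a Aa]|nA] := pselect (exists a, A a); last first.
    by exists t0 => s As; case: nA; exists s.
  have ubP : graph_ext (fun z => exists2 t, A t & sval t z).
    split=> [|e [t At]|x].
    + split; first by exists a => //; case: (svalP a) => -[].
      move=> c x y [s As sx] [t At ty].
      have [/asboolP st|/asboolP ts] := totA s t As At.
        by exists t => //; case: (svalP t) => -[_ +] _ _; apply => //; apply: st.
      by exists s => //; case: (svalP s) => -[_ +] _ _; apply => //; apply: ts.
    + by case: (svalP t) => _ + _; apply.
    + by exists a => //; case: (svalP a).
  by exists (exist _ _ ubP) => s As; apply/asboolP => z sz; exists s.
have [G0 GD] := sGa.
pose D n := exists e, Ga (n, e).
have sD : submodule D.
  split; first by exists 0.
  by move=> a x y [e xe] [e' ye]; exists (a *: e + e'); apply: (GD a (x, e) (y, e')).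
have fun_Ga n e e' : Ga (n, e) -> Ga (n, e') -> e = e'.
  move=> h h'; apply/eqP; rewrite -subr_eq0; apply/eqP/Ga0.
  by rewrite -(subrr n); apply: (submoduleB sGa h h').
have allD n : D n.
  apply: contrapT => nDn; have [{nDn}n nDn CJ] := enough_elements sD (ex_intro _ n nDn).
  have [g gP] : {g : N -> E & forall x, D x -> Ga (x, g x)}.
    apply: (@choice _ _ (fun x e => D x -> Ga (x, e))) => x.
    by have [[e xe]|nDx] := pselect (D x); [exists e | exists 0].
  pose J r := D (r *: n); pose h (r : R^o) := g (r *: n).
  have sJ : submodule (J : R^o -> Prop).
    split; first by rewrite /J scale0r; case: sD.
    by move=> a r s Jr Js; rewrite /J scalerDl -scalerA; case: sD => _; apply.
  have lh : lin_on (J : R^o -> Prop) h.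
    move=> a r s Jr Js; apply: (fun_Ga ((a *: r + s) *: n)).
      by apply: gP; case: sJ => _; apply.
    rewrite scalerDl -scalerA; by apply: (GD a (r *: n, h r) (s *: n, h s)); apply: gP.
  have [e he] := ext_ideal sJ CJ lh.
  (* The maximal graph is prolonged by (n, e). It stays single-valued because h is multiplication by
     e on the colon ideal of n. *)
  have extP : graph_ext (fun z => exists r y, Ga y /\ z = (y.1 + r *: n, y.2 + r *: e)).
    split.
    - split; first by exists 0, 0; split; [| rewrite !scale0r !addr0].
      move=> a _ _ [r [y [Gy ->]]] [s [z [Gz ->]]].
      exists (a * r + s), (a *: y + z); split; first exact: GD.
      by rewrite !scalerDl -!scalerA; congr (_, _) => /=; rewrite scalerDr addrACA.
    - move=> e' [r [[y w] [Gy [y0 ->]]]] /=.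
      have yE : y = (- r) *: n by apply/eqP; rewrite scaleNr -addr_eq0 -y0.
      have Jr : J (- r) by exists w; rewrite -yE.
      have := he _ Jr; rewrite /h -yE => gE.
      have -> : w = g y by apply: (fun_Ga y) => //; apply: gP; exists w.
      by rewrite gE scaleNr addNr.
    - by move=> x; exists 0, (i x, f x); rewrite !scale0r !addr0.
  have ub : le (exist _ Ga (And3 sGa Ga0 Gaf)) (exist _ _ extP).
    by apply/asboolP => z Gz; exists 0, z; rewrite !scale0r !addr0; case: z Gz.
  have /asboolP/(_ (n, e)) Gn := maxG _ ub; apply: nDn; exists e; apply: Gn.
  by exists 1, 0; split=> //; rewrite !scale1r !add0r.
have [g gP] := choice allD.
have lg : linear g.
  move=> a x y; apply: (fun_Ga (a *: x + y)) => //.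
  by apply: (GD a (x, g x) (y, g y)).
exists (mkLinear lg) => x; apply: (fun_Ga (i x)) => //; exact: gP.
Qed.
End Baer.

Lemma vector_space_injective (K : fieldType) (E : lmodType K) : injective_module E.
Proof.
apply: (@baer _ _ (fun=> True)) => [J h sJ _ lh|N D _ [n nDn]]; last by exists n.
have [[r [r0 Jr]]|nJ] := pselect (exists r : K, r != 0 /\ J r).
  have J1 : J 1 by rewrite -(mulVf r0); apply: (submoduleZ r^-1 sJ Jr).
  exists (h 1) => s _; rewrite -(lin_onZ _ sJ lh) //.
  by congr (h _); rewrite /GRing.scale /= mulr1.
exists 0 => r Jr; rewrite scaler0; have [->|r0] := eqVneq r 0; first exact: lin_on0 lh.
by case: nJ; exists r.
Qed.

(** * Cosyzygies and Schanuel's lemma *)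

Section LinearAlgebra.
Variable R : nzRingType.

Lemma linear_factor (A B X : lmodType R) (p : {linear A -> B}) (f : {linear A -> X}) :
  (forall b, exists a, p a = b) -> (forall a, p a = 0 -> f a = 0) ->
  exists g : {linear B -> X}, forall a, g (p a) = f a.
Proof.
move=> surj ker; have [s sP] := choice surj.
have fE a b : p a = p b -> f a = f b.
  move=> pab; apply/eqP; rewrite -subr_eq0 -linearB; apply/eqP/ker.
  by rewrite linearB pab subrr.
have lg : linear (f \o s).
  by move=> a x y; rewrite /comp -linearP; apply: fE; rewrite linearP !sP.
by exists (mkLinear lg) => a; apply: fE; rewrite sP.
Qed.

Lemma injective_prod (E F : lmodType R) :
  injective_module E -> injective_module F -> injective_module (E * F)%type.
Proof.
move=> injE injF M N i f inji.
have [g gP] := injE M N i (fst \o f) inji.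
have [h hP] := injF M N i (snd \o f) inji.
have lgh : linear (fun x => (g x, h x)) by move=> a x y; rewrite !linearP.
by exists (mkLinear lgh) => x; rewrite /= /linear_fun_of gP hP /=; case: (f x).
Qed.

Lemma injective_zero : injective_module 'rV[R]_0.
Proof.
by move=> M N i f inji; exists \0 => x; rewrite [RHS]thinmx0 [LHS]thinmx0.
Qed.

(** Y' is a summand of Y up to an injective module. One direction suffices, since injectivity only
    has to pass from Y to Y'. *)
Definition retract (Y' Y : lmodType R) := exists2 J : lmodType R, injective_module J &
  exists (i : {linear Y' -> (Y * J)%type}) (r : {linear (Y * J)%type -> Y'}), cancel i r.

Lemma retract_refl (Y : lmodType R) : retract Y Y.
Proof.
exists ('rV[R]_0 : lmodType R); first exact: injective_zero.
have li : linear (fun y : Y => (y, 0 : 'rV[R]_0)).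
  by move=> a x y; congr pair; rewrite /= scaler0 addr0.
by exists (mkLinear li), fst.
Qed.

Lemma retract_injective (Y' Y : lmodType R) :
  retract Y' Y -> injective_module Y -> injective_module Y'.
Proof.
move=> [J injJ [i [r ir]]] injY M N j f injj.
have [g gP] := injective_prod injY injJ (i \o f) injj.
by exists (r \o g) => x; rewrite /= gP /= ir.
Qed.

Record cosyzygy (Y E Q : lmodType R) := Cosyzygy {
  cs_in : {linear Y -> E};
  cs_out : {linear E -> Q};
  cs_inj : injective cs_in;
  cs_surj : forall q, exists e, cs_out e = q;
  cs_exact : forall e, cs_out e = 0 <-> exists y, e = cs_in y }.

Lemma cs_comp (Y E Q : lmodType R) (c : cosyzygy Y E Q) y : cs_out c (cs_in c y) = 0.
Proof. by apply/cs_exact; exists y. Qed.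

(* Schanuel: both cosyzygies sit, up to injective summands, in the same pushout. *)
Lemma retract_cosyzygy (Y E Q Y' E' Q' : lmodType R)
    (c : cosyzygy Y E Q) (c' : cosyzygy Y' E' Q') :
  injective_module E -> injective_module E' -> retract Y' Y -> retract Q' Q.
Proof.
move=> injE injE' [J injJ [i [r ir]]].
have lj : linear (fun z : Y * J => (cs_in c z.1, z.2) : E * J).
  by move=> a x y; congr pair; rewrite /= linearP.
pose j := mkLinear lj.
have injj : injective j by move=> [x x'] [y y'] [] /cs_inj -> ->.
have [al alP] := injective_prod injE injJ (j \o i) (cs_inj (c := c')).
have [be beP] := injE' _ _ j (cs_in c' \o r) injj.
(* On the image of Y' the map [be] undoes [al], so the error e - be (al e) vanishes there and the
   pair descends to Q'. *)
have lf : linear (fun e => (cs_out c (al e).1, e - be (al e)) : Q * E').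
  move=> a x y; congr pair; first by rewrite /= !linearP.
  by rewrite /= (linearP al) (linearP be) opprD addrACA scalerBr.
have lb : linear (fun e => cs_out c' (be (e, 0))).
  move=> a x y; rewrite -linearP -linearP; congr (cs_out c' (be _)).
  by congr pair; rewrite /= scaler0 addr0.
have [i' i'P] : exists i' : {linear Q' -> (Q * E')%type},
    forall e, i' (cs_out c' e) = (cs_out c (al e).1, e - be (al e)).
  have [|g gP] := linear_factor (cs_surj c') (f := mkLinear lf).
    move=> _ /(cs_exact c')[y ->]; rewrite /= /linear_fun_of alP /= cs_comp.
    by rewrite (beP (i y)) /= ir subrr.
  by exists g.
have [be' be'P] : exists be' : {linear Q -> Q'},
    forall e, be' (cs_out c e) = cs_out c' (be (e, 0)).
  have [|g gP] := linear_factor (cs_surj c) (f := mkLinear lb); last by exists g.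
  move=> _ /(cs_exact c)[y ->]; rewrite /= /linear_fun_of.
  by have /= -> := beP (y, 0); rewrite cs_comp.
have lr : linear (fun z : Q * E' => be' z.1 + cs_out c' z.2).
  by move=> a x y; rewrite /= !linearP scalerDr addrACA.
exists E' => //; exists i', (mkLinear lr) => q; have [e <-] := cs_surj c' q.
rewrite i'P /= /linear_fun_of /= be'P linearB.
have beE : be (al e) = be ((al e).1, 0) + be (0, (al e).2).
  by rewrite -(linearD be); congr (be _); case: (al e) => u v; congr pair; rewrite /= ?addr0 ?add0r.
have be0 : cs_out c' (be (0, (al e).2)) = 0.
  by have := beP (0, (al e).2); rewrite /= /linear_fun_of /= linear0 => ->; rewrite cs_comp.
rewrite beE (linearD (cs_out c')) be0 addr0.
by rewrite addrC subrK.
Qed.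

Lemma finite_injective_dimension_injective (M : lmodType R) :
  injective_module M -> finite_injective_dimension M.
Proof.
move=> injM.
pose E k : lmodType R := if k is 0 then M else 'rV[R]_0.
pose d k : {linear E k -> E k.+1} := \0.
have E0 k (x y : E k.+1) : x = y by rewrite [x]thinmx0 [y]thinmx0.
exists 0%N, E, idfun, d; split.
- by case=> // k; apply: injective_zero.
- by [].
- by move=> y; split=> [_|_]; [exists y | apply: E0].
- by move=> k y; split=> [_|_]; [exists 0; apply: E0 | apply: E0].
- by case=> // k _ x; apply: E0.
Qed.

Lemma finite_injective_dimension_cosyzygy (Y E Q : lmodType R) (c : cosyzygy Y E Q) :
  injective_module E -> finite_injective_dimension Q -> finite_injective_dimension Y.
Proof.
move=> injE [n [F [eps [d [injF injeps ex0 exS F0]]]]].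
pose F' k : lmodType R := if k is k'.+1 then F k' else E.
pose d' k : {linear F' k -> F' k.+1} :=
  match k return {linear F' k -> F' k.+1} with 0 => eps \o cs_out c | k'.+1 => d k' end.
exists n.+1, F', (cs_in c), d'; split=> //.
- by case.
- exact: cs_inj.
- move=> y; rewrite /= -(cs_exact c); split=> [h|->]; last by rewrite linear0.
  by apply: injeps; rewrite h linear0.
- case=> [|k] y /=; last exact: exS.
  rewrite ex0; split=> -[x ->]; last by exists (cs_out c x).
  by have [e <-] := cs_surj c x; exists e.
- by case=> // k; apply: F0.
Qed.

End LinearAlgebra.

(** * Coinduced modules *)

Section Coinduced.
Variables (K : fieldType) (R : comNzRingType) (kap : {rmorphism K -> R}).

Record coind (C : lmodType R) : Type := Coind {
  cfun :> R -> C;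
  cfunP : forall k a b, cfun (kap k * a + b) = kap k *: cfun a + cfun b }.

Section CoindModule.
Variable C : lmodType R.
Implicit Types f g : coind C.

HB.instance Definition _ := gen_eqMixin (coind C).
HB.instance Definition _ := gen_choiceMixin (coind C).

Lemma coind_ext f g : cfun f =1 cfun g -> f = g.
Proof.
case: f g => [f fP] [g gP] /= /funext efg; case: _ / efg in gP *.
by congr Coind; apply: Prop_irrelevance.
Qed.

Lemma coindD f a b : f (a + b) = f a + f b.
Proof. by have := cfunP f 1 a b; rewrite rmorph1 mul1r scale1r. Qed.

Lemma coind0 f : f 0 = 0.
Proof. by apply: (addrI (f 0)); rewrite -coindD !addr0. Qed.

Lemma coindZ f k a : f (kap k * a) = kap k *: f a.
Proof. by have := cfunP f k a 0; rewrite !addr0 coind0 addr0. Qed.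

Lemma coind_sum f (I : Type) (r : seq I) (F : I -> R) :
  f (\sum_(i <- r) F i) = \sum_(i <- r) f (F i).
Proof. by elim: r => [|i r IH]; rewrite ?big_nil ?coind0 // !big_cons coindD IH. Qed.

Fact coind_add_subproof f g k a b :
  f (kap k * a + b) + g (kap k * a + b) = kap k *: (f a + g a) + (f b + g b).
Proof. by rewrite !cfunP scalerDr addrACA. Qed.
Definition coind_add f g := Coind (coind_add_subproof f g).
Fact coind_opp_subproof f k a b : - f (kap k * a + b) = kap k *: (- f a) + (- f b).
Proof. by rewrite cfunP opprD scalerN. Qed.
Definition coind_opp f := Coind (coind_opp_subproof f).
Fact coind_zero_subproof k (a b : R) : 0 = kap k *: (0 : C) + 0.
Proof. by rewrite scaler0 addr0. Qed.
Definition coind_zero : coind C := @Coind C (fun=> 0) coind_zero_subproof.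
Fact coind_scale_subproof c f k a b :
  f ((kap k * a + b) * c) = kap k *: f (a * c) + f (b * c).
Proof. by rewrite mulrDl -mulrA cfunP. Qed.
Definition coind_scale c f := Coind (coind_scale_subproof c f).

Lemma coind_addA : associative coind_add.
Proof. by move=> f g h; apply: coind_ext => a /=; rewrite addrA. Qed.
Lemma coind_addC : commutative coind_add.
Proof. by move=> f g; apply: coind_ext => a /=; rewrite addrC. Qed.
Lemma coind_add0 : left_id coind_zero coind_add.
Proof. by move=> f; apply: coind_ext => a /=; rewrite add0r. Qed.
Lemma coind_addN : left_inverse coind_zero coind_opp coind_add.
Proof. by move=> f; apply: coind_ext => a /=; rewrite addNr. Qed.
HB.instance Definition _ :=
  GRing.isZmodule.Build (coind C) coind_addA coind_addC coind_add0 coind_addN.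

Lemma coind_scaleA a b f : coind_scale a (coind_scale b f) = coind_scale (a * b) f.
Proof. by apply: coind_ext => c /=; rewrite mulrA. Qed.
Lemma coind_scale1 : left_id 1 coind_scale.
Proof. by move=> f; apply: coind_ext => c /=; rewrite mulr1. Qed.
Lemma coind_scaleDr : right_distributive coind_scale +%R.
Proof. by move=> a f g; apply: coind_ext => c. Qed.
Lemma coind_scaleDl f : {morph coind_scale^~ f : a b / a + b}.
Proof. by move=> a b; apply: coind_ext => c /=; rewrite mulrDr coindD. Qed.
HB.instance Definition _ := GRing.Zmodule_isLmodule.Build R (coind C)
  coind_scaleA coind_scale1 coind_scaleDr coind_scaleDl.

Lemma coind_scaleE a f b : (a *: f) b = f (b * a). Proof. by []. Qed.
Lemma coind_addE f g b : (f + g) b = f b + g b. Proof. by []. Qed.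
Fact coind_in_subproof (c : C) k a b :
  (kap k * a + b) *: c = kap k *: (a *: c) + b *: c.
Proof. by rewrite scalerDl scalerA. Qed.
Definition coind_in (c : C) : coind C := Coind (coind_in_subproof c).
Lemma coind_in_linear : linear coind_in.
Proof.
by move=> a x y; apply: coind_ext => b /=; rewrite scalerDr !scalerA.
Qed.
HB.instance Definition _ := GRing.isLinear.Build R C (coind C) *:%R coind_in coind_in_linear.
Lemma coind_in_inj : injective coind_in.
Proof. by move=> x y /(congr1 (fun f : coind C => f 1)) /=; rewrite !scale1r. Qed.

(** Evaluation at 1 identifies R-maps into [coind C] with K-maps into C, and K-maps always extend.
    An extension g returns as n |-> (a |-> g (a n)). *)
Theorem coind_injective : injective_module (coind C).
Proof.
move=> M N i f inji.
have lf1 : linear (fun m : res_scalars kap M => f m 1 : res_scalars kap C).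
  by move=> k x y; rewrite [f _]linearP coind_addE coind_scaleE mul1r -[kap k]mulr1 coindZ.
have li : linear (i : res_scalars kap M -> res_scalars kap N).
  by move=> k x y; apply: linearP.
have [g gP] := @vector_space_injective K (res_scalars kap C) _ _ (mkLinear li) (mkLinear lf1) inji.
have hP n k a b : (g ((kap k * a + b) *: n : N) : C) =
    kap k *: (g (a *: n : N) : C) + g (b *: n : N).
  rewrite scalerDl -scalerA; exact: (linearP g k (a *: n : N) (b *: n : N)).
pose h n : coind C := @Coind C (fun a => g (a *: n : N)) (hP n).
have lh : linear h.
  move=> a x y; apply: coind_ext => b; rewrite /= scalerDr scalerA.
  by have := linearP g 1 ((b * a) *: x : N) (b *: y : N); rewrite !scale1r.
exists (mkLinear lh) => x; apply: coind_ext => a; rewrite /= -linearZ.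
by have -> := gP (a *: x : M); rewrite /= /linear_fun_of linearZ coind_scaleE mul1r.
Qed.

Definition coker_rel (e : coind C) := exists y, e = coind_in y.
Lemma coker_submodule : submodule coker_rel.
Proof.
split; first by exists 0; rewrite linear0.
by move=> a _ _ [x ->] [y ->]; exists (a *: x + y); rewrite linearP.
Qed.

Definition coker : lmodType R := quotm coker_submodule.
Definition coker_cosyzygy : cosyzygy C (coind C) coker :=
  @Cosyzygy R C (coind C) coker coind_in (@qpi _ _ _ coker_submodule)
    coind_in_inj (@qpi_surj _ _ _ coker_submodule) (@qpi_eq0 _ _ _ coker_submodule).
End CoindModule.

Fixpoint cosyz (Y : lmodType R) k : lmodType R :=
  if k is k'.+1 then coker (cosyz Y k') else Y.

Lemma cosyzP (Y : lmodType R) k :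
  cosyzygy (cosyz Y k) (coind (cosyz Y k)) (cosyz Y k.+1).
Proof. exact: coker_cosyzygy. Qed.

Lemma finite_injective_dimension_cosyz (Y : lmodType R) k :
  injective_module (cosyz Y k) -> finite_injective_dimension Y.
Proof.
elim: k => [|k IH] in Y *; first exact: finite_injective_dimension_injective.
move=> inj; apply: (finite_injective_dimension_cosyzygy (coker_cosyzygy Y)).
  exact: coind_injective.
apply: IH; suff -> : cosyz (coker Y) k = cosyz Y k.+1 by [].
by elim: k {inj} => //= k ->.
Qed.
End Coinduced.

(** * Injectivity over a ring of fractions *)

Section FractionRing.
Variables (A L : comNzRingType) (phi : {rmorphism A -> L}).
Hypothesis frac : forall l, exists a s t, phi s * t = 1 /\ l = phi a * t.
Hypothesis frac_eq0 : forall a, phi a = 0 -> exists u t, phi u * t = 1 /\ u * a = 0.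

(** Denominators act invertibly on both modules, so a map commuting with them commutes with their
    inverses. *)
Lemma frac_linear (M N : lmodType L) (g : res_scalars phi M -> res_scalars phi N) :
  linear g -> linear (g : M -> N).
Proof.
move=> lg; pose g' : {linear res_scalars phi M -> res_scalars phi N} := mkLinear lg.
pose gM (x : M) : N := g x.
have gA a (x : M) : gM (phi a *: x) = phi a *: gM x.
  exact: (linearZ_LR g' a x).
have gZ l (x : M) : gM (l *: x) = l *: gM x.
  have [a [s [t [st ->]]]] := frac l.
  have ts : t * phi s = 1 by rewrite mulrC.
  transitivity (t *: (phi s *: gM ((phi a * t) *: x))).
    by rewrite scalerA ts scale1r.
  by rewrite -gA scalerA mulrCA st mulr1 gA scalerA mulrC.
by move=> l x y; rewrite -[RHS]/(l *: gM x + gM y) -gZ; apply: (raddfD g').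
Qed.

Lemma injective_of_res (E : lmodType L) :
  injective_module (res_scalars phi E : lmodType A) -> injective_module E.
Proof.
move=> injE M N i f inji.
have li : linear (i : res_scalars phi M -> res_scalars phi N) by move=> a x y; apply: linearP.
have lf : linear (f : res_scalars phi M -> res_scalars phi E) by move=> a x y; apply: linearP.
have [g gP] := injE _ _ (mkLinear li) (mkLinear lf) inji.
by exists (mkLinear (frac_linear (linearP g))).
Qed.

(** Baer's criterion over A: a map h on an ideal J extends to J L by a/s |-> h(a)/s, then to L by
    injectivity there, and its value at 1 is the required element. *)
Lemma res_injective (E : lmodType L) :
  injective_module E -> injective_module (res_scalars phi E : lmodType A).
Proof.
move=> injE; apply: (@baer _ _ (fun=> True)) => [J h sJ _ lh|N D _ [n nDn]]; last by exists n.
(* [fr l (a, s, t)]: l is the fraction a/s with numerator in J, and t is the inverse of s. *)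
pose fr (l : L) (z : A * A * L) :=
  [/\ J z.1.1, phi z.1.2 * z.2 = 1 & l = phi z.1.1 * z.2].
pose JL (l : L^o) := exists z, fr l z.
pose val (z : A * A * L) : E := z.2 *: (h z.1.1 : E).
have hZ a r : J r -> h (a * r) = phi a *: (h r : E) :> E by apply: (lin_onZ a sJ lh).
have val_uniq l z z' : fr l z -> fr l z' -> val z = val z'.
  case: z z' => [[a s] t] [[a' s'] t'] [/= Ja st lE] [/= Ja' st' lE'].
  have ker : phi (s' * a - s * a') = 0.
    rewrite rmorphB !rmorphM; apply/eqP; rewrite subr_eq0; apply/eqP.
    have -> : phi a = l * phi s by rewrite lE -mulrA [t * _]mulrC st mulr1.
    have -> : phi a' = l * phi s' by rewrite lE' -mulrA [t' * _]mulrC st' mulr1.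
    by ring.
  have [u [v [uv]]] := frac_eq0 ker; rewrite mulrBr => /eqP; rewrite subr_eq0 => /eqP e.
  have := congr1 h e; rewrite !mulrA !hZ // !rmorphM => /(congr1 (fun w : E => (v * t * t') *: w)).
  rewrite !scalerA /val /=.
  have -> : v * t * t' * (phi u * phi s') = t * ((phi u * v) * (phi s' * t')) by ring.
  have -> : v * t * t' * (phi u * phi s) = t' * ((phi u * v) * (phi s * t)) by ring.
  by rewrite uv st st' !mulr1.
have [hL hLP] : {hL : L^o -> E & forall l z, fr l z -> hL l = val z}.
  apply: (@choice _ _ (fun l e => forall z, fr l z -> e = val z)) => l.
  have [[z frz]|nz] := pselect (exists z, fr l z).
    by exists (val z) => z'; apply: val_uniq.
  by exists 0 => z frz; case: nz; exists z.
have frD l a s t m b r v c d q : fr l (a, s, t) -> fr m (b, r, v) -> phi d * q = 1 ->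
    fr (phi c * q * l + m) (c * a * r + b * s * d, s * r * d, t * v * q).
  move=> [/= Ja st ->] [/= Jb rv ->] dq; split=> /=.
  - have -> : c * a * r + b * s * d = (c * r) * a + (s * d) * b by ring.
    exact: (submoduleD sJ (submoduleZ _ sJ Ja) (submoduleZ _ sJ Jb)).
  - transitivity ((phi s * t) * (phi r * v) * (phi d * q)); first by rewrite !rmorphM; ring.
    by rewrite st rv dq !mulr1.
  - rewrite rmorphD !rmorphM.
    transitivity (phi c * phi a * t * q * (phi r * v) + phi b * v * (phi s * t) * (phi d * q)).
      by rewrite rv st dq !mulr1; ring.
    by ring.
have sJL : submodule JL.
  split; first by exists (0, 1, 1); split; rewrite /= ?rmorph1 ?rmorph0 ?mulr1 ?mul0r //; case: sJ.
  move=> c l m [[[a s] t] fl] [[[b r] v] fm].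
  have [c' [d [q [dq ->]]]] := frac c.
  by exists (c' * a * r + b * s * d, s * r * d, t * v * q); apply: frD.
have lhL : lin_on JL hL.
  move=> c l m [[[a s] t] fl] [[[b r] v] fm].
  have [c' [d [q [dq ->]]]] := frac c.
  rewrite (hLP _ _ (frD _ _ _ _ _ _ _ _ c' d q fl fm dq)) (hLP _ _ fl) (hLP _ _ fm) /val /=.
  case: fl fm => /= Ja st _ [/= Jb rv _].
  have -> : c' * a * r + b * s * d = (c' * r) * a + (s * d) * b by ring.
  rewrite (lin_onD lh (submoduleZ _ sJ Ja) (submoduleZ _ sJ Jb)) !hZ //.
  rewrite scalerDr !scalerA; congr (_ *: _ + _ *: _).
    transitivity (phi c' * q * t * (phi r * v)); first by rewrite rmorphM; ring.
    by rewrite rv mulr1.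
  transitivity (v * (phi s * t) * (phi d * q)); first by rewrite rmorphM; ring.
  by rewrite st dq !mulr1.
have [g gP] := injective_extend injE sJL lhL.
exists (g 1) => a Ja; have fra : fr (phi a) (a, 1, 1) by split; rewrite /= ?rmorph1 ?mulr1.
have := gP (phi a) (ex_intro _ _ fra).
rewrite (hLP _ _ fra) /val /= scale1r => <-.
by rewrite res_scaleE -linearZ; congr (g _); rewrite /GRing.scale /= mulr1.
Qed.

Definition res_cosyzygy (Y E Q : lmodType L) (c : cosyzygy Y E Q) :
  cosyzygy (res_scalars phi Y : lmodType A) (res_scalars phi E : lmodType A)
           (res_scalars phi Q : lmodType A).
Proof.
have li : linear (cs_in c : res_scalars phi Y -> res_scalars phi E).
  by move=> a x y; apply: linearP.
have lo : linear (cs_out c : res_scalars phi E -> res_scalars phi Q).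
  by move=> a x y; apply: linearP.
exact: (@Cosyzygy A (res_scalars phi Y) (res_scalars phi E) (res_scalars phi Q)
  (mkLinear li) (mkLinear lo) (@cs_inj _ _ _ _ c) (@cs_surj _ _ _ _ c) (@cs_exact _ _ _ _ c)).
Defined.

Variables (K : fieldType) (kap : {rmorphism K -> A}).

(** Coinduction over A and over L gives different cosyzygies. Injectives over L stay injective over
    A, so Schanuel's lemma makes each cosyzygy over L a retract of the one over A, from which it
    inherits injectivity. *)
Lemma fraction_ring_injdim k :
  injective_module (cosyz kap (res_scalars phi L^o) k) ->
  finite_injective_dimension L^o.
Proof.
move=> injA; pose kapL : {rmorphism K -> L} := phi \o kap.
apply: (@finite_injective_dimension_cosyz _ _ kapL _ k); apply: injective_of_res.
apply: retract_injective injA.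
elim: k => [|k IH]; first exact: retract_refl.
apply: retract_cosyzygy (cosyzP kap _ k) (res_cosyzygy (cosyzP kapL _ k)) _ _ IH.
  exact: coind_injective.
by apply: res_injective; apply: coind_injective.
Qed.

End FractionRing.

(** * Edge rings *)

Section IndependentSets.
Variables (T : finType) (G : sgraph T).
Implicit Types (S : {set T}) (x y : T).

Lemma independentP S :
  reflect (forall x y, x \in S -> y \in S -> ~~ G x y) (independent G S).
Proof.
apply: (iffP 'forall_in_forall_inP) => h x => [y xS yS|xS y yS]; exact: h.
Qed.

Lemma independentPn S :
  ~~ independent G S -> exists x y, [/\ x \in S, y \in S & G x y].
Proof.
by case/forall_inPn=> x xS /forall_inPn[y yS]; rewrite negbK => xy; exists x, y.
Qed.

Lemma independentS S S' : S \subset S' -> independent G S' -> independent G S.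
Proof.
by move=> /subsetP sub /independentP h; apply/independentP => x y /sub xS /sub; apply: h.
Qed.

Lemma independent0 : independent G set0.
Proof. by apply/independentP => x y; rewrite inE. Qed.

Lemma independent1 x : independent G [set x].
Proof. by apply/independentP => y z /set1P-> /set1P->; rewrite adj_irr. Qed.

Lemma independentU1 x S :
  independent G (x |: S) = independent G S && [forall y in S, ~~ G x y].
Proof.
apply/independentP/andP => [h|[/independentP hS /forall_inP hx] y z].
  split; first by apply/independentP => y z yS zS; apply: h; rewrite !inE ?yS ?zS orbT.
  by apply/forall_inP => y yS; apply: h; rewrite !inE ?eqxx ?yS ?orbT.
move=> /setU1P[->|yS] /setU1P[->|zS]; rewrite ?adj_irr //.
- exact: hx.
- by rewrite adj_sym; apply: hx.
- exact: hS.
Qed.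
End IndependentSets.

Section EdgeRing.
Variables (K : fieldType) (n : nat) (G : sgraph 'I_n).
Local Notation R := {mpoly K[n]}.

Definition edge_ring : comNzRingType := {ideal_quot (@edge_ideal K n G)}.
Local Notation A := edge_ring.

Definition edge_pi : R -> A := \pi_({ideal_quot (@edge_ideal K n G)}).
HB.instance Definition _ := GRing.RMorphism.copy edge_pi
  (\pi_({ideal_quot (@edge_ideal K n G)}) : R -> {ideal_quot (@edge_ideal K n G)}).

Definition scalar_pi : {rmorphism K -> A} := edge_pi \o @mpolyC n K.
Arguments scalar_pi : simpl never.
Definition mon (m : 'X_{1..n}) : A := edge_pi 'X_[m].
Definition var (i : 'I_n) : A := mon U_(i)%MM.

Definition msup (m : 'X_{1..n}) : {set 'I_n} := [set i | m i != 0%N].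
Definition indep_mon m := independent G (msup m).

Lemma msupD m m' : msup (m + m')%MM = msup m :|: msup m'.
Proof. by apply/setP => i; rewrite !inE mnmDE addn_eq0 negb_and. Qed.

Lemma msup1 i : msup U_(i)%MM = [set i].
Proof. by apply/setP => j; rewrite !inE mnm1E [j == i]eq_sym; case: (i == j). Qed.

Lemma indep_mon_addl m m' : indep_mon (m + m')%MM -> indep_mon m.
Proof. by apply: independentS; rewrite msupD subsetUl. Qed.

(** I(G) is a monomial ideal, and a monomial lies in it exactly when its support contains an
    edge. *)
Lemma edge_idealP (q : R) :
  reflect (forall m, indep_mon m -> q@_m = 0) (q \in @edge_ideal K n G).
Proof.
apply: (iffP idP) => [/asboolP[s sX ->] m im|h].
  rewrite raddf_sum /= big_seq big1 // => -[p e] /sX /= [i [j [Gij ->]]].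
  rewrite (mpolyE p) mulr_suml raddf_sum /= big1 // => m' _.
  rewrite -scalerAl -!mpolyXD mcoeffZ mcoeffX; case: eqP => [mE|]; last by rewrite mulr0.
  move: im; rewrite -mE /indep_mon !msupD !msup1 => /independentP/(_ i j).
  by rewrite !inE !eqxx !orbT => /(_ isT isT); rewrite Gij.
suff h' m : q@_m *: 'X_[m] \in @edge_ideal K n G.
  by rewrite (mpolyE q); apply: (big_ind (fun x => x \in @edge_ideal K n G));
     [exact: idealr0 | move=> x y; apply: rpredD | ].
have [im|] := boolP (indep_mon m); first by rewrite h // scale0r idealr0.
case/independentPn=> i [j []]; rewrite !inE => mi mj Gij.
have ij : i != j by apply: contraTneq Gij => ->; rewrite adj_irr.
have -> : m = (m - (U_(i) + U_(j)) + (U_(i) + U_(j)))%MM.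
  rewrite submK //; apply/mnm_lepP => k; rewrite mnmDE !mnm1E.
  have [<-|_] := eqVneq i k; first by rewrite eq_sym (negPf ij) /= lt0n.
  by have [<-|//] := eqVneq j k; rewrite /= lt0n.
rewrite mpolyXD -mul_mpolyC mulrA idealMr //.
apply/asboolP; exists [:: (1, 'X_i * 'X_j)].
  by move=> p; rewrite inE => /eqP ->; exists i, j.
by rewrite big_seq1 mul1r mpolyXD.
Qed.

Lemma edge_pi_eq (p q : R) :
  edge_pi p = edge_pi q <-> forall m, indep_mon m -> p@_m = q@_m.
Proof.
split=> [/eqP|h].
  rewrite -Quotient.idealrBE => /edge_idealP h m /h /eqP.
  by rewrite mcoeffB subr_eq0 => /eqP.
apply/eqP; rewrite -Quotient.idealrBE; apply/edge_idealP => m /h e.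
by rewrite mcoeffB e subrr.
Qed.

Lemma edge_pi_surj (a : A) : exists p, edge_pi p = a.
Proof. by exists (repr a); rewrite /edge_pi reprK. Qed.

(** [repr a] is determined only modulo I(G), which fixes its coefficients at independent monomials;
    these are the coordinates of a in the monomial basis. *)
Definition cf (m : 'X_{1..n}) (a : A) : K := if indep_mon m then (repr a)@_m else 0.

Lemma cf_pi m p : cf m (edge_pi p) = if indep_mon m then p@_m else 0.
Proof.
rewrite /cf; case: ifP => // im.
have /edge_pi_eq -> // : edge_pi (repr (edge_pi p)) = edge_pi p by rewrite /edge_pi reprK.
Qed.

Lemma cfP k a b m : cf m (scalar_pi k * a + b) = k * cf m a + cf m b.
Proof.
have [[p <-] [q <-]] := (edge_pi_surj a, edge_pi_surj b).
rewrite -[scalar_pi k]/(edge_pi k%:MP) -rmorphM -rmorphD !cf_pi; case: ifP => _; last by rewrite mulr0 addr0.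
by rewrite mcoeffD mul_mpolyC mcoeffZ.
Qed.

Lemma cfD a b m : cf m (a + b) = cf m a + cf m b.
Proof. by have := cfP 1 a b m; rewrite rmorph1 !mul1r. Qed.
Lemma cf0 m : cf m 0 = 0.
Proof. by apply: (addrI (cf m 0)); rewrite -cfD !addr0. Qed.
Lemma cf_ext a b : (forall m, indep_mon m -> cf m a = cf m b) -> a = b.
Proof.
have [[p <-] [q <-]] := (edge_pi_surj a, edge_pi_surj b).
by move=> h; apply/edge_pi_eq => m im; have := h m im; rewrite !cf_pi im.
Qed.

Lemma cf_mon m m' : cf m (mon m') = (indep_mon m && (m' == m))%:R.
Proof. by rewrite cf_pi mcoeffX; case: ifP. Qed.

Lemma monD m m' : mon (m + m')%MM = mon m * mon m'.
Proof. by rewrite /mon mpolyXD rmorphM. Qed.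
Lemma mon0 : mon 0%MM = 1.
Proof. by rewrite /mon mpolyX0 rmorph1. Qed.
Lemma mon_eq0 m : ~~ indep_mon m -> mon m = 0.
Proof.
move=> im; apply: cf_ext => m' im'; rewrite cf_mon cf0 im' /=.
by case: eqP => // mm; rewrite mm im' in im.
Qed.

Lemma edge_var i j : G i j -> var i * var j = 0.
Proof.
move=> Gij; rewrite -monD mon_eq0 // /indep_mon msupD !msup1.
by apply/independentP => /(_ i j); rewrite !inE !eqxx orbT Gij => /(_ isT isT).
Qed.

Lemma edge_ring_expand a :
  exists s : seq 'X_{1..n}, a = \sum_(m <- s) scalar_pi (cf m a) * mon m.
Proof.
have [p <-] := edge_pi_surj a; exists (msupp p).
rewrite {1}(mpolyE p) rmorph_sum /=; apply: eq_bigr => m _.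
rewrite -mul_mpolyC rmorphM cf_pi; case: ifP => [//|/negbT im].
by rewrite -[X in _ * X = _]/(mon m) (mon_eq0 im) !mulr0.
Qed.

Lemma cf_finite a : exists s : seq 'X_{1..n}, uniq s /\ forall m, cf m a != 0 -> m \in s.
Proof.
have [p <-] := edge_pi_surj a; exists (msupp p); split; first exact: msupp_uniq.
by move=> m; rewrite cf_pi mcoeff_msupp; case: ifP; rewrite ?eqxx.
Qed.

Lemma cf_mulmon m k a : indep_mon (m + k)%MM -> cf (m + k)%MM (a * mon k) = cf m a.
Proof.
move=> im; have [p <-] := edge_pi_surj a.
rewrite -[mon k]/(edge_pi 'X_[k]) -rmorphM !cf_pi im (indep_mon_addl im).
by rewrite [(m + k)%MM]addmC [LHS]mcoeffMX.
Qed.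

Section Functional.
Variable C : lmodType A.

(** Values on the monomial basis may be prescribed freely. [fE] replaces the support by any larger
    list without repetitions, so that a, b and their combination are compared over one list. *)
Fact flin_subproof (v : 'X_{1..n} -> C) k a b : let f c :=
    \sum_(m <- msupp (repr c)) scalar_pi (cf m c) *: v m in
  f (scalar_pi k * a + b) = scalar_pi k *: f a + f b.
Proof.
move=> f.
have fE c s : uniq s -> (forall m, cf m c != 0 -> m \in s) ->
    f c = \sum_(m <- s) scalar_pi (cf m c) *: v m.
  move=> us sP; rewrite /f (bigID (fun m => cf m c == 0)) /= big1 ?add0r; last first.
    by move=> m /eqP ->; rewrite rmorph0 scale0r.
  rewrite [RHS](bigID (fun m => cf m c == 0)) /= [X in _ = X + _]big1 ?add0r; last first.
    by move=> m /eqP ->; rewrite rmorph0 scale0r.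
  rewrite -big_filter -[RHS]big_filter; apply: perm_big.
  apply: uniq_perm; rewrite ?filter_uniq ?msupp_uniq // => m.
  rewrite !mem_filter; case: eqP => //= /eqP cm; rewrite (sP _ cm) mcoeff_msupp.
  by move: cm; rewrite /cf; case: ifP; rewrite ?eqxx.
have [[sa [_ ha]] [sb [_ hb]]] := (cf_finite a, cf_finite b).
pose s := undup (sa ++ sb).
rewrite !(fE _ s) ?undup_uniq // => [|m|m|m].
- rewrite scaler_sumr -big_split /=; apply: eq_bigr => m _.
  by rewrite cfP mpolyCD mpolyCM rmorphD rmorphM scalerDl scalerA.
- by move=> /hb; rewrite mem_undup mem_cat orbC => ->.
- by move=> /ha; rewrite mem_undup mem_cat => ->.
- rewrite cfP mem_undup mem_cat; apply: contraNT; rewrite negb_or => /andP[ma mb].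
  have /eqP -> : cf m a == 0 by apply: contraNT ma; apply: ha.
  have /eqP -> : cf m b == 0 by apply: contraNT mb; apply: hb.
  by rewrite mulr0 addr0.
Qed.
Definition flin v : coind scalar_pi C := Coind (flin_subproof v).

Lemma flinE v m : flin v (mon m) = if indep_mon m then v m else 0.
Proof.
case: ifP => [im|/negbT im]; last by rewrite (mon_eq0 im) coind0.
rewrite /= (bigD1_seq m) ?msupp_uniq //=; last first.
  rewrite mcoeff_msupp; have := cf_mon m m; rewrite /cf im eqxx => ->.
  exact: oner_neq0.
rewrite cf_mon im eqxx rmorph1 scale1r big1 ?addr0 // => m' ne.
by rewrite cf_mon eq_sym (negPf ne) andbF rmorph0 scale0r.
Qed.

Lemma coind_mon_ext (f g : coind scalar_pi C) :
  (forall m, indep_mon m -> f (mon m) = g (mon m)) -> f = g.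
Proof.
move=> h; apply: coind_ext => a; have [s ->] := edge_ring_expand a.
rewrite !coind_sum; apply: eq_bigr => m _; rewrite !coindZ.
by have [/h ->//|/mon_eq0 ->] := boolP (indep_mon m); rewrite !coind0.
Qed.
End Functional.

End EdgeRing.

(** * Certificates *)

Section Certificate.
Variables (T : finType) (G : sgraph T).

Definition nb (t : T) : {set T} := [set w | G t w].
(** For independent F this says that a monomial with support F is killed in R/I(G) by the variables
    of U. *)
Definition dominates (F U : {set T}) := [forall u in U, [exists f in F, G u f]].

Lemma dominatesP (F U : {set T}) :
  reflect (forall u, u \in U -> exists2 f, f \in F & G u f) (dominates F U).
Proof. by apply: (iffP forall_inP) => h u /h /exists_inP. Qed.

(* Says that a monomial killed by [U] and the neighbours of [t] is [t] times a
   monomial killed by [U]. *)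
Definition liftable (U : {set T}) (t : T) := forall F, independent G F ->
  dominates F (U :|: nb t) -> t \in F /\ dominates (F :\ t) U.

Definition gorenstein_certificate (fam : {set T} -> Prop) :=
  (forall S, maxset (independent G) S -> fam (~: S)) /\
  (forall U, fam U -> U != set0 -> exists t, [/\ t \in U, fam (U :\ t),
     fam (U :\ t :|: nb t) & liftable (U :\ t) t]).
End Certificate.

(** * Lifting annihilated elements along a certificate *)

Section Annihilators.
Variables (K : fieldType) (n : nat) (G : sgraph 'I_n).
Local Notation A := (edge_ring K G).
Local Notation kap := (scalar_pi K G).
Local Notation var := (@var K n G).
Local Notation mon := (@mon K n G).

Definition killed (M : lmodType A) (U : {set 'I_n}) (c : M) :=
  forall i, i \in U -> var i *: c = 0.

Lemma killed_submodule (M : lmodType A) U : submodule (@killed M U).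
Proof.
split=> [i _|a x y kx ky i iU]; first by rewrite scaler0.
by rewrite scalerDr scalerA mulrC -scalerA kx // ky // scaler0 addr0.
Qed.

Lemma killed_linear (M N : lmodType A) (f : {linear M -> N}) U c :
  killed U c -> killed U (f c).
Proof. by move=> kc i iU; rewrite -linearZ kc // linear0. Qed.

Lemma killed_inj (M N : lmodType A) (f : {linear M -> N}) U c :
  injective f -> killed U (f c) -> killed U c.
Proof. by move=> injf kc i iU; apply: injf; rewrite linearZ /= kc // linear0. Qed.

Lemma killedS (M : lmodType A) (U V : {set 'I_n}) (c : M) :
  U \subset V -> killed V c -> killed U c.
Proof. by move=> /subsetP s kc i /s; apply: kc. Qed.

(** Put g(m) = f(m / x_t), and 0 when x_t does not divide m. Then x_t g and f agree on m if x_t m is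
    nonzero; otherwise m contains a neighbour of t, and f vanishes on it. *)
Lemma coind_divide (C : lmodType A) (U : {set 'I_n}) t (f : coind kap C) :
  t \notin U -> killed (U :|: nb G t) f ->
  exists2 g, killed U g & f = var t *: g.
Proof.
move=> tU kf.
have f0 i (m : 'X_{1..n}) : i \in U :|: nb G t -> m i != 0%N -> f (mon m) = 0.
  move=> /kf fi mi; have -> : m = (U_(i) + (m - U_(i)))%MM.
    rewrite addmC submK //; apply/mnm_lepP => j; rewrite mnm1E.
    by case: eqVneq => [<-|//]; rewrite lt0n.
  by rewrite monD mulrC -coind_scaleE fi.
exists (flin (fun m => if m t != 0%N then f (mon (m - U_(t))%MM) else 0)).
  move=> i iU; apply: coind_mon_ext => m im; rewrite coind_scaleE -monD flinE.
  case: ifP => // _; case: ifP => // _; apply: (f0 i); first by rewrite inE iU.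
  have ti : t != i by apply: contraNneq tU => ->.
  by rewrite mnmBE mnmDE !mnm1E eqxx (negPf ti) subn0 addn1.
apply: coind_mon_ext => m im; rewrite coind_scaleE -monD flinE.
case: ifP => [_|/negbT]; first by rewrite mnmDE mnm1E eqxx addn1 /= addmK.
rewrite /indep_mon msupD msup1 setUC independentU1 negb_and [independent _ _]im /=.
case/forall_inPn=> j; rewrite negbK inE => mj Gtj.
by apply: (f0 j) => //; rewrite !inE Gtj orbT.
Qed.

Variables (Y : lmodType A) (fam : {set 'I_n} -> Prop).
Hypothesis cert : gorenstein_certificate G fam.
Hypothesis baseY : forall U t, liftable G U t -> forall y : Y,
  killed (U :|: nb G t) y -> exists2 y', killed U y' & y = var t *: y'.
Local Notation C := (cosyz kap Y).
Local Notation E k := (coind kap (C k)).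
Local Notation inn k := (cs_in (cosyzP kap Y k)).
Local Notation out k := (cs_out (cosyzP kap Y k)).

(** Let e0 be a lift killed by U - t. Then x_t e0 comes from C_k and is killed by U - t and N(t).
    Once it equals x_t y' with y' in C_k killed by U - t, the lift is e0 - y'. Induction is on k
    first, because U - t + N(t) may be larger than U. *)
Lemma kill_lift k U (c : C k.+1) : fam U -> killed U c ->
  exists2 e : E k, killed U e & out k e = c.
Proof.
elim/ltn_ind: k U c => k IHk U; have [m] := ubnP #|U|.
elim: m U => // m IHm U; rewrite ltnS => Um c famU kc.
have [U0|Un0] := eqVneq U set0.
  have [e <-] := cs_surj (cosyzP kap Y k) c.
  by exists e => // i; rewrite U0 inE.
have [t [tU fam0 famN lift]] := cert.2 U famU Un0.
have Um' : (#|U :\ t| < m)%N by move: Um; rewrite (cardsD1 t) tU.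
have [e0 ke0 e0c] := IHm _ Um' c fam0 (killedS (subD1set U t) kc).
have /(cs_exact (cosyzP kap Y k))[y ty] : out k (var t *: e0) = 0.
  by rewrite linearZ /= e0c kc.
have ky : killed (U :\ t :|: nb G t) y.
  apply: (killed_inj (cs_inj (c := cosyzP kap Y k))); rewrite -ty => i.
  rewrite inE => /orP[/ke0 ei|]; first by rewrite scalerA mulrC -scalerA ei scaler0.
  by rewrite inE => ti; rewrite scalerA mulrC edge_var // scale0r.
suff [y' ky' yE] : exists2 y', killed (U :\ t) y' & y = var t *: y'.
  exists (e0 - inn k y'); last by rewrite linearB cs_comp subr0.
  move=> i iU; rewrite scalerBr -linearZ /=; have [->|it] := eqVneq i t.
    by rewrite -yE ty subrr.
  have iUt : i \in U :\ t by rewrite !inE it.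
  by rewrite ke0 // ky' // linear0 subr0.
(* In degree 0 divisibility is [baseY]. Above it, y is lifted to the preceding coinduced module,
   divided there by [coind_divide], and projected back. *)
case: k IHk {IHm} c {kc} e0 {ke0 e0c} y {ty} ky => [|k] IHk c e0 y ky; first exact: baseY lift y ky.
have [e' ke' <-] := IHk k (ltnSn k) _ y famN ky.
have [|e'' ke'' e'E] := coind_divide _ ke'; first by rewrite !inE eqxx.
by exists (out k e''); [apply: killed_linear | rewrite e'E linearZ].
Qed.

Section FacetResolution.
Variable S : {set 'I_n}.
Hypothesis indS : independent G S.
Hypothesis famS : fam (~: S).
Local Notation kS := (killed (~: S)).

(** On elements killed by the complement of S the ring A acts through K[S]. This is linearity over
    the subring K[S'], so that variables can be added one at a time. *)
Definition slin (S' : {set 'I_n}) (M N : lmodType A) (f : M -> N) :=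
  (forall k x y, kS x -> kS y -> f (kap k *: x + y) = kap k *: f x + f y) /\
  (forall s x, s \in S' -> kS x -> f (var s *: x) = var s *: f x).

Lemma kS_var (M : lmodType A) s (x : M) : kS x -> kS (var s *: x).
Proof. exact: (submoduleZ _ (killed_submodule M _)). Qed.
Lemma kS_iter (M : lmodType A) s p (x : M) : kS x -> kS (var s ^+ p *: x).
Proof. exact: (submoduleZ _ (killed_submodule M _)). Qed.
Lemma kS_lin (M : lmodType A) a (x y : M) : kS x -> kS y -> kS (a *: x + y).
Proof. by have [_] := killed_submodule M (~: S); apply. Qed.

Lemma slin_sum (M N : lmodType A) (f : M -> N) S' x y :
  slin S' f -> kS x -> kS y -> f (x + y) = f x + f y.
Proof. by move=> [fl _] kx ky; have := fl 1 x y kx ky; rewrite rmorph1 !scale1r. Qed.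

(* On functions on monomials the operator equation u t - t u = h has an explicit
   solution: this is where the polynomial ring K[S] has Ext^1(-, coind) = 0. *)
Lemma solve_commutator (M C' : lmodType A) (S' : {set 'I_n}) t (h : M -> coind kap C') :
  t \in S -> t \notin S' -> S' \subset S -> slin S' h -> (forall x, kS x -> kS (h x)) ->
  exists u : M -> coind kap C', [/\ slin S' u, forall x, kS (u x) &
    forall x, kS x -> u (var t *: x) = var t *: u x + h x].
Proof.
move=> tS tS' /subsetP S'S hl kh.
pose mt (m : 'X_{1..n}) p := (m - U_(t) *+ p.+1)%MM.
(* The equation says u(x)(x_t m) = u(x_t x)(m) - h(x)(m), a recursion in the exponent of t. Started
   with 0 at exponent 0, it unfolds to this sum. *)
pose v x (m : 'X_{1..n}) : C' := if msup m \subset S then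
  - \sum_(p < m t) h (var t ^+ p *: x) (mon (mt m p)) else 0.
have vmon x (m : 'X_{1..n}) : flin (v x) (mon m) = v x m.
  rewrite flinE; case: ifP => // /negbT im; rewrite /v; case: ifP => // mS.
  by case/negP: im; apply: independentS mS indS.
have supD (m : 'X_{1..n}) s : s \in S -> (msup (m + U_(s))%MM \subset S) = (msup m \subset S).
  by move=> sS; rewrite msupD msup1 subUset sub1set sS andbT.
exists (fun x => flin (v x)); split.
- split=> [k x y kx ky|s x sS' kx]; apply: coind_mon_ext => m im.
    rewrite coind_addE coind_scaleE [mon m * _]mulrC coindZ !vmon /v.
    case: ifP => _; last by rewrite scaler0 addr0.
    rewrite scalerN -opprD scaler_sumr -big_split /=; congr (- _).
    apply: eq_bigr => p _; rewrite scalerDr scalerA [_ * kap k]mulrC -scalerA.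
    rewrite hl.1 ?coind_addE ?coind_scaleE; try exact: kS_iter.
    by rewrite [mon _ * _]mulrC coindZ.
  have st : s != t by apply: contraNneq tS' => <-.
  rewrite coind_scaleE -monD !vmon /v supD ?S'S //; case: ifP => // _; congr (- _).
  rewrite mnmDE mnm1E (negPf st) addn0; apply: eq_bigr => p _.
  rewrite scalerA mulrC -scalerA hl.2 //; last exact: kS_iter.
  rewrite coind_scaleE -monD; congr (h _ (mon _)); apply/mnmP => i.
  rewrite !(mnmDE, mnmBE, mulmnE, mnm1E); have [<-|_] := eqVneq t i; last by rewrite mul0n !subn0.
  by rewrite (negPf st) !addn0.
- move=> x i; rewrite inE => iS; apply: coind_mon_ext => m _.
  rewrite coind_scaleE -monD vmon /v ifF //.
  by apply/negbTE; apply: contra iS; rewrite msupD msup1 subUset sub1set => /andP[_].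
- move=> x kx; apply: coind_mon_ext => m im.
  rewrite coind_addE coind_scaleE -monD !vmon /v supD //; case: ifP => [mS|/negbT].
    rewrite mnmDE mnm1E eqxx addn1 big_ord_recl opprD expr0 scale1r -addrA [RHS]addrC -addrA.
    have -> : mt (m + U_(t))%MM 0%N = m by rewrite /mt mulm1n addmK.
    rewrite /= subrr addr0; congr (- _); apply: eq_bigr => p _.
    rewrite scalerA -exprSr; congr (h _ (mon _)); apply/mnmP => i.
    rewrite !(mnmDE, mnmBE, mulmnE, mnm1E) /bump /= add1n.
    by have [_|_] := eqVneq t i; [rewrite !mul1n addn1 subSS | rewrite !mul0n addn0].
  case/subsetPn=> i; rewrite inE => mi iS; rewrite add0r.
  have -> : m = (m - U_(i) + U_(i))%MM.
    rewrite submK //; apply/mnm_lepP => j; rewrite mnm1E.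
    by case: eqVneq => [<-|//]; rewrite lt0n.
  by rewrite monD -coind_scaleE kh // inE.
Qed.

Lemma slin0 (M N : lmodType A) (f : M -> N) S' : slin S' f -> f 0 = 0.
Proof.
move=> fl; apply: (addrI (f 0)); rewrite -(slin_sum fl) ?addr0 //.
all: by case: (killed_submodule M (~: S)).
Qed.
End FacetResolution.
End Annihilators.

(** * Injectivity of the n-th cosyzygy *)

Section GorensteinRing.
Variables (K : fieldType) (n : nat) (G : sgraph 'I_n).
Local Notation A := (edge_ring K G).
Local Notation kap := (scalar_pi K G).
Local Notation var := (@var K n G).
Local Notation mon := (@mon K n G).

Lemma mon_ind (P : A -> Prop) :
  (forall k a b, P a -> P b -> P (kap k * a + b)) -> P 0 -> P 1 ->
  (forall i a, P a -> P (var i * a)) -> forall a, P a.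
Proof.
move=> Plin P0 P1 Pvar a; have [s ->] := edge_ring_expand a.
elim: s => [|m s IH]; rewrite ?big_nil ?big_cons //; apply: Plin => // {IH}.
have [d] := ubnP (mdeg m); elim: d m => // d IH m; rewrite ltnS => md.
have [->|] := eqVneq m 0%MM; first by rewrite mon0.
case: (pickP (fun i => m i != 0%N)) => [i mi _|m0]; last first.
  by case/eqP; apply/mnmP => i; rewrite mnm0E; apply/eqP; have := m0 i; case: eqP.
have mE : m = (U_(i) + (m - U_(i)))%MM.
  rewrite addmC submK //; apply/mnm_lepP => j; rewrite mnm1E.
  by case: eqVneq => [<-|//]; rewrite lt0n.
rewrite mE monD; apply: Pvar; apply: IH; rewrite (leq_trans _ md) //.
by rewrite {2}mE mdegD mdeg1.
Qed.

Section FacetSplitting.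
Variables (Y : lmodType A) (S : {set 'I_n}).
Hypothesis indS : independent G S.
Local Notation C := (cosyz kap Y).
Local Notation E k := (coind kap (C k)).
Local Notation inn k := (cs_in (cosyzP kap Y k)).
Local Notation out k := (cs_out (cosyzP kap Y k)).
Local Notation kS := (killed (~: S)).
Hypothesis liftS : forall k (c : C k.+1), kS c -> exists2 e : E k, kS e & out k e = c.

(** Two lifts of an element differ by an element of the kernel W, so an arbitrary choice of lifts
    becomes K-linear after subtracting its K-linear projection to W. *)
Lemma scalar_section k : exists g : C k.+1 -> E k,
  [/\ slin S set0 g, forall c, kS c -> kS (g c) & forall c, kS c -> out k (g c) = c].
Proof.
pose EK : lmodType K := res_scalars kap (E k).
pose W (e : EK) := kS (e : E k) /\ out k e = 0.
have sW : submodule W.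
  split=> [|a x y [kx ox] [ky oy]]; first by split; [case: (killed_submodule (E k) (~: S)) | rewrite linear0].
  split; first exact: kS_lin kx ky.
  by rewrite [out k _]linearP ox oy scaler0 addr0.
pose WK : lmodType K := submodule_type sW.
have lv : linear (val : WK -> EK) by move=> a x y; rewrite linearP.
have [r rP] := @vector_space_injective K WK WK EK (mkLinear lv) idfun val_inj.
have rW (w : EK) : W w -> (val (r w) : EK) = w.
  by move=> /(submodule_predP sW) Ww; have /(congr1 val) := rP (Sub w Ww).
have [l lP] : {l : C k.+1 -> E k & forall c, kS c -> kS (l c) /\ out k (l c) = c}.
  apply: (@choice _ _ (fun c e => kS c -> kS e /\ out k e = c)) => c.
  have [kc|nkc] := pselect (kS c); last by exists 0.
  by have [e ke ec] := liftS kc; exists e.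
pose rr (e : EK) : EK := val (r e).
have rl : linear rr by move=> a x y; rewrite /rr linearP lv.
have rrW e : W (rr e) by apply/(submodule_predP sW)/valP.
pose g c : E k := (l c : E k) - (rr (l c) : E k).
have gP c e : kS c -> kS e -> out k e = c -> g c = e - (rr e : E k).
  move=> kc ke ec; have [kl lc] := lP c kc.
  have We : W ((l c : E k) - e).
    by split; [apply: (submoduleB (killed_submodule _ _)) | rewrite linearB lc ec subrr].
  have := rW _ We; rewrite -/(rr _) => h.
  have rB : rr ((l c : E k) - e) = rr (l c) - rr e by apply: (linearB (mkLinear rl)).
  move: h; rewrite rB; suff swap (a b x y : E k) : a - b = x - y -> x - a = y - b by apply: swap.
  move=> h; have -> : x = a - b + y by rewrite h subrK.
  by rewrite addrC !addrA addNr add0r addrC.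
exists g; split.
- split=> [a x y kx ky|s x]; last by rewrite inE.
  have [[kl lx] [km ly]] := (lP x kx, lP y ky).
  rewrite (gP _ (kap a *: l x + l y)); first last.
  + by rewrite linearP lx ly.
  + exact: kS_lin.
  + exact: kS_lin.
  have -> : rr (kap a *: l x + l y) = kap a *: (rr (l x) : E k) + rr (l y) by apply: (rl a).
  by rewrite scalerBr opprD addrACA.
- by move=> c kc; apply: (submoduleB (killed_submodule _ _)); [case: (lP c kc) | case: (rrW (l c))].
- by move=> c kc; rewrite linearB (lP c kc).2 (rrW (l c)).2 subr0.
Qed.

(* The polynomial ring on S has global dimension at most #|S|, one variable at a time. *)
Lemma slin_lift (S' : {set 'I_n}) k (M : lmodType A) (f : M -> C k.+1) :
  S' \subset S -> (#|S'| <= k)%N -> slin S S' f -> (forall x, kS x -> kS (f x)) ->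
  exists g : M -> E k, [/\ slin S S' g, forall x, kS x -> kS (g x) &
    forall x, kS x -> out k (g x) = f x].
Proof.
have [m] := ubnP #|S'|; elim: m S' k M f => // m IH S' k M f; rewrite ltnS => Sm S'S Sk fl kf.
have [S0|[t tS']] := set_0Vmem S'.
  have [g [gl kg go]] := scalar_section k.
  exists (g \o f); split=> [|x kx|x kx]; rewrite ?S0 /=; try by [apply: kg; apply: kf | apply: go; apply: kf].
  split=> [a x y kx ky|s x]; last by rewrite inE.
  by rewrite /= fl.1 // gl.1 //; apply: kf.
set S'' := S' :\ t; have tS'' : t \notin S'' by rewrite !inE eqxx.
have sub'' : S'' \subset S' by apply: subD1set.
have cS' : #|S'| = #|S''|.+1 by rewrite (cardsD1 t) tS'.
have slinS (N : lmodType A) (h : M -> N) : slin S S' h -> slin S S'' h.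
  by move=> [h1 h2]; split=> // s x sS''; apply: h2; apply: (subsetP sub'').
have lt'' : (#|S''| < m)%N by rewrite -cS'.
have S''S : S'' \subset S by apply: subset_trans S'S.
have [g0 [g0l kg0 g0o]] := IH _ k M f lt'' S''S (ltnW (leq_trans (eq_leq (esym cS')) Sk)) (slinS _ _ fl) kf.
case: k f fl kf Sk g0 g0l kg0 g0o => [|k] f fl kf Sk g0 g0l kg0 g0o; first by rewrite cS' in Sk.
have tS : t \in S by apply: (subsetP S'S).
(* The defect of g0 in commuting with t comes from a map d into C_(k+1). Lifting d to E_k uses up
   one degree, whence the bound on #|S'|. *)
have dP x : exists y, kS x -> g0 (var t *: x) - var t *: g0 x = inn k.+1 y.
  have [kx|nkx] := pselect (kS x); last by exists 0.
  have /(cs_exact (cosyzP kap Y k.+1))[y yE] : out k.+1 (g0 (var t *: x) - var t *: g0 x) = 0.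
    by rewrite linearB linearZ g0o ?g0o ?fl.2 ?subrr //; apply: kS_var.
  by exists y.
have [d {}dP] := choice dP.
have injn : injective (inn k.+1) by exact: cs_inj.
have dl : slin S S'' d.
  split=> [a x y kx ky|s x sS'' kx]; apply: injn.
    rewrite linearP -!dP //; try exact: kS_lin.
    have -> : var t *: (kap a *: x + y) = kap a *: (var t *: x) + var t *: y.
      by rewrite scalerDr !scalerA mulrC.
    rewrite !g0l.1 //; try exact: kS_var.
    by rewrite !scalerDr !scalerN !scalerA opprD addrACA [kap a * _]mulrC.
  rewrite [inn k.+1 (_ *: _)]linearZ /= -!dP //; try exact: kS_var.
  have -> : var t *: (var s *: x) = var s *: (var t *: x) by rewrite !scalerA mulrC.
  rewrite (g0l.2 s (var t *: x)) ?(g0l.2 s x) //; try exact: kS_var.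
  by rewrite scalerBr !scalerA [var t * _]mulrC.
have kd x : kS x -> kS (d x).
  move=> kx; apply: (killed_inj injn); rewrite -dP //.
  by apply: (submoduleB (killed_submodule _ _)); [apply: kg0; apply: kS_var | apply: kS_var; apply: kg0].
have [h [hl kh ho]] := IH _ k M d lt'' S''S (leq_trans (eq_leq (esym cS')) Sk) dl kd.
have [u [ul ku uP]] := solve_commutator indS tS tS'' S''S hl kh.
(* With u t - t u = h and h a lift of d, subtracting the image of u cancels the defect. *)
have gl'' : slin S S'' (fun x => g0 x - inn k.+1 (out k (u x))).
  split=> [a x y kx ky|s x sS'' kx].
    by rewrite g0l.1 // ul.1 // (linearP (out k)) (linearP (inn k.+1)) scalerBr opprD addrACA.
  by rewrite g0l.2 // ul.2 // !linearZ /= scalerBr scalerN.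
exists (fun x => g0 x - inn k.+1 (out k (u x))); split.
- split; first exact: gl''.1.
  move=> s x sS' kx; have [->|st] := eqVneq s t; last by apply: gl''.2 => //; rewrite !inE st.
  have -> : inn k.+1 (out k (u (var t *: x))) =
      var t *: inn k.+1 (out k (u x)) + (g0 (var t *: x) - var t *: g0 x).
    by rewrite uP // (linearD (out k)) ho // (linearD (inn k.+1)) -dP // !linearZ.
  by rewrite scalerBr opprD opprB addrCA [RHS]addrC; congr (_ + _); rewrite addrC subrK.
- by move=> x kx; apply: (submoduleB (killed_submodule _ _)); [apply: kg0 | do 2 apply: killed_linear; apply: ku].
- by move=> x kx; rewrite linearB cs_comp subr0 g0o.
Qed.

Lemma facet_section k : (#|S| <= k)%N -> exists g : C k.+1 -> E k,
  [/\ forall c, kS c -> kS (g c), forall c, kS c -> out k (g c) = c &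
      forall a c, kS c -> g (a *: c) = a *: g c].
Proof.
move=> Sk; have idl : slin S S (idfun : C k.+1 -> C k.+1) by [].
have [g [gl kg go]] := slin_lift (subxx S) Sk idl (fun x kx => kx).
exists g; split=> // a c kc; have ka b : kS (b *: c) by apply: (submoduleZ _ (killed_submodule _ _)).
have g0 := slin0 gl.
elim/mon_ind: a => [q a b IHa IHb|||i a IHa].
- by rewrite !scalerDl -!scalerA gl.1 // IHa IHb.
- by rewrite !scale0r.
- by rewrite !scale1r.
have [iS|iS] := boolP (i \in S); first by rewrite -!scalerA gl.2 // IHa.
by rewrite -!scalerA -IHa (ka a) ?(kg _ (ka a)) ?inE.
Qed.

End FacetSplitting.

Lemma maxset_extend (P : pred {set 'I_n}) U : P U -> exists2 S, maxset P S & U \subset S.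
Proof. by case/maxset_exists=> S mS US; exists S. Qed.

(** Baer's criterion for the ideals that contain P_S for some facet S. The index n is large enough
    for [slin_lift] because #|S| <= n. *)
Theorem certificate_injective (Y : lmodType A) fam :
  gorenstein_certificate G fam ->
  (forall U t, liftable G U t -> forall y : Y,
     killed (U :|: nb G t) y -> exists2 y', killed U y' & y = var t *: y') ->
  injective_module (cosyz kap Y n).
Proof.
move=> cert base.
apply: (@baer _ _ (fun J => exists2 S, maxset (independent G) S & forall i, i \notin S -> J (var i))).
- move=> J h sJ [S mS JS] lh.
  have indS := maxsetp mS; have liftS k c := kill_lift cert base (k := k) (c := c) (cert.1 _ mS).
  have Sn : (#|S| <= n)%N by rewrite -[X in (_ <= X)%N]card_ord max_card.
  have [g [kg go gl]] := facet_section indS liftS Sn.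
  set c := cosyzP kap Y n in go.
  have lh' : lin_on J (cs_in c \o h) by move=> a x y Jx Jy; rewrite /= lh // linearP.
  (* Inside E_n, h is multiplication by some e. The class of e in C_(n+1) is killed by J, so
     subtracting its image under the section g moves e into C_n without changing its products with
     J. *)
  have [e0 e0P] := injective_extend (@coind_injective _ _ kap _) sJ lh'.
  pose e := e0 1.
  have eP r : J r -> r *: e = cs_in c (h r).
    by move=> Jr; have /= <- := e0P r Jr; rewrite -linearZ; congr (e0 _); rewrite /GRing.scale /= mulr1.
  have ke : killed (~: S) (cs_out c e).
    by move=> i; rewrite inE => /JS Ji; rewrite -linearZ eP // cs_comp.
  have /(cs_exact c)[y yE] : cs_out c (e - g (cs_out c e)) = 0.
    by rewrite linearB go // subrr.
  exists y => r Jr; apply: (cs_inj (c := c)); rewrite -eP // linearZ /= -yE scalerBr -gl //.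
  have -> : r *: cs_out c e = 0 by rewrite -linearZ eP // cs_comp.
  have := gl 0 _ ke; rewrite !scale0r => ->.
  by rewrite subr0.
- move=> N D sD [x nDx].
  (* Take U maximal such that x_U x is outside D. Then x_U is nonzero, so U is independent, and for
     a facet S containing U every variable outside S moves x_U x into D. *)
  pose bad (U : {set 'I_n}) := `[<~ D (mon [multinom nat_of_bool (i \in U) | i < n] *: x)>].
  have bad0 : bad set0.
    apply/asboolP; have -> : [multinom nat_of_bool (i \in (set0 : {set 'I_n})) | i < n] = 0%MM.
      by apply/mnmP => i; rewrite mnmE mnm0E inE.
    by rewrite mon0 scale1r.
  have [U mU _] := maxset_extend bad0.
  have /asboolP nDU := maxsetp mU.
  have msU : msup [multinom nat_of_bool (i \in U) | i < n] = U.
    by apply/setP => i; rewrite inE mnmE; case: (i \in U).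
  have indU : independent G U.
    apply: contrapT => /negP nU; apply: nDU.
    by rewrite mon_eq0 ?scale0r; [case: sD | rewrite /indep_mon msU].
  have [S mS US] := maxset_extend indU.
  exists (mon [multinom nat_of_bool (i \in U) | i < n] *: x) => //.
  exists S => // i iS; have iU : i \notin U by apply: contra iS; apply: (subsetP US).
  apply: contrapT => nD; have : bad (i |: U).
    apply/asboolP; apply: contra_not nD; rewrite scalerA /var -monD.
    suff -> : [multinom nat_of_bool (j \in i |: U) | j < n] =
      (U_(i) + [multinom nat_of_bool (j \in U) | j < n])%MM by [].
    apply/mnmP => j; rewrite mnmDE !mnmE !inE eq_sym.
    by case: eqVneq => [<-|//]; rewrite (negPf iU).
  move/(maxsetsup mU)/(_ (subsetUr _ _)) => eU.
  by move: iU; rewrite -eU !inE eqxx.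
Qed.

End GorensteinRing.

(** * Localization *)

Section LocalizationMap.
Variables (A : comNzRingType) (p : prime_idealr A).
Local Notation L := (localization p).

Definition loc (a : A) : L := Localization.tolocal p a.

Lemma loc_pi a : loc a = \pi_(Localization.type p) (Localization.mkfrac a (Localization.denom_key1 p)).
Proof. by rewrite /loc !piE. Qed.

Lemma loc_eqP a b : loc a = loc b <-> exists2 u, u \notin p & u * a = u * b.
Proof.
rewrite !loc_pi; split=> [/Localization.eqP_pi|] [u up].
  by rewrite /Localization.den /= !mulr1 => e; exists u.
by move=> e; apply/Localization.eqP_pi; exists u; rewrite // /Localization.den /= !mulr1.
Qed.

Fact loc_is_zmod_morphism : zmod_morphism loc.
Proof.
move=> a b; rewrite !loc_pi [RHS](_ : _ = Localization.add
   (\pi_(Localization.type p) (Localization.mkfrac a (Localization.denom_key1 p)))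
   (Localization.opp (\pi_(Localization.type p) (Localization.mkfrac b (Localization.denom_key1 p))))) //.
rewrite !piE; apply: Localization.pi_eq.
by rewrite /Localization.den /= !mulr1.
Qed.
HB.instance Definition _ := GRing.isZmodMorphism.Build A L loc loc_is_zmod_morphism.

Fact loc_is_monoid_morphism : monoid_morphism loc.
Proof.
split=> [|a b]; first by [].
rewrite !loc_pi [RHS](_ : _ = Localization.mul
   (\pi_(Localization.type p) (Localization.mkfrac a (Localization.denom_key1 p)))
   (\pi_(Localization.type p) (Localization.mkfrac b (Localization.denom_key1 p)))) //.
rewrite !piE; apply: Localization.pi_eq.
by rewrite /Localization.den /= !mulr1.
Qed.
HB.instance Definition _ := GRing.isMonoidMorphism.Build A L loc loc_is_monoid_morphism.

Lemma loc_eq0 a : loc a = 0 <-> exists2 u, u \notin p & u * a = 0.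
Proof. by rewrite -[0](rmorph0 loc) loc_eqP; split=> -[u up e]; exists u; rewrite // e mulr0. Qed.

Lemma loc_unit s : s \notin p -> exists t, loc s * t = 1.
Proof.
move=> sp; exists (\pi_(Localization.type p) (Localization.mkfrac 1 sp)).
rewrite loc_pi [LHS](_ : _ = Localization.mul
   (\pi_(Localization.type p) (Localization.mkfrac s (Localization.denom_key1 p)))
   (\pi_(Localization.type p) (Localization.mkfrac 1 sp))) //.
rewrite !piE [RHS](_ : _ = \pi_(Localization.type p) (Localization.mkfrac 1 (Localization.denom_key1 p))).
  by apply: Localization.pi_eq; rewrite /Localization.den /= !mulr1 !mul1r.
by rewrite -loc_pi.
Qed.

Lemma loc_frac (l : L) : exists a s t, [/\ s \notin p, loc s * t = 1 & l = loc a * t].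
Proof.
elim/quotW: l => -[a [s sp]]; exists a, s.
have [t st] := loc_unit sp; exists t; split=> //.
suff e : \pi_(Localization.type p) (a, exist _ s sp) * loc s = loc a.
  by rewrite -e -mulrA st mulr1.
rewrite !loc_pi [LHS](_ : _ = Localization.mul (\pi_(Localization.type p) (a, exist _ s sp))
   (\pi_(Localization.type p) (Localization.mkfrac s (Localization.denom_key1 p)))) //.
by rewrite !piE; apply: Localization.pi_eq; rewrite /Localization.den /= !mulr1.
Qed.
End LocalizationMap.

(** * Finite injective dimension of the local rings *)

Section CertificateGorenstein.
Variables (K : fieldType) (n : nat) (G : sgraph 'I_n).
Local Notation A := (edge_ring K G).
Local Notation var := (@var K n G).
Local Notation mon := (@mon K n G).

(** Annihilators of variables are spanned by monomials, so [liftable] applies to the support of each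
    monomial of a, and each is divided by x_t. *)
Lemma edge_ring_lift U t (a : A) : liftable G U t ->
  (forall i, i \in U :|: nb G t -> var i * a = 0) ->
  exists2 b, forall i, i \in U -> var i * b = 0 & a = var t * b.
Proof.
move=> lift ka; have [s aE] := edge_ring_expand a.
have sup m : cf m a != 0 -> t \in msup m /\ dominates G (msup m :\ t) U.
  move=> cm; have im : indep_mon G m by move: cm; rewrite /cf; case: ifP; rewrite ?eqxx.
  apply: lift => //; apply/dominatesP => i /ka ia.
  have : ~~ indep_mon G (m + U_(i))%MM.
    apply: contra cm => iU; rewrite -(cf_mulmon _ iU) mulrC.
    by rewrite -[_ * a]/(var i * a) ia cf0.
  rewrite /indep_mon msupD msup1 setUC independentU1 negb_and [independent _ _]im /=.
  by case/forall_inPn=> f fm; rewrite negbK; exists f.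
exists (\sum_(m <- s) scalar_pi K G (cf m a) * mon (m - U_(t))%MM).
  move=> i iU; rewrite mulr_sumr big1 // => m _; rewrite mulrCA -monD.
  have [->|cm] := eqVneq (cf m a) 0; first by rewrite rmorph0 mul0r.
  have [_ /dominatesP/(_ i iU)[f fm Gif]] := sup m cm.
  rewrite mon_eq0 ?mulr0 // /indep_mon msupD msup1.
  apply/independentP => /(_ i f); rewrite Gif => h; suff: ~~ true by [].
  apply: h; rewrite !inE ?eqxx //; move: fm; rewrite !inE mnmBE mnm1E => /andP[ft fm].
  by rewrite eq_sym in ft; rewrite (negPf ft) subn0 fm orbT.
rewrite {1}aE mulr_sumr; apply: eq_bigr => m _.
have [->|cm] := eqVneq (cf m a) 0; first by rewrite rmorph0 !mul0r mulr0.
have [tm _] := sup m cm; rewrite mulrCA -monD addmC submK //.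
apply/mnm_lepP => j; rewrite mnm1E; case: eqVneq => [<-|//].
by move: tm; rewrite inE lt0n.
Qed.

Variable p : prime_idealr A.
Local Notation L := (localization p).

Lemma common_denominator (U : {set 'I_n}) (a : A) :
  (forall i, i \in U -> loc p (var i * a) = 0) ->
  exists2 u, u \notin p & forall i, i \in U -> var i * (u * a) = 0.
Proof.
move=> h; suff [u up uP] : exists2 u, u \notin p & forall i, i \in enum U -> var i * (u * a) = 0.
  by exists u => // i iU; apply: uP; rewrite mem_enum.
have {}h i : i \in enum U -> loc p (var i * a) = 0 by rewrite mem_enum; apply: h.
elim: (enum U) h => [|i s IH] h; first by exists 1; rewrite ?idealr1.
have [|u up uP] := IH; first by move=> j js; apply: h; rewrite inE js orbT.
have /loc_eq0[v vp ve] := h i (mem_head _ _).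
exists (u * v); first by rewrite prime_idealrM negb_or up.
move=> j; rewrite inE => /orP[/eqP ->|/uP e]; last first.
  by transitivity (v * (var j * (u * a))); [ring | rewrite e mulr0].
by transitivity (u * (v * (var i * a))); [ring | rewrite ve mulr0].
Qed.

Lemma certificate_local fam :
  gorenstein_certificate G fam -> finite_injective_dimension L^o.
Proof.
move=> cert.
have fracL (l : L) : exists a s t, loc p s * t = 1 /\ l = loc p a * t.
  by have [a [s [t [_ st e]]]] := loc_frac l; exists a, s, t.
have frac0 a : loc p a = 0 -> exists u t, loc p u * t = 1 /\ u * a = 0.
  by move=> /loc_eq0[u up ua]; have [t ut] := loc_unit up; exists u, t.
apply: (@fraction_ring_injdim A L (loc p) fracL frac0 K (scalar_pi K G) n).
apply: certificate_injective cert _ => U t lift y ky.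
have [a [s [q [sp sq yE]]]] := loc_frac (y : L).
have [i iU|u up uP] := @common_denominator (U :|: nb G t) a.
  have : loc p (var i) * y = 0 by exact: ky.
  rewrite yE mulrA -rmorphM => /(congr1 (fun z => z * loc p s)).
  by rewrite mul0r -mulrA [q * _]mulrC sq mulr1.
have [b kb ab] := edge_ring_lift lift uP.
have [v uv] := loc_unit up.
exists (loc p b * v * q : L).
  move=> i iU; change (loc p (var i) * (loc p b * v * q) = 0).
  by rewrite !mulrA -rmorphM kb // rmorph0 !mul0r.
change ((y : L) = loc p (var t) * (loc p b * v * q)).
by rewrite !mulrA -rmorphM -ab yE rmorphM -[LHS]mul1r -uv; ring.
Qed.
End CertificateGorenstein.

(** Induction on the number k of coordinates compared: one list serves the monomials whose next
    exponent exceeds its bound N, and each slice with exponent c <= N has its own list. *)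
Lemma dickson n (P : 'X_{1..n} -> Prop) :
  exists2 s : seq 'X_{1..n}, forall m, m \in s -> P m &
    forall m, P m -> exists2 m', m' \in s & forall i, (m' i <= m i)%N.
Proof.
suff: forall k (P : 'X_{1..n} -> Prop), exists2 s : seq 'X_{1..n}, forall m, m \in s -> P m &
    forall m, P m -> exists2 m', m' \in s & forall i : 'I_n, (i < k)%N -> (m' i <= m i)%N.
  move=> /(_ n P)[s sP Ps]; exists s => // m /Ps[m' m's le].
  by exists m' => // i; apply: le.
elim=> [|k IH] {}P.
  have [[m Pm]|nP] := pselect (exists m, P m); last first.
    by exists [::] => // m Pm; case: nP; exists m.
  by exists [:: m] => [m'|m' _]; [rewrite inE => /eqP -> | exists m; rewrite ?inE].
have [kn|nk] := ltnP k n; last first.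
  have [s sP Ps] := IH P; exists s => // m /Ps[m' m's le]; exists m' => // i _.
  by apply: le; apply: leq_trans nk.
pose ik := Ordinal kn; have [s0 s0P Ps0] := IH P.
pose N := (\max_(m <- s0) m ik)%N.
have /choice[s sP] c : exists s : seq 'X_{1..n}, (forall m, m \in s -> P m /\ m ik = c) /\
    forall m, P m /\ m ik = c -> exists2 m', m' \in s & forall i : 'I_n, (i < k)%N -> (m' i <= m i)%N.
  by have [s sP Ps] := IH (fun m => P m /\ m ik = c); exists s.
exists (s0 ++ flatten [seq s c | c <- iota 0 N.+1]) => [m|m Pm].
  by rewrite mem_cat => /orP[/s0P //|/flatten_mapP[c _ /(sP c).1 []]].
have [mN|Nm] := leqP (m ik) N.
  have [m' m's le] := (sP (m ik)).2 m (conj Pm erefl); exists m'.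
    rewrite mem_cat; apply/orP; right; apply/flatten_mapP; exists (m ik) => //.
    by rewrite mem_iota.
  move=> i; rewrite ltnS leq_eqVlt => /orP[/eqP ik_eq|]; last exact: le.
  have -> : i = ik by apply: val_inj.
  by rewrite ((sP _).1 _ m's).2.
have [m' m's le] := Ps0 m Pm; exists m'; first by rewrite mem_cat m's.
move=> i; rewrite ltnS leq_eqVlt => /orP[/eqP ik_eq|]; last exact: le.
have -> : i = ik by apply: val_inj.
by apply: leq_trans (ltnW Nm); rewrite /N (big_rem m') //= leq_maxl.
Qed.

(** By Dickson's lemma finitely many members of J have leading monomials dividing, between them, all
    leading monomials of J; division by these members terminates. *)
Lemma mpoly_ideal_finite (K : fieldType) n (J : {mpoly K[n]} -> Prop) :
  (forall a p q, J p -> J q -> J (a * p + q)) ->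
  exists2 s : seq {mpoly K[n]}, forall g, g \in s -> J g &
    forall p, J p -> ideal_gen (fun g => g \in s) p.
Proof.
move=> Jlin.
have [s sP Ps] := dickson (fun m => exists p, [/\ J p, p != 0 & mlead p = m]).
have /choice[g gP] (m : 'X_{1..n}) : exists g, m \in s -> [/\ J g, g != 0 & mlead g = m].
  by case: (boolP (m \in s)) => [/sP[p ?]|_]; [exists p | exists 0].
exists (map g s) => [_ /mapP[m ms ->]|p]; first by case: (gP m ms).
elim/mleadrect: p => p IH Jp.
have [->|p0] := eqVneq p 0; first by exists [::]; rewrite ?big_nil.
have [|m' m's le] := Ps (mlead p); first by exists p.
have [Jg g0 lg] := gP m' m's; set h := g m' in Jg g0 lg.
pose c := (mleadc p / mleadc h) *: 'X_[mlead p - m'] : {mpoly K[n]}.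
have mE : (mlead p - m' + m')%MM = mlead p by rewrite submK //; apply/mnm_lepP.
pose q : {mpoly K[n]} := p - c * h.
have Jq : J q by rewrite /q -mulNr addrC; apply: Jlin.
have lc : (mlead c <= (mlead p - m')%MM)%O.
  by apply: le_trans (mleadZ_le _ _) _; rewrite mleadXm.
have qp : q != 0 -> ((mlead q : 'X_{1..n}) < mlead p)%O.
  move=> q0; rewrite lt_neqAle; apply/andP; split.
    apply: contra q0 => /eqP e; rewrite -mleadc_eq0 e /q mcoeffB.
    have -> : (c * h)@_(mlead p) = p@_(mlead p); last by rewrite subrr.
    rewrite -{1}mE mleadcMW ?lg // mcoeffZ mcoeffX eqxx mulr1 -lg divfK //.
    by rewrite mleadc_eq0.
  apply: le_trans (mleadB_le _ _) _.
  rewrite leUx lexx /=.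
  apply: le_trans (mleadM_le _ _) _.
  by rewrite lg -{1}mE lem_add.
have [t tP qE] : ideal_gen (fun x => x \in map g s) q.
  have [->|/qp] := eqVneq q 0; first by exists [::]; rewrite ?big_nil.
  by move=> lt; apply: IH.
exists ((c, h) :: t) => [u|]; last by rewrite big_cons -qE /q addrC subrK.
by rewrite inE => /orP[/eqP -> /=|/tP //]; apply: map_f.
Qed.

Lemma edge_ring_noetherian (K : fieldType) n (G : sgraph 'I_n) : noetherian (edge_ring K G).
Proof.
move=> I; have [|s sI Is] := @mpoly_ideal_finite K n (fun p => edge_pi G p \in I).
  by move=> a p q Ip Iq; rewrite rmorphD rmorphM rpredD // idealMr.
exists (map (edge_pi G) s) => a; split=> [aI|[t tP ->]].
  have [p pE] := edge_pi_surj a; rewrite -pE in aI *.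
  have [t tP ->] := Is p aI.
  exists [seq (edge_pi G u.1, edge_pi G u.2) | u <- t].
    by move=> _ /mapP[u ut ->] /=; apply: map_f; apply: tP.
  by rewrite big_map rmorph_sum; apply: eq_bigr => u _; rewrite rmorphM.
rewrite big_seq rpred_sum // => u /tP /mapP[p ps ->].
by rewrite idealMr // sI.
Qed.

Theorem certificate_gorenstein (K : fieldType) n (G : sgraph 'I_n) fam :
  gorenstein_certificate G fam -> gorenstein_graph K G.
Proof.
move=> cert; split; first exact: edge_ring_noetherian.
by move=> p _; apply: certificate_local cert.
Qed.

(** * Vanishing of Ext over the local rings *)

Section ExtVanishing.
Variables (L : comNzRingType) (n : nat) (z : 'I_n -> L).
Implicit Types (X Y B C S W : {set 'I_n}) (i q : 'I_n).
Local Notation V := {ffun 'I_n -> L^o}.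

Definition idl X (x : L^o) := exists c : V, x = \sum_(i in X) c i * z i :> L.
(** Coordinates outside X are unrestricted. This adds a free summand to the syzygies and lets one
    free module V serve all X. *)
Definition syz X (a : V) := \sum_(i in X) a i * z i = 0 :> L.

Definition comb X (a : V) : L^o := \sum_(i in X) a i * z i : L.

Fact comb_linear X : linear (comb X).
Proof.
move=> k a b; rewrite /comb [RHS](_ : _ = k * (\sum_(i in X) a i * z i) + \sum_(i in X) b i * z i) //.
by rewrite mulr_sumr -big_split; apply: eq_bigr => i _; rewrite !ffunE mulrDl -mulrA.
Qed.
HB.instance Definition _ X := GRing.isLinear.Build L V L^o *:%R (comb X) (comb_linear X).

Lemma idl_submodule X : submodule (idl X).
Proof.
split=> [|k _ _ [a ->] [b ->]]; first by exists 0; rewrite big1 // => i _; rewrite ffunE mul0r.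
by exists (k *: a + b); have := comb_linear X k a b.
Qed.

Lemma syz_submodule X : submodule (syz X).
Proof.
split=> [|k a b sa sb]; first exact: (linear0 (comb X)).
have [ca cb] : comb X a = 0 /\ comb X b = 0 by [].
by change (comb X (k *: a + b) = 0); rewrite comb_linear ca cb scaler0 addr0.
Qed.

Lemma idlM X k x : idl X x -> idl X (k * x).
Proof. exact: (submoduleZ k (idl_submodule X)). Qed.

Lemma idl_gen X i : i \in X -> idl X (z i).
Proof.
move=> iX; exists [ffun j => (i == j)%:R]; rewrite (bigD1 i) //= ffunE eqxx mul1r big1 ?addr0 //.
by move=> j /andP[_ ji]; rewrite ffunE eq_sym (negPf ji) mul0r.
Qed.

Lemma idl_ind X (P : L -> Prop) : submodule (P : L^o -> Prop) -> (forall i, i \in X -> P (z i)) ->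
  forall x, idl X x -> P x.
Proof.
move=> [P0 PD] Pz x [c ->]; apply: (big_ind P) => // [a b Pa Pb|i iX].
  by have := PD 1 a b Pa Pb; rewrite scale1r.
by have := PD (c i) (z i) 0 (Pz i iX) P0; rewrite addr0.
Qed.

Lemma idlS X B x : X \subset B -> idl X x -> idl B x.
Proof.
move=> /subsetP XB; apply: idl_ind; first exact: idl_submodule.
by move=> i /XB; apply: idl_gen.
Qed.

Variables (E : nat -> lmodType L) (eps : {linear L^o -> E 0%N})
  (delta : forall k, {linear E k -> E k.+1}) (d : nat).
Hypotheses (injE : forall k, injective_module (E k)) (inj_eps : injective eps)
  (exact0 : forall y, delta 0%N y = 0 <-> exists x, y = eps x)
  (exactS : forall k y, delta k.+1 y = 0 <-> exists x, y = delta k x)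
  (E0 : forall k, (d < k)%N -> forall x : E k, x = 0).

(* Ext^(k+1)(P, L) = 0 *)
Definition ext_vanish k (M : lmodType L) (P : M -> Prop) :=
  forall f : M -> E k.+1, lin_on P f -> (forall x, P x -> delta k.+1 (f x) = 0) ->
  exists2 g : M -> E k, lin_on P g & forall x, P x -> delta k (g x) = f x.

Lemma ext_vanish_large k (M : lmodType L) (P : M -> Prop) : (d <= k)%N -> ext_vanish k P.
Proof.
by move=> dk f _ _; exists (fun=> 0) => [a x y _ _|x _]; [rewrite scaler0 addr0 | rewrite linear0 [RHS]E0].
Qed.

Lemma free_lift (M N : lmodType L) (h : {linear M -> N}) (f : V -> N) :
  linear f -> (forall a, exists x, h x = f a) -> exists g : {linear V -> M}, forall a, h (g a) = f a.
Proof.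
move=> lf hf; have [b bP] := choice (fun i => hf [ffun j => (i == j)%:R]).
pose g (a : V) : M := \sum_i a i *: b i.
have lg : linear g.
  move=> k x y; rewrite /g scaler_sumr -big_split; apply: eq_bigr => i _.
  by rewrite !ffunE scalerDl scalerA.
exists (mkLinear lg) => a; rewrite [LHS]linear_sum /=.
have lf' := linear_sum (mkLinear lf).
have aE : a = \sum_i a i *: [ffun j => (i == j)%:R] :> V.
  apply/ffunP => j; rewrite sum_ffunE (bigD1 j) //= !ffunE eqxx big1 ?addr0; last first.
    by move=> i ij; rewrite !ffunE (negPf ij) scaler0.
  by rewrite /GRing.scale /= mulr1.
rewrite {2}aE [RHS]lf'; apply: eq_bigr => i _.
by rewrite linearZ bP [RHS](linearZ_LR (mkLinear lf)).
Qed.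

(** Extend f to g on V by injectivity. Then delta g vanishes on syzygies and descends to a cocycle
    on the ideal; if that is the coboundary of h, then g minus h composed with [comb] is a cocycle
    on V. *)
Lemma syz_extension k X (f : V -> E k) :
  lin_on (syz X) f -> (forall a, syz X a -> delta k (f a) = 0) ->
  ext_vanish k (idl X) ->
  exists2 f' : {linear V -> E k}, forall a, syz X a -> f' a = f a & forall a, delta k (f' a) = 0.
Proof.
move=> lf df van; have [g gP] := injective_extend (@injE k) (syz_submodule X) lf.
have /choice[c cP] (x : L^o) : exists c : V, idl X x -> x = comb X c.
  by have [[c ->]|n0] := pselect (idl X x); [exists c | exists 0 => /n0].
have ker a b : comb X a = comb X b -> delta k (g a) = delta k (g b).
  move=> ab; apply/eqP; rewrite -subr_eq0 -!linearB; apply/eqP.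
  have s : syz X (a - b).
    by change (comb X (a - b) = 0); rewrite linearB /= ab subrr.
  by rewrite gP // df.
have [||h lh hP] := van (fun x => delta k (g (c x))).
- move=> a x y Ix Iy; rewrite -!linearP; apply: ker.
  rewrite -cP; last by apply: (idl_submodule X).2.
  by rewrite comb_linear -!cP.
- move=> x Ix; apply/exactS; by exists (g (c x)).
have lg' : linear (fun a => g a - h (comb X a)).
  move=> a x y; rewrite comb_linear lh; try by [exists x | exists y].
  by rewrite linearP scalerBr opprD addrACA.
exists (mkLinear lg') => [a sa|a].
  rewrite [LHS](_ : _ = g a - h (comb X a)) // -gP //.
  by rewrite [comb X a]sa (lin_on0 (idl_submodule X) lh) subr0.
rewrite [LHS](_ : _ = delta k (g a - h (comb X a))) // linearB hP; last by exists a.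
by apply/eqP; rewrite subr_eq0; apply/eqP/ker/cP; exists a.
Qed.

Lemma ext_shift k X : ext_vanish k.+1 (idl X) -> ext_vanish k (syz X).
Proof.
move=> van f lf df; have [f' ff' df'] := syz_extension lf df van.
have [|g gP] := @free_lift _ _ (delta k) f' (linearP f').
  by move=> a; have /exactS[x] := df' a; exists x.
by exists g => [|a sa]; [apply: lin_onT | rewrite gP ff'].
Qed.

(** If Ext^1 of the ideal vanishes, every map from its syzygies to L extends to V; alpha lists the
    values on unit vectors. *)
Lemma ext1_extend X (f : V -> L^o) : lin_on (syz X) f -> ext_vanish 0 (idl X) ->
  exists alpha : 'I_n -> L, forall a, syz X a -> f a = \sum_i a i * alpha i :> L.
Proof.
move=> lf van; have [|a _|f' ff' df'] := @syz_extension 0 X (eps \o f) _ _ van.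
- by move=> a x y sx sy; rewrite /= lf // linearP.
- by apply/exact0; exists (f a).
have [|g gP] := @free_lift _ _ eps f' (linearP f').
  by move=> a; have /exact0[x] := df' a; exists x.
exists (fun i => g [ffun j => (i == j)%:R]) => a sa.
have aE : a = \sum_i a i *: [ffun j => (i == j)%:R] :> V.
  apply/ffunP => j; rewrite sum_ffunE (bigD1 j) //= !ffunE eqxx big1 ?addr0; last first.
    by move=> i ij; rewrite !ffunE (negPf ij) scaler0.
  by rewrite /GRing.scale /= mulr1.
have -> : f a = g a by apply: inj_eps; rewrite gP ff'.
by rewrite {1}aE linear_sum; apply: eq_bigr => i _; rewrite linearZ.
Qed.

Lemma idlU X B x : idl (X :|: B) x -> exists b c, [/\ idl X b, idl B c & x = b + c].
Proof.
apply: (@idl_ind _ (fun x => exists b c, [/\ idl X b, idl B c & x = b + c])) => [|i].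
  split=> [|a _ _ [b [c [Ib Ic ->]]] [b' [c' [Ib' Ic' ->]]]].
    by exists 0, 0; rewrite addr0; split=> //; case: (idl_submodule X); case: (idl_submodule B).
  exists (a * b + b'), (a * c + c'); split; [exact: (idl_submodule X).2|exact: (idl_submodule B).2|].
  by rewrite [a *: _](_ : _ = a * (b + c)) // mulrDr addrACA.
rewrite inE => /orP[iX|iB]; [exists (z i), 0 | exists 0, (z i)]; rewrite ?addr0 ?add0r.
  by split=> //; [apply: idl_gen | case: (idl_submodule B)].
by split=> //; [case: (idl_submodule X) | apply: idl_gen].
Qed.

(* The B-component of the q-th coordinate of a syzygy. *)
Lemma syz_part X B C q :
  (forall x, idl B x -> idl C x -> x = 0) ->
  (forall a, syz X a -> idl (B :|: C) (a q)) ->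
  exists rho : V -> L^o, [/\ lin_on (syz X) rho, forall a, syz X a -> idl B (rho a) &
    forall a b, syz X a -> idl B b -> idl C (a q - b) -> rho a = b].
Proof.
move=> BC sBC; have [sB sC] := (idl_submodule B, idl_submodule C).
have /choice[rho rhoP] (a : V) : exists b : L^o, syz X a -> idl B b /\ idl C (a q - b).
  have [sa|ns] := pselect (syz X a); last by exists 0 => /ns.
  have [b [c [Ib Ic e]]] := idlU (sBC _ sa).
  by exists b => _; split=> //; rewrite e addrC addKr.
have uniq a b : syz X a -> idl B b -> idl C (a q - b) -> rho a = b.
  move=> /rhoP[Ir Cr] Ib Cb; apply/eqP; rewrite -subr_eq0; apply/eqP; apply: BC.
    exact: (submoduleB sB).
  have -> : rho a - b = (a q - b) - (a q - rho a) by rewrite opprB [RHS]addrC subrKA.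
  exact: (submoduleB sC).
exists rho; split=> //; last by move=> a /rhoP[].
move=> k a b sa sb; have [Ba Ca] := rhoP a sa; have [Bb Cb] := rhoP b sb.
apply: uniq; first exact: (syz_submodule X).2.
  exact: sB.2.
have -> : (k *: a + b) q - (k *: rho a + rho b) = k *: (a q - rho a : L^o) + (b q - rho b).
  by rewrite !ffunE scalerBr opprD addrACA.
exact: sC.2.
Qed.

(** The ideal of B is a direct summand of the syzygies of X: it embeds as the q-th coordinate,
    because z_q kills B, and [syz_part] projects back. *)
Lemma ext_retract k X B C q :
  q \in X -> (forall i, i \in B -> z i * z q = 0) ->
  (forall x, idl B x -> idl C x -> x = 0) ->
  (forall a, syz X a -> idl (B :|: C) (a q)) ->
  ext_vanish k (syz X) -> ext_vanish k (idl B).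
Proof.
move=> qX Bq BC sBC van f lf df.
have [rho [lr Br rE]] := syz_part BC sBC.
have [||g lg gP] := van (fun a => f (rho a)).
- by move=> a x y sx sy; rewrite lr // lf //; apply: Br.
- by move=> a sa; apply: df; apply: Br.
pose e (x : L^o) : V := [ffun j => if q == j then x else 0].
have le : linear e.
  by move=> a x y; apply/ffunP => j; rewrite !ffunE; case: ifP; rewrite ?scaler0 ?addr0.
have se x : idl B x -> syz X (e x).
  move=> Bx; have xq : x * z q = 0.
    move: x Bx; apply: idl_ind => //; split=> [|a x y xq yq]; first by rewrite mul0r.
    by rewrite mulrDl -[a *: x]/(a * x) -mulrA xq yq mulr0 addr0.
  rewrite /syz (bigD1 q) //= ffunE eqxx xq big1 ?addr0 // => i /andP[_ iq].
  by rewrite ffunE eq_sym (negPf iq) mul0r.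
exists (g \o e) => [a x y Bx By|x Bx]; first by rewrite /= le lg //; apply: se.
rewrite /= gP ?(rE _ x) ?ffunE ?eqxx ?subrr //; try exact: se.
by case: (idl_submodule C).
Qed.

(** Vanishing at k+1 for both ideals gives vanishing at k for both syzygy modules, hence at k for
    both ideals through the two implications. The descent starts at the length d of the
    resolution. *)
Lemma ext_vanish_cycle X B :
  (forall k, ext_vanish k (syz X) -> ext_vanish k (idl B)) ->
  (forall k, ext_vanish k (syz B) -> ext_vanish k (idl X)) ->
  forall k, ext_vanish k (idl X) /\ ext_vanish k (idl B).
Proof.
move=> XB BX; suff h j k : (d <= k + j)%N -> ext_vanish k (idl X) /\ ext_vanish k (idl B).
  by move=> k; apply: (h d); apply: leq_addl.
elim: j k => [|j IH] k; first by rewrite addn0 => dk; split; apply: ext_vanish_large.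
rewrite addnS -addSn => /IH[vX vB].
by split; [apply/BX/ext_shift | apply/XB/ext_shift].
Qed.

(* What survives of a face's local ring: z restricted to the vertex set W of G_F. *)
Variables (G : sgraph 'I_n) (W : {set 'I_n}).
Hypotheses (zG : forall i j, G i j -> z i * z j = 0)
  (proper_face : forall S, S \subset W -> independent G S -> ~ idl (W :\: S) 1)
  (face_regular : forall S s (x : L), S \subset W -> independent G S -> s \in S ->
     idl (W :\: S) (x * z s) -> idl (W :\: S) x)
  (joinI0 : forall B C, B \subset W -> C \subset W -> (forall b c, b \in B -> c \in C -> G b c) ->
     forall x : L, idl B x -> idl C x -> x = 0)
  (local_unit : forall x : L, idl W (1 - x) -> exists y, x * y = 1).

(** Modulo the prime generated by W - S only the q-th term of the relation survives, and z_q is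
    regular there. *)
Lemma syz_face X S q a : syz X a -> X \subset W -> S \subset W -> independent G S -> q \in S ->
  q \in X -> (forall i, i \in X -> i \in S -> i = q) -> idl (W :\: S) (a q).
Proof.
move=> sa XW SW iS qS qX XS; apply: (face_regular SW iS qS).
have sI := idl_submodule (W :\: S).
move: sa; rewrite /syz (bigD1 q) //= => /eqP; rewrite addr_eq0 => /eqP ->.
apply: (submoduleN sI); apply: big_ind => [|x y Ix Iy|i /andP[iX iq]].
- by case: sI.
- exact: (submoduleD sI).
apply: idlM; apply: idl_gen; rewrite inE (subsetP XW) // andbT.
by apply: contra iq => /(XS _ iX) ->.
Qed.

Lemma face_gen i : i \in W -> ~ idl (W :\ i) (z i).
Proof.
move=> iW Iz; have iS : [set i] \subset W by rewrite sub1set.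
apply: (proper_face iS (independent1 G i)).
by apply: (face_regular iS (independent1 G i) (set11 i)); rewrite mul1r.
Qed.

Lemma vertex_unit i x : i \in W -> idl (W :\ i) ((1 - x) * z i) -> exists y, x * y = 1.
Proof.
move=> iW Ix; have iS : [set i] \subset W by rewrite sub1set.
apply: local_unit; apply: (@idlS (W :\ i)); first exact: subD1set.
exact: (face_regular iS (independent1 G i) (set11 i)).
Qed.

Definition single i (x : L) : V := [ffun j => if i == j then x else 0].

Lemma single_sum X i x (c : 'I_n -> L) : i \in X -> \sum_(j in X) single i x j * c j = x * c i :> L.
Proof.
move=> iX; rewrite (bigD1 i) //= ffunE eqxx big1 ?addr0 // => j /andP[_ ji].
by rewrite ffunE eq_sym (negPf ji) mul0r.
Qed.

Lemma syz_single X i x : i \in X -> x * z i = 0 -> syz X (single i x).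
Proof. by move=> iX xz; rewrite /syz single_sum. Qed.

Lemma syz_koszul X i j : i \in X -> j \in X -> syz X (single i (z j) - single j (z i)).
Proof.
move=> iX jX; change (comb X (single i (z j) - single j (z i)) = 0).
by rewrite linearB /= /comb !single_sum // mulrC subrr.
Qed.

(* If G_F is a join of two parts, Ext of one part is a shift of Ext of the other. *)
Lemma join_part X Y : X :|: Y = W -> Y != set0 ->
  (forall x y, x \in X -> y \in Y -> G x y) -> forall v w, v \in X -> w \in X -> v = w.
Proof.
move=> XYW /set0Pn[y yY] XY v w vX wX; apply/eqP/negP => /negP vw.
have [XW YW] : X \subset W /\ Y \subset W by rewrite -XYW subsetUl subsetUr.
have YX i j : i \in Y -> j \in X -> G i j by move=> iY jX; rewrite adj_sym XY.
have syzW B i a : B \subset W -> syz B a -> i \in B -> idl (W :\ i) (a i).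
  move=> BW sa iB; apply: (syz_face sa BW _ (independent1 G i) (set11 i)) => //.
    by rewrite sub1set (subsetP BW).
  by move=> j _ /set1P.
have step B C i : B \subset W -> C \subset W -> B :|: C = W -> i \in B ->
    (forall x y, x \in B -> y \in C -> G x y) -> forall a, syz B a -> idl (C :|: B) (a i).
  move=> BW CW BCW iB BC a sa; apply: (@idlS (W :\ i)); first by rewrite setUC BCW subD1set.
  exact: syzW BW _ _.
(* Coordinates of syzygies of X or of Y lie in the ideal of W, the direct sum of the ideals of X and
   Y; hence each of the two is a summand of the syzygies of the other. *)
have vanX k : ext_vanish k (idl X).
  have [] := @ext_vanish_cycle X Y _ _ k => // j.
    apply: (ext_retract vX) (step X Y v XW YW XYW vX XY); last exact: (joinI0 YW XW).
    by move=> i iY; apply/zG/YX.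
  apply: (ext_retract yY) (step Y X y YW XW _ yY YX); last by rewrite setUC.
    by move=> i iX; apply/zG/XY.
  exact: (joinI0 XW YW).
(* The Y-component of the v-th coordinate is given by coefficients al. It equals z_y on the syzygy
   z_y e_v, which makes al v a unit. *)
have [rho [lr Br rE]] := syz_part (joinI0 YW XW YX) (step X Y v XW YW XYW vX XY).
have [al alE] := ext1_extend lr (vanX 0%N).
have ev (i : 'I_n) (x : L) : \sum_j single i x j * al j = x * al i.
  by rewrite -[RHS](@single_sum setT) ?inE //; apply: eq_bigl => j; rewrite inE.
have yv : al v * z y = z y.
  have sy : syz X (single v (z y)) by apply: syz_single => //; apply/zG/YX.
  rewrite mulrC -ev -alE //; apply: rE => //; first exact: idl_gen.
  by rewrite ffunE eqxx subrr; case: (idl_submodule X).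
have [be albe] : exists be, al v * be = 1.
  apply: (@vertex_unit y); first exact: (subsetP YW).
  by rewrite mulrBl mul1r yv subrr; case: (idl_submodule (W :\ y)).
(* On the Koszul relation of v and w the v-th coordinate z_w has no Y-component. So z_w is a
   multiple of z_v, against [face_gen]. *)
have wv : z w * al v = z v * al w.
  apply/eqP; rewrite -subr_eq0 -!ev -sumrB; apply/eqP.
  transitivity (rho (single v (z w) - single w (z v))).
    rewrite alE; last exact: syz_koszul.
    by apply: eq_bigr => j _; rewrite !ffunE -mulrBl.
  apply: rE; [exact: syz_koszul | by case: (idl_submodule Y) |].
  by rewrite !ffunE eqxx eq_sym (negPf vw) subr0 subr0; apply: idl_gen.
apply: (@face_gen w); first exact: (subsetP XW).
have -> : z w = be * al w * z v by rewrite -[z w]mulr1 -albe mulrA wv; ring.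
by apply: idlM; apply: idl_gen; rewrite !inE vw (subsetP XW).
Qed.

(** In the complement of G_F, y has no neighbour but possibly u, and l is a leaf of the path l - p -
    q. The ideals of l and of T = W - {l, p} are summands of each other's syzygies, through the
    coordinates l and q, so Ext^1 of the ideal of T vanishes. The y-component of the u-th coordinate
    of a syzygy of T is then given by coefficients; the Koszul relation of u and y makes al u a
    unit, and z_l e_u then forces z_l = 0. *)
Lemma no_path y u l p q :
  [/\ y \in W, u \in W, l \in W, p \in W & q \in W] ->
  [/\ y != u, y != l, y != p, u != l & u != p] -> q != l -> q != p ->
  (forall w, w \in W -> w != y -> w != u -> G y w) ->
  (forall w, w \in W -> w != l -> w != p -> G l w) ->
  ~~ G l p -> ~~ G q p -> False.
Proof.
move=> [yW uW lW pW qW] [yu yl yp ul up] ql qp yN lN lp nqp.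
pose T := W :\: [set l; p].
have TW : T \subset W by apply: subsetDl.
have lT t : t \in T -> G l t by rewrite !inE negb_or => /andP[/andP[tl tp] tW]; apply: lN.
have inT t : t \in W -> t != l -> t != p -> t \in T by move=> tW tl tp; rewrite !inE negb_or tl tp tW.
have sub1 i : i \in W -> [set i] \subset W by rewrite sub1set.
have lTW := sub1 l lW.
have indep2 i j : ~~ G i j -> independent G [set i; j].
  by move=> ij; rewrite independentU1 independent1; apply/forall_inP => k /set1P ->.
have sT a : syz T a -> idl ([set l] :|: T) (a q).
  move=> sa; apply: (@idlS (W :\: [set q; p])).
    by apply/subsetP => i; rewrite !inE; case: (i =P l) => //= _; case: (i == p); rewrite ?orbT // orbF; case: (i == q).
  apply: (syz_face sa) => //; rewrite ?inE ?eqxx //.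
  - by rewrite subUset !sub1 //.
  - exact: indep2.
  - by rewrite negb_or ql qp.
  by move=> i; rewrite !inE negb_or => /andP[/andP[_ ip] _] /orP[/eqP //|/eqP ipe]; rewrite ipe eqxx in ip.
have vanT k : ext_vanish k (idl T).
  have [] := @ext_vanish_cycle T [set l] _ _ k => // j.
    apply: (@ext_retract _ T [set l] T q) sT; first exact: inT.
      by move=> i /set1P ->; apply/zG/lN.
    by apply: (joinI0 lTW TW) => b c /set1P -> /lT.
  apply: (@ext_retract _ [set l] T set0 l); rewrite ?inE //.
  - by move=> i iT; rewrite mulrC; apply/zG/lT.
  - by move=> x _ [c ->]; rewrite big_set0.
  move=> a sa; rewrite setU0; apply: (syz_face sa) => //; rewrite ?inE ?eqxx //.
  - by rewrite subUset !sub1 //.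
  - exact: indep2.
  by move=> i /set1P.
pose C := W :\: [set y; u].
have yC b c : b \in [set y] -> c \in C -> G b c.
  by move=> /set1P ->; rewrite !inE negb_or => /andP[/andP[cy cu] cW]; apply: yN.
have CW : C \subset W by apply: subsetDl.
have [uT yT] : u \in T /\ y \in T by split; apply: inT.
have su a : syz T a -> idl ([set y] :|: C) (a u).
  move=> sa; apply: (@idlS (W :\ u)).
    by apply/subsetP => i; rewrite !inE; case: (i == y) => //=.
  apply: (syz_face sa) => //; rewrite ?inE ?eqxx ?sub1 ?independent1 //.
  by move=> i _ /set1P.
have [rho [lr Br rE]] := syz_part (joinI0 (sub1 y yW) CW yC) su.
have [al alE] := ext1_extend lr (vanT 0%N).
have ev (i : 'I_n) (x : L) : \sum_j single i x j * al j = x * al i.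
  by rewrite -[RHS](@single_sum setT) ?inE //; apply: eq_bigl => j; rewrite inE.
have yE : z y * al u - z u * al y = z y.
  rewrite -!ev -sumrB; transitivity (rho (single u (z y) - single y (z u))).
    rewrite alE; last exact: syz_koszul.
    by apply: eq_bigr => j _; rewrite !ffunE -mulrBl.
  apply: rE; [exact: syz_koszul | by apply: idl_gen; rewrite inE |].
  by rewrite !ffunE eqxx (negPf yu) subr0 subrr; case: (idl_submodule C).
have [be albe] : exists be, al u * be = 1.
  apply: (@vertex_unit y) => //.
  have -> : (1 - al u) * z y = - al y * z u by rewrite mulrBl mul1r -{1}yE; ring.
  by apply: idlM; apply: idl_gen; rewrite !inE eq_sym yu.
have lu : z l * al u = 0.
  have sl : syz T (single u (z l)) by apply: syz_single => //; apply/zG/lT.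
  rewrite -ev -alE //; apply: rE => //; first by case: (idl_submodule [set y]).
  by rewrite ffunE eqxx subr0; apply: idl_gen; rewrite !inE negb_or eq_sym yl eq_sym ul.
apply: (@face_gen l lW); have -> : z l = 0 by rewrite -[z l]mulr1 -albe mulrA lu mul0r.
by case: (idl_submodule (W :\ l)).
Qed.
End ExtVanishing.

(** * The local ring at the point of a face *)

Section EdgeRingMorphism.
Variables (K : fieldType) (n : nat) (G : sgraph 'I_n) (B : comNzRingType).
Variable f : {rmorphism {mpoly K[n]} -> B}.

Definition kills_edges := forall i j, G i j -> f ('X_i * 'X_j) = 0.
Hypothesis fG : kills_edges.

Definition edge_lift (_ : kills_edges) (a : edge_ring K G) : B := f (repr a).

Lemma edge_liftE p : edge_lift fG (edge_pi G p) = f p.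
Proof.
apply/eqP; rewrite -subr_eq0 -rmorphB; apply/eqP.
have : repr (edge_pi G p) - p \in @edge_ideal K n G.
  by rewrite Quotient.idealrBE reprK.
case/asboolP=> s sX ->; rewrite rmorph_sum big_seq big1 // => u us.
have [i [j [Gij ->]]] := sX _ us.
by rewrite rmorphM fG // mulr0.
Qed.

Fact edge_lift_is_zmod_morphism : zmod_morphism (edge_lift fG).
Proof.
move=> a b; have [[p <-] [q <-]] := (edge_pi_surj a, edge_pi_surj b).
by rewrite -rmorphB !edge_liftE rmorphB.
Qed.
HB.instance Definition _ :=
  GRing.isZmodMorphism.Build (edge_ring K G) B (edge_lift fG) edge_lift_is_zmod_morphism.
Fact edge_lift_is_monoid_morphism : monoid_morphism (edge_lift fG).
Proof.
split=> [|a b]; first by rewrite -[1](rmorph1 (edge_pi G)) edge_liftE rmorph1.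
have [[p <-] [q <-]] := (edge_pi_surj a, edge_pi_surj b).
by rewrite -rmorphM !edge_liftE rmorphM.
Qed.
HB.instance Definition _ :=
  GRing.isMonoidMorphism.Build (edge_ring K G) B (edge_lift fG) edge_lift_is_monoid_morphism.
End EdgeRingMorphism.

Section FaceLocalization.
Variables (K : fieldType) (n : nat) (G : sgraph 'I_n).
Local Notation R := {mpoly K[n]}.
Local Notation A := (edge_ring K G).
Local Notation var := (@var K n G).
Local Notation mon := (@mon K n G).
Implicit Types (F S B C : {set 'I_n}).

Definition restr (S : {set 'I_n}) : {rmorphism R -> R} :=
  comp_mpoly [tuple (if i \in S then 'X_i else 0 : R) | i < n].

Lemma restrX S (m : 'X_{1..n}) : restr S 'X_[m] = if msup m \subset S then 'X_[m] else 0.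
Proof.
rewrite /restr /= comp_mpolyX; case: ifP => [/subsetP mS|/negbT /subsetPn[i]].
  rewrite [RHS]mpolyXE_id; apply: eq_bigr => i _; rewrite tnth_mktuple; case: ifP => // /negbT iS.
  have -> : m i = 0%N by apply/eqP; apply: contraR iS => mi; apply: mS; rewrite inE.
  by rewrite !expr0.
rewrite inE => mi iS; rewrite (bigD1 i) //= tnth_mktuple (negPf iS).
by case: (m i) mi => // k _; rewrite exprS !mul0r.
Qed.

Lemma restr_coef S p (m : 'X_{1..n}) : (restr S p)@_m = if msup m \subset S then p@_m else 0.
Proof.
have -> : restr S p = \sum_(m' <- msupp p) p@_m' *: restr S 'X_[m'].
  rewrite {1}(mpolyE p) raddf_sum; apply: eq_bigr => m' _.
  by rewrite /restr /= comp_mpolyZ.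
rewrite raddf_sum [in RHS](mpolyE p) raddf_sum /=.
case: ifP => mS; last rewrite big1 //; first apply: eq_bigr; move=> m' _.
  rewrite !mcoeffZ restrX; case: ifP => // m'S.
  by rewrite mcoeffX; case: eqP => [mm|_]; rewrite ?mcoeff0 //; rewrite mm mS in m'S.
rewrite mcoeffZ restrX; case: ifP => m'S; last by rewrite mcoeff0 mulr0.
by rewrite mcoeffX; case: eqP => [mm|_]; rewrite ?mulr0 //; rewrite mm mS in m'S.
Qed.

Definition point (F : {set 'I_n}) : {rmorphism R -> K} := meval (fun i => (i \in F)%:R).

Lemma point_restr F S p : F \subset S -> point F (restr S p) = point F p.
Proof.
move=> /subsetP FS; rewrite /= comp_mpoly_meval; apply: meval_eq => i.
rewrite tnth_mktuple; case: ifP => iS; first by rewrite mevalXU.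
by rewrite meval0; case: (boolP (i \in F)) => // /FS; rewrite iS.
Qed.

Lemma restr_kills S : independent G S -> kills_edges G (restr S).
Proof.
move=> /independentP iS i j Gij; rewrite -mpolyXD restrX ifF //; apply/negP.
rewrite msupD !msup1 subUset !sub1set => /andP[iiS jS].
by have := iS i j iiS jS; rewrite Gij.
Qed.

Lemma point_kills F : independent G F -> kills_edges G (point F).
Proof.
move=> /independentP iF i j Gij; rewrite /= mevalM !mevalXU -natrM mulnb.
by case: andP => // -[iiF jF]; have := iF i j iiF jF; rewrite Gij.
Qed.

Variable F : {set 'I_n}.
Hypothesis iF : independent G F.

Definition face_point : {rmorphism A -> K} := edge_lift (point_kills iF).
Definition face_ideal (_ : independent G F) : {pred A} := fun a => face_point a == 0.

Fact face_ideal_closed : idealr_closed (face_ideal iF).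
Proof.
split; rewrite /in_mem /= /face_ideal ?rmorph0 ?rmorph1 ?oner_eq0 //.
by move=> a x y; rewrite !unfold_in => /eqP x0 /eqP y0; rewrite rmorphD rmorphM x0 y0 mulr0 addr0.
Qed.
HB.instance Definition _ := isIdealr.Build A (face_ideal iF) face_ideal_closed.
Fact face_ideal_prime : prime_idealr_closed (face_ideal iF).
Proof. by move=> a b; rewrite !unfold_in rmorphM mulf_eq0. Qed.
HB.instance Definition _ := isPrimeIdealrClosed.Build A (face_ideal iF) face_ideal_prime.

Definition face_prime : prime_idealr A := face_ideal iF.

Lemma face_primeP a : (a \in face_prime) = (face_point a == 0).
Proof. by []. Qed.

Lemma face_prime_maximal : maximal_ideal face_prime.
Proof.
move=> J pJ a aJ; rewrite face_primeP; apply: contraT => a0; set k := face_point a in a0.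
have kJ : scalar_pi K G k \in J.
  have -> : scalar_pi K G k = a - (a - scalar_pi K G k) by rewrite opprB addrC subrK.
  apply: rpredB => //; apply: pJ; rewrite face_primeP rmorphB.
  have -> : face_point (scalar_pi K G k) = k; last by rewrite subrr.
  by rewrite -[scalar_pi K G k]/(edge_pi G k%:MP) [LHS]edge_liftE; apply: mevalC.
by have := idealMr (scalar_pi K G k^-1) kJ; rewrite -rmorphM mulVf // rmorph1 idealr1.
Qed.

Definition face_restr S (iS : independent G S) : {rmorphism A -> R} := edge_lift (restr_kills iS).

Lemma face_restr_eq0 S (iS : independent G S) a :
  face_restr iS a = 0 <-> forall m : 'X_{1..n}, msup m \subset S -> cf m a = 0.
Proof.
have [p <-] := edge_pi_surj a; rewrite [face_restr _ _]edge_liftE.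
have im m : msup m \subset S -> indep_mon G m by move/independentS; apply.
split=> [p0 m mS|p0]; first by rewrite cf_pi im //; have := restr_coef S p m; rewrite mS p0 mcoeff0 => <-.
apply/mpolyP => m; rewrite restr_coef mcoeff0; case: ifP => // mS.
by have := p0 m mS; rewrite cf_pi im.
Qed.

Lemma face_restr_point S (iS : independent G S) a : F \subset S -> face_restr iS a = 0 -> face_point a = 0.
Proof.
have [p <-] := edge_pi_surj a => FS; rewrite [face_restr _ _]edge_liftE [face_point _]edge_liftE.
by rewrite -(point_restr p FS) => ->; rewrite rmorph0.
Qed.

Local Notation L := (localization face_prime).
Local Notation locF := (loc face_prime).
Let W := ~: closed_nbhd G F.
Let z i : L := locF (var i).

Lemma local_face S : S \subset W -> independent G S -> independent G (F :|: S).
Proof.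
move=> /subsetP SW /independentP iS; move/independentP: (iF) => iF'.
have FS x y : x \in F -> y \in S -> ~~ G x y.
  move=> xF /SW; rewrite !inE => /norP[yF]; rewrite yF /= => /exists_inPn /(_ x xF).
  by rewrite adj_sym.
apply/independentP => x y; rewrite !inE => /orP[xF|xS] /orP[yF|yS]; auto.
by rewrite adj_sym; apply: FS.
Qed.

(** For f in F the variable x_f has value 1 at the point, so it is a unit of L, and its product with
    a neighbouring variable is 0. *)
Lemma nbhd_var_eq0 i : i \notin W -> i \notin F -> z i = 0.
Proof.
rewrite !inE negbK => /orP[-> //|/andP[iF' /exists_inP[f fF Gif]]] _.
apply/loc_eq0; exists (var f); last by apply: edge_var; rewrite adj_sym.
by rewrite face_primeP [face_point _]edge_liftE /= mevalXU fF oner_eq0.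
Qed.

(* The prime of L generated by the variables outside the face F :|: S. *)
Definition vanishes S (iS : independent G S) (l : L) :=
  exists a s t, [/\ s \notin face_prime, locF s * t = 1, l = locF a * t & face_restr iS a = 0].

(** Independence of the chosen fraction: [face_restr] maps to a domain, and a denominator cannot
    restrict to 0, since its value at the point of F is nonzero and can be computed after
    restriction. *)
Lemma vanishes_any S (iS : independent G S) a s t : F \subset S -> s \notin face_prime ->
  locF s * t = 1 -> vanishes iS (locF a * t) -> face_restr iS a = 0.
Proof.
move=> FS sp st [a' [s' [t' [s'p s't' e a0]]]].
have [u up ue] : exists2 u, u \notin face_prime & u * (a * s') = u * (a' * s).
  apply/loc_eqP; rewrite !rmorphM.
  transitivity ((locF a * t) * (locF s * locF s')).
    by rewrite -[LHS]mul1r -st; ring.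
  by rewrite e -[RHS]mul1r -s't'; ring.
have us0 : face_restr iS (u * s) != 0.
  apply/eqP => /(face_restr_point FS)/eqP; rewrite -face_primeP prime_idealrM.
  by rewrite (negPf up) (negPf sp).
have us'0 : face_restr iS (u * s') != 0.
  apply/eqP => /(face_restr_point FS)/eqP; rewrite -face_primeP prime_idealrM.
  by rewrite (negPf up) (negPf s'p).
have : face_restr iS a * face_restr iS (u * s') = 0.
  have -> : face_restr iS a * face_restr iS (u * s') = face_restr iS (u * (a * s')).
    by rewrite !rmorphM; ring.
  by rewrite ue !rmorphM a0 mul0r mulr0.
by move/eqP; rewrite mulf_eq0 (negPf us'0) orbF => /eqP.
Qed.

Lemma vanishes_submodule S (iS : independent G S) : submodule (vanishes iS : L^o -> Prop).
Proof.
split=> [|k x y [a [s [t [sp st -> a0]]]] [b [s' [t' [s'p s't' -> b0]]]]].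
  exists 0, 1, 1; split; rewrite ?rmorph0 ?rmorph1 ?mul0r ?mulr1 //.
  by rewrite idealr1.
have [c [r [q [rp rq ->]]]] := loc_frac k.
exists (c * a * s' + b * (r * s)), (r * s * s'), (q * t * t'); split.
- by rewrite !prime_idealrM (negPf rp) (negPf sp).
- transitivity ((locF r * q) * (locF s * t) * (locF s' * t')); first by rewrite !rmorphM; ring.
  by rewrite rq st s't' !mulr1.
- rewrite [LHS](_ : _ = locF c * q * (locF a * t) + locF b * t') // rmorphD !rmorphM.
  transitivity (locF c * q * (locF a * t) * (locF s' * t') + locF b * t' * ((locF r * q) * (locF s * t))).
    by rewrite s't' rq st !mulr1.
  ring.
- by rewrite rmorphD !rmorphM a0 b0 mulr0 !mul0r addr0.
Qed.

Lemma vanishesP S (SW : S \subset W) (iS : independent G S) l :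
  vanishes (local_face SW iS) l <-> idl z (W :\: S) l.
Proof.
split=> [[a [s [t [sp st -> a0]]]]|].
  rewrite mulrC; apply: (submoduleZ t (idl_submodule z (W :\: S))).
  have [r ->] := edge_ring_expand a; rewrite rmorph_sum.
  apply: big_ind => [|x y|m _]; first by case: (idl_submodule z (W :\: S)).
    exact: (submoduleD (idl_submodule z (W :\: S))).
  have [mS|] := boolP (msup m \subset F :|: S).
    have /face_restr_eq0/(_ m mS) -> := a0.
    by rewrite rmorph0 mul0r rmorph0; case: (idl_submodule z (W :\: S)).
  case/subsetPn=> i; rewrite inE => mi iFS.
  have -> : m = (m - U_(i) + U_(i))%MM.
    rewrite submK //; apply/mnm_lepP => j; rewrite mnm1E.
    by case: eqVneq => [<-|//]; rewrite lt0n.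
  rewrite monD mulrA rmorphM; apply: (submoduleZ (_ : L) (idl_submodule z (W :\: S))).
  move: iFS; rewrite !inE => /norP[iF' iS']; have [iW|iW] := boolP (i \in W).
    by apply: (@idl_gen _ _ z); rewrite inE iS'.
  by case: (idl_submodule z (W :\: S)); rewrite -(nbhd_var_eq0 iW iF').
apply: idl_ind; first exact: vanishes_submodule.
move=> i; rewrite inE => /andP[iS' iW]; exists (var i), 1, 1; rewrite !rmorph1 !mulr1.
split=> //; first by rewrite idealr1.
apply/face_restr_eq0 => m mS; rewrite /var cf_mon; case: eqP => [mi|]; last by rewrite andbF.
move: mS; rewrite -mi msup1 sub1set inE (negPf iS') orbF => iF'.
by move: iW; rewrite !inE iF'.
Qed.

Lemma loc_face_edge i j : G i j -> z i * z j = 0.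
Proof. by move=> Gij; rewrite -rmorphM edge_var ?rmorph0. Qed.

Lemma face_proper S : S \subset W -> independent G S -> ~ idl z (W :\: S) 1.
Proof.
move=> SW iS /(vanishesP SW iS) v1.
have := @vanishes_any _ (local_face SW iS) 1 1 1 (subsetUl _ _).
rewrite idealr1 !rmorph1 !mulr1 => /(_ isT erefl v1)/eqP.
by rewrite oner_eq0.
Qed.

Lemma face_domain S s x : S \subset W -> independent G S -> s \in S ->
  idl z (W :\: S) (x * z s) -> idl z (W :\: S) x.
Proof.
move=> SW iS sS /(vanishesP SW iS) vx; apply/(vanishesP SW iS).
have [a [r [t [rp rt xE]]]] := loc_frac x.
have : vanishes (local_face SW iS) (locF (a * var s) * t) by rewrite rmorphM mulrAC -xE.
move/(vanishes_any (subsetUl _ _) rp rt); rewrite rmorphM => /eqP; rewrite mulf_eq0.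
have -> : (face_restr (local_face SW iS) (var s) == 0) = false.
  apply/negbTE/eqP => /face_restr_eq0/(_ U_(s)%MM); rewrite msup1 sub1set inE sS orbT cf_mon.
  by rewrite /indep_mon msup1 independent1 eqxx => /(_ isT)/eqP; rewrite oner_eq0.
by rewrite orbF => /eqP a0; exists a, r, t.
Qed.

(** Multiplication by the unit x_F leaves only monomials supported on some face F :|: S. The
    independent set S misses B or C, since these are joined, so x vanishes on that face and the
    coefficient is 0. *)
Lemma face_joinI0 B C : B \subset W -> C \subset W -> (forall b c, b \in B -> c \in C -> G b c) ->
  forall x, idl z B x -> idl z C x -> x = 0.
Proof.
move=> BW CW BC x Bx Cx; have [a [r [t [rp rt xE]]]] := loc_frac x.
pose e := mon [multinom nat_of_bool (i \in F) | i < n].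
have msF : msup [multinom nat_of_bool (i \in F) | i < n] = F.
  by apply/setP => i; rewrite inE mnmE; case: (i \in F).
suff ea : e * a = 0.
  rewrite xE; have -> : locF a = 0; last by rewrite mul0r.
  apply/loc_eq0; exists e => //.
  rewrite face_primeP [face_point _]edge_liftE /= mevalX.
  rewrite big1 ?oner_eq0 // => i _; rewrite mnmE; case: (i \in F); rewrite ?expr0 ?expr1 //.
have [s ->] := edge_ring_expand a; rewrite mulr_sumr big1 // => m _.
rewrite mulrCA -monD; have [im|/mon_eq0 ->] := boolP (indep_mon G ([multinom nat_of_bool (i \in F) | i < n] + m)%MM); last by rewrite mulr0.
rewrite /indep_mon msupD msF in im.
pose S := msup m :\: F; have FS : F :|: S = F :|: msup m.
  by apply/setP => i; rewrite !inE; case: (i \in F).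
have SW : S \subset W.
  apply/subsetP => i; rewrite !inE => /andP[iF' mi]; rewrite (negPf iF') /=.
  apply/exists_inPn => f fF; move/independentP: im; apply; rewrite !inE ?fF //.
  by rewrite mi orbT.
have iS : independent G S by apply: independentS im; rewrite -FS subsetUr.
have van (D : {set 'I_n}) : D \subset W -> [disjoint D & S] -> idl z D x -> vanishes (local_face SW iS) x.
  move=> DW DS Dx; apply/(vanishesP SW iS); apply: idlS Dx.
  by rewrite subsetD DW.
have vx : vanishes (local_face SW iS) x.
  have [/van|] := boolP [disjoint B & S]; first by apply.
  rewrite -setI_eq0 => /set0Pn[b]; rewrite inE => /andP[bB bS].
  apply: (van C) => //; rewrite -setI_eq0; apply/eqP/setP => c; rewrite in_set0 inE.
  apply/negP => /andP[cC cS]; have /independentP := iS => /(_ b c bS cS).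
  by rewrite BC.
move: vx; rewrite xE => /(vanishes_any (subsetUl _ _) rp rt)/face_restr_eq0/(_ m) ->.
  by rewrite rmorph0 mul0r.
by rewrite FS subsetUr.
Qed.

Lemma face_unit x : idl z W (1 - x) -> exists y, x * y = 1.
Proof.
have [a [r [t [rp rt ->]]]] := loc_frac x; move=> h.
have {h} : vanishes (local_face (sub0set W) (independent0 G)) (1 - locF a * t).
  by apply/vanishesP; rewrite setD0.
rewrite -{1}rt -mulrBl -rmorphB => /(vanishes_any (subsetUl _ _) rp rt)/face_restr_point.
rewrite rmorphB => /(_ (subsetUl _ _))/eqP; rewrite subr_eq0 => /eqP e.
have ap : a \notin face_prime by rewrite face_primeP -e -face_primeP.
have [t' at'] := loc_unit ap; exists (t' * locF r).
by transitivity ((locF a * t') * (locF r * t)); [ring | rewrite at' rt mulr1].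
Qed.

Hypothesis gorG : gorenstein_graph K G.

Lemma gorenstein_join X Y : X :|: Y = W -> Y != set0 ->
  (forall x y, x \in X -> y \in Y -> G x y) -> forall v w, v \in X -> w \in X -> v = w.
Proof.
have [d [E [eps [delta [injE inj_eps ex0 exS E0]]]]] := gorG.2 face_prime face_prime_maximal.
exact: (join_part injE inj_eps ex0 exS E0 loc_face_edge face_proper face_domain face_joinI0 face_unit).
Qed.

Lemma gorenstein_no_path y u l p q :
  [/\ y \in W, u \in W, l \in W, p \in W & q \in W] ->
  [/\ y != u, y != l, y != p, u != l & u != p] -> q != l -> q != p ->
  (forall w, w \in W -> w != y -> w != u -> G y w) ->
  (forall w, w \in W -> w != l -> w != p -> G l w) ->
  ~~ G l p -> ~~ G q p -> False.
Proof.
have [d [E [eps [delta [injE inj_eps ex0 exS E0]]]]] := gorG.2 face_prime face_prime_maximal.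
exact: (no_path injE inj_eps ex0 exS E0 loc_face_edge face_proper face_domain face_joinI0 face_unit).
Qed.
End FaceLocalization.

(** * Purity and isolated vertices of links *)

Section Links.
Variables (T : finType) (G : sgraph T).
Implicit Types (F S X Y : {set T}) (x y u v w : T).
Local Notation W F := (~: closed_nbhd G F).
Local Notation facet S := (maxset (independent G) S).

Lemma inW F x : (x \in W F) = (x \notin F) && [forall y in F, ~~ G x y].
Proof.
rewrite !inE; case: (x \in F) => //=; rewrite negb_exists_in.
by [].
Qed.

Lemma inWP F x : reflect (x \notin F /\ forall y, y \in F -> ~~ G x y) (x \in W F).
Proof. by rewrite inW; apply: (iffP andP) => -[h /forall_inP]. Qed.

Lemma inWU1 F x y : (y \in W (x |: F)) = [&& y != x, ~~ G y x & y \in W F].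
Proof.
apply/inWP/and3P => [[]|[yx xy /inWP[yF h]]].
  rewrite in_setU1 => /norP[yx yF] h; split=> //; first by apply: h; rewrite setU11.
  by apply/inWP; split=> // z zF; apply: h; rewrite !inE zF orbT.
split=> [|z]; first by rewrite !inE negb_or yx.
by rewrite !inE => /orP[/eqP ->|/h].
Qed.

Lemma inW0 x : x \in W set0.
Proof. by apply/inWP; split=> [|y]; rewrite inE. Qed.

Lemma independentW F x : independent G F -> x \in W F -> independent G (x |: F).
Proof. by move=> iF /inWP[_ h]; rewrite independentU1 iF; apply/forall_inP. Qed.

Lemma facetP S : reflect (independent G S /\ W S = set0) (facet S).
Proof.
apply: (iffP idP) => [mS|[iS WS]].
  split; first exact: maxsetp mS.
  apply/eqP/set0Pn => -[x xW]; have /inWP[xS _] := xW.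
  have := maxsetsup mS (independentW (maxsetp mS) xW) (subsetUr _ _).
  by move=> e; rewrite -e setU11 in xS.
apply/maxsetP; split=> // S' iS' SS'; apply/eqP; rewrite eqEsubset SS' andbT.
apply/subsetP => x xS'; apply: contraT => xS; suff: x \in W S by rewrite WS inE.
apply/inWP; split=> // y yS; move/independentP: iS'; apply=> //.
exact: (subsetP SS').
Qed.

Lemma facet_extend F : independent G F -> exists2 S, facet S & F \subset S.
Proof. by case/maxset_exists=> S mS FS; exists S. Qed.

(** The conclusion bounds X alone; exchanging the parts bounds Y, which leaves K_2 as the only
    join. *)
Definition join_free := forall F X Y, independent G F -> X :|: Y = W F -> Y != set0 ->
  (forall x y, x \in X -> y \in Y -> G x y) -> forall v w, v \in X -> w \in X -> v = w.

(** No G_F has an isolated vertex; [tight] is the same condition for one F. *)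
Definition leafy := forall F x, independent G F -> x \in W F -> exists2 y, y \in W F & G x y.

Hypothesis jf : join_free.

Lemma join_pair F X x y : independent G F -> X \subset W F ->
  (forall v w, v \in X -> w \in W F -> w \notin X -> G v w) ->
  x \in X -> y \in W F -> y \notin X -> X = [set x] /\ W F = [set x; y].
Proof.
move=> iF XW XY xX yW yX.
have XYW : X :|: (W F :\: X) = W F.
  by apply/setP => v; rewrite in_setU in_setD; case: (boolP (v \in X)) => // /(subsetP XW) ->.
have yY : y \in W F :\: X by rewrite in_setD yX.
have joined v w : v \in X -> w \in W F :\: X -> G v w.
  by move=> vX; rewrite in_setD => /andP[wX wW]; apply: XY.
have X1 : X = [set x].
  apply/setP => v; rewrite inE; apply/idP/eqP => [vX|-> //].
  by apply: (jf iF XYW _ joined vX xX); apply/set0Pn; exists y.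
have Y1 : W F :\: X = [set y].
  apply/setP => v; rewrite in_set1; apply/idP/eqP => [vY|-> //].
  rewrite setUC in XYW; apply: (jf iF XYW _ _ vY yY); first by apply/set0Pn; exists x.
  by move=> p q pY qX; rewrite adj_sym joined.
by split=> //; rewrite -XYW Y1 X1.
Qed.

(** Induction on the number of vertices outside F. Let X consist of the vertices of G_F all of whose
    facets over F have the size of S. A vertex not adjacent to a member of X shares a facet with it,
    hence is in X by induction. So X is joined to the rest, and G_F is K_2 unless the rest is
    empty. *)
Lemma join_free_pure : well_covered G.
Proof.
suff h k F S S' : (#|T| - #|F| <= k)%N -> facet S -> facet S' -> F \subset S -> F \subset S' -> #|S| = #|S'|.
  by move=> S S' mS mS'; apply: (h #|T| set0); rewrite ?leq_subr ?sub0set.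
elim: k F S S' => [|k IH] F S S' Fk mS mS' FS FS'.
  have FT : F = setT.
    by apply/eqP; rewrite eqEcard subsetT cardsT -subn_eq0 -leqn0.
  move: FS FS'; rewrite FT !subTset => /eqP -> /eqP -> //.
have iF := independentS FS (maxsetp mS).
have [eF|/subsetPn[x xS xF]] := boolP (S \subset F).
  have SF : S = F by apply/eqP; rewrite eqEsubset eF.
  by congr #|pred_of_set _|; rewrite SF in mS *; rewrite (maxsetsup mS (maxsetp mS') FS').
have [eF|/subsetPn[x' xS' xF']] := boolP (S' \subset F).
  have SF : S' = F by apply/eqP; rewrite eqEsubset eF.
  by congr #|pred_of_set _|; rewrite SF in mS' *; rewrite (maxsetsup mS' (maxsetp mS) FS).
have inWS (S0 : {set T}) v : facet S0 -> F \subset S0 -> v \in S0 -> v \notin F -> v \in W F.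
  move=> /maxsetp/independentP iS FS0 vS vF; apply/inWP; split=> // f /(subsetP FS0); exact: iS.
have IH' v S1 S2 : v \notin F -> facet S1 -> facet S2 -> F \subset S1 -> F \subset S2 ->
    v \in S1 -> v \in S2 -> #|S1| = #|S2|.
  move=> vF m1 m2 F1 F2 v1 v2; apply: (IH (v |: F)); rewrite ?subUset ?sub1set ?v1 ?v2 //.
  by rewrite cardsU1 vF addnC addn1 subnS -(leq_add2r 1) !addn1; case: (_ - _)%N Fk.
pose X := [set v in W F | [forall S0 : {set T}, facet S0 && (F \subset S0) && (v \in S0) ==> (#|S0| == #|S|)]].
have inX v : v \in W F -> reflect (forall S0, facet S0 -> F \subset S0 -> v \in S0 -> #|S0| = #|S|) (v \in X).
  move=> vW; rewrite inE vW; apply: (iffP forallP) => h S0.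
    by move=> m0 F0 v0; apply/eqP; move/implyP: (h S0); apply; rewrite m0 F0.
  by apply/implyP => /andP[/andP[m0 F0] v0]; apply/eqP/h.
have xW := inWS _ _ mS FS xS xF; have xW' := inWS _ _ mS' FS' xS' xF'.
have xX : x \in X by apply/(inX _ xW) => S0 m0 F0 x0; apply: (IH' x).
have XY v w : v \in X -> w \in W F -> w \notin X -> G v w.
  move=> vX wW wX; apply: contraR wX => vw; apply/(inX _ wW) => S0 m0 F0 w0.
  have vW : v \in W F by move: vX; rewrite inE => /andP[].
  have [wv|wv] := eqVneq w v; first by apply: (elimT (inX _ vW)) => //; rewrite -wv.
  have vW' : v \in W (w |: F) by rewrite inWU1 eq_sym wv vw.
  have [S1 m1] := facet_extend (independentW (independentW iF wW) vW').
  rewrite !subUset !sub1set => /and3P[v1 w1 F1].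
  rewrite (IH' w S0 S1) //; last by case/inWP: wW.
  exact: (elimT (inX _ vW)).
have [xX'|xX'] := boolP (x' \in X); first by apply/esym/(elimT (inX _ xW')).
have XW : X \subset W F by apply/subsetP => v; rewrite inE => /andP[].
have [_ WE] := join_pair iF XW XY xX xW' xX'.
have Gxx' := XY x x' xX xW' xX'.
have SE (S0 : {set T}) v w : facet S0 -> F \subset S0 -> v \in S0 -> W F = [set v; w] -> G v w -> v \notin F -> S0 = v |: F.
  move=> m0 F0 v0 W0 vw vF; apply/eqP; rewrite eqEsubset subUset sub1set v0 F0 !andbT.
  apply/subsetP => z z0; rewrite !inE; have [//|zF] := boolP (z \in F); first by rewrite orbT.
  rewrite orbF; have := inWS _ _ m0 F0 z0 zF; rewrite W0 !inE => /orP[//|/eqP zw].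
  by move/independentP: (maxsetp m0) => /(_ v z v0 z0); rewrite zw vw.
rewrite (SE S x x') // (SE S' x' x) //; last by rewrite adj_sym.
  by rewrite !cardsU1 xF xF'.
by rewrite WE setUC.
Qed.

Definition tight F := forall x, x \in W F -> exists2 y, y \in W F & G x y.

Definition path_free := forall F y u l p q, independent G F ->
  [/\ y \in W F, u \in W F, l \in W F, p \in W F & q \in W F] ->
  [/\ y != u, y != l, y != p, u != l & u != p] -> q != l -> q != p ->
  (forall w, w \in W F -> w != y -> w != u -> G y w) ->
  (forall w, w \in W F -> w != l -> w != p -> G l w) ->
  ~~ G l p -> ~~ G q p -> False.

Hypothesis pf : path_free.

Lemma handshake (R : rel T) : ssrbool.symmetric R -> irreflexive R ->
  ~~ odd (\sum_x \sum_y R x y)%N.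
Proof.
move=> sR iR; pose lt x y := (enum_rank x < enum_rank y)%N.
have -> : (\sum_x \sum_y R x y)%N = (\sum_x \sum_y (R x y && lt x y) + \sum_x \sum_y (R x y && lt y x))%N.
  rewrite -big_split; apply: eq_bigr => x _; rewrite -big_split; apply: eq_bigr => y _ /=.
  have [->|xy] := eqVneq x y; first by rewrite iR.
  by rewrite /lt; case: ltngtP => [_|_|/ord_inj/enum_rank_inj e]; rewrite ?andbT ?andbF ?addn0 // e eqxx in xy *.
rewrite [X in (_ + X)%N]exchange_big /=; set a := (\sum_x _)%N; set b := (\sum_x _)%N.
have -> : b = a by apply: eq_bigr => x _; apply: eq_bigr => y _; rewrite sR.
by rewrite addnn odd_double.
Qed.

Lemma in_sep (A : {set T}) (P : pred T) x : (x \in [set y in A | P y]) = (x \in A) && P x.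
Proof. by rewrite in_set. Qed.

(** Add w to F, and then the set I of isolated vertices of the new link. If u or y is in I, the
    claim can be read off. Otherwise the enlarged F2 is tight, and adding y to it leaves u a
    neighbour not adjacent to y, a contradiction. *)
Lemma tightU1_isolated F u y : independent G F ->
  (forall F', F \proper F' -> independent G F' -> tight F' -> forall v, v \in W F' -> tight (v |: F')) ->
  u \in W F -> y \in W F -> y != u -> ~~ G y u -> (forall z, z \in W F -> G u z -> G y z) ->
  forall w, w \in W F -> w != u -> w != y -> ~~ G y w ->
  ~~ G w u /\ forall z, z \in W F -> G u z -> G w z.
Proof.
move=> iF IH uW yW yu nyu uy w wW wu wy nyw.
have nwu : ~~ G w u by apply: contra nyw => wu'; apply: uy => //; rewrite adj_sym.
split=> //; pose F1 := w |: F; have iF1 : independent G F1 by apply: independentW.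
have W1 z : (z \in W F1) = [&& z != w, ~~ G z w & z \in W F] by apply: inWU1.
pose I := [set x in W F1 | [forall z in W F1, ~~ G x z]].
have IP x : reflect (x \in W F1 /\ forall z, z \in W F1 -> ~~ G x z) (x \in I).
  by rewrite in_sep; apply: (iffP andP) => -[h /forall_inP].
have [uI|uI] := boolP (u \in I).
  move=> z zW uz; apply: contraT => nwz; have zw : z != w by apply: contraNneq nwu => <-; rewrite adj_sym.
  by have [_ /(_ z)] := elimT (IP u) uI; rewrite W1 zw adj_sym nwz zW uz => /(_ isT).
have [yI|yI] := boolP (y \in I).
  move=> z zW uz; apply: contraT => nwz; have zw : z != w by apply: contraNneq nwu => <-; rewrite adj_sym.
  by have [_ /(_ z)] := elimT (IP y) yI; rewrite W1 zw adj_sym nwz zW uy // => /(_ isT).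
pose F2 := F1 :|: I.
have IF f i : f \in F1 -> i \in I -> ~~ G i f by move=> fF /IP[/inWP[_ h] _]; apply: h.
have W2 z : (z \in W F2) = (z \notin I) && (z \in W F1).
  apply/inWP/andP => [[]|[zI zW]].
    rewrite in_setU => /norP[zF zI] h; split=> //; apply/inWP; split=> // f fF; apply: h.
    by rewrite in_setU fF.
  have /inWP[zF1 h] := zW; split; first by rewrite in_setU negb_or zF1.
  move=> f; rewrite in_setU => /orP[/h //|/IP[_ /(_ z zW)]].
  by rewrite adj_sym.
have iF2 : independent G F2.
  move/independentP: (iF1) => iF1'; apply/independentP => a b; rewrite (in_setU a F1 I) (in_setU b F1 I).
  move=> /orP[aF|aI] /orP[bF|bI]; [exact: iF1'| |exact: IF|].
    by rewrite adj_sym; apply: IF.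
  by have [_ h] := elimT (IP a) aI; apply: h; have [] := elimT (IP b) bI.
have t2 : tight F2.
  move=> x; rewrite W2 => /andP[xI xW].
  have : ~~ [forall z in W F1, ~~ G x z].
    by apply: contra xI => /forall_inP h; apply/IP.
  case/forall_inPn=> z zW; rewrite negbK => xz; exists z => //; rewrite W2 zW andbT.
  by apply/negP => /IP[_ /(_ x xW)]; rewrite adj_sym xz.
have F2F : F \proper F2.
  apply/properP; split; first by apply: (subset_trans (subsetUr [set w] F)); apply: subsetUl.
  by exists w; [rewrite !inE eqxx | case/inWP: wW].
have y2 : y \in W F2 by rewrite W2 yI W1 eq_sym wy nyw yW.
have u2 : u \in W (y |: F2) by rewrite inWU1 eq_sym yu adj_sym nyu W2 uI W1 eq_sym wu adj_sym nwu uW.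
have [z] := IH F2 F2F iF2 t2 y y2 u u2.
rewrite inWU1 W2 W1 => /and3P[_ nzy /andP[_ /and3P[_ _ zW]]] uz.
by rewrite adj_sym (uy z zW uz) in nzy.
Qed.

(** A counterexample forces the complement of G_F to have all degrees one or two, with a leaf.
    Parity gives a second leaf, and [path_free] excludes the configuration. *)
Lemma tightU1 F u : independent G F -> tight F -> u \in W F -> tight (u |: F).
Proof.
have [k] := ubnP (#|T| - #|F|)%N; elim: k => // k IH in F u *; rewrite ltnS => Fk iF tF uW.
have {}IH F' : F \proper F' -> independent G F' -> tight F' -> forall v, v \in W F' -> tight (v |: F').
  move=> FF' iF' tF' v vW; apply: IH => //; apply: leq_trans Fk.
  have FF := proper_card FF'; apply: ltn_sub2l => //; apply: leq_trans FF _; exact: max_card.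
(* The names are exchanged: from here on y0 is the vertex added to F, and u is isolated in the
   resulting link. *)
move=> y0 y0W; have {uW y0W} := (uW, y0W); move: u y0 => y0 u [y0W].
rewrite inWU1 => /and3P[uy0 nuy0 uW].
apply: contrapT => nex.
have uy z : z \in W F -> G u z -> G y0 z.
  move=> zW uz; apply: contraT => ny; case: nex; exists z => //.
  rewrite inWU1 zW andbT adj_sym ny andbT.
  by apply: contraNneq nuy0 => <-.
(* The non-neighbours of u whose neighbourhoods contain that of u. By [tightU1_isolated] they are
   joined to everything outside Y except u. *)
pose Y := [set y in W F | [&& y != u, ~~ G y u & [forall z in W F, G u z ==> G y z]]].
have YP y : reflect [/\ y \in W F, y != u, ~~ G y u & forall z, z \in W F -> G u z -> G y z] (y \in Y).
  rewrite in_sep; apply: (iffP and4P) => -[yW yu nyu h]; split=> //.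
    by move=> z zW uz; have /forall_inP/(_ z zW)/implyP := h; apply.
  by apply/forall_inP => z zW; apply/implyP/h.
have y0Y : y0 \in Y by apply/YP; rewrite eq_sym adj_sym.
have clos y w : y \in Y -> w \in W F -> w != u -> w \notin Y -> G y w.
  move=> yY wW wu; apply: contraR => nyw; have [-> //|wy] := eqVneq w y.
  have /YP[yW yu nyu yuz] := yY.
  have [nwu h] := tightU1_isolated iF IH uW yW yu nyu yuz wW wu wy nyw.
  by apply/YP.
have iFu := independentW iF uW.
have YWu : Y \subset W (u |: F).
  by apply/subsetP => y /YP[yW yu nyu _]; rewrite inWU1 yu nyu.
(* If Y is the whole link of u, the non-neighbours of u are joined to its neighbours. Otherwise Y is
   one side of a join in that link, which is then the edge {y0, r}. *)
have [/subsetP rest|/subsetPn[r rW rY]] := boolP (W (u |: F) \subset Y).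
  have [z zW uz] := tF u uW; pose X := W F :\: [set z | G u z].
  have XE v : (v \in X) = ~~ G u v && (v \in W F) by rewrite in_setD (in_set (fun z => G u z)).
  have uX : u \in X by rewrite XE adj_irr.
  have y0X : y0 \in X by rewrite XE adj_sym; apply/andP; case/YP: y0Y.
  have XW : X \subset W F by apply: subsetDl.
  have [||X1 _] := join_pair iF XW _ uX zW; last first.
  - by move: y0X; rewrite X1 in_set1 eq_sym (negPf uy0).
  - by rewrite XE uz.
  move=> v w; rewrite !XE => /andP[nuv vW] wW; rewrite wW andbT negbK => uw.
  have [-> //|vu] := eqVneq v u.
  have /rest/YP[_ _ _ h] : v \in W (u |: F) by rewrite inWU1 vu adj_sym nuv.
  exact: h.
have rWF : r \in W F by move: rW; rewrite inWU1 => /and3P[].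
have [|YE WE] := join_pair iFu YWu _ y0Y rW rY.
  move=> v w vY; rewrite inWU1 => /and3P[wu _ wW]; exact: clos.
have nN w : w \in W F -> w != u -> w != y0 -> w != r -> G u w.
  move=> wW wu wy wr; apply: contraT => nuw.
  have : w \in W (u |: F) by rewrite inWU1 wu adj_sym nuw.
  by rewrite WE !inE (negPf wy) (negPf wr).
have yN w : w \in W F -> w != y0 -> w != u -> G y0 w.
  by move=> wW wy wu; apply: clos => //; rewrite YE inE.
have [ru nru] : r != u /\ ~~ G r u by move: rW; rewrite inWU1 => /and3P[].
have ry : r != y0 by apply: contraNneq rY => ->.
have y0Wu : y0 \in W (u |: F) by apply: (subsetP YWu).
have iFuy := independentW iFu y0Wu.
(* By purity this facet shows that G_F has independence number two. [D w] is the neighbourhood of w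
   in the complement; it will have one or two elements. *)
have fac : maxset (independent G) (y0 |: (u |: F)).
  apply/facetP; split=> //; apply/eqP/set0Pn => -[w]; rewrite !inWU1 => /and4P[wy nwy wu /andP[nwu wW]].
  by rewrite adj_sym yN in nwy.
have uF : u \notin F by case/inWP: uW.
have cfac : #|y0 |: (u |: F)| = #|F|.+2.
  by rewrite !cardsU1 uF in_setU1 (eq_sym y0) (negPf uy0) /=; case/inWP: y0W => ->.
pose D w := W (w |: F).
have D2 w v v' : w \in W F -> v \in D w -> v' \in D w -> v != v' -> G v v'.
  move=> wW vD v'D vv'; apply: contraT => nvv'.
  have iv := independentW (independentW iF wW) vD.
  have v'D' : v' \in W (v |: (w |: F)) by rewrite inWU1 eq_sym vv' adj_sym nvv'.
  have [S mS] := facet_extend (independentW iv v'D').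
  move/subset_leq_card; rewrite (join_free_pure mS fac) cfac.
  rewrite !cardsU1; case/inWP: v'D' => -> _; case/inWP: vD => -> _; case/inWP: wW => -> _.
  by rewrite !add1n !ltnS ltnn.
have D0 w : w \in W F -> exists v, v \in D w.
  move=> wW; apply/set0Pn; apply: contraT; rewrite negbK => /eqP Dw0.
  have wN v : v \in W F -> v != w -> G w v.
    move=> vW vw; apply: contraT => nwv; have : v \in D w by rewrite inWU1 vw adj_sym nwv.
    by rewrite Dw0 inE.
  have sub1 : [set w] \subset W F by rewrite sub1set.
  have [x xW [xw x2]] : exists2 x, x \in W F & x != w /\ exists2 x', x' \in W F & x' != w /\ x' != x.
    have [->|yw] := eqVneq w y0; first by exists u => //; split=> //; exists r.
    have [->|uw] := eqVneq w u; first by exists y0 => //; split; rewrite 1?eq_sym //; exists r.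
    exists y0 => //; split; first by rewrite eq_sym.
    by exists u => //; split=> //; rewrite eq_sym.
  have [||_ WFE] := join_pair iF sub1 _ (set11 w) xW; rewrite ?inE //.
    by move=> v v' /set1P -> v'W; rewrite in_set1; apply: wN.
  have [x' x'W [x'w x'x]] := x2.
  by move: x'W; rewrite WFE !inE (negPf x'w) (negPf x'x).
have D12 w v v' v'' : w \in W F -> v \in D w -> v' \in D w -> v'' \in D w -> v != v' -> v'' = v \/ v'' = v'.
  move=> wW vD v'D v''D vv'; have sub1 : [set v] \subset W (w |: F) by rewrite sub1set.
  have [||_ DE] := join_pair (independentW iF wW) sub1 _ (set11 v) v'D; last first.
  - by move: v''D; rewrite /D DE !inE => /orP[] /eqP; [left | right].
  - by rewrite in_set1 eq_sym.
  by move=> a b /set1P -> bW; rewrite in_set1 eq_sym; apply: (D2 w).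
(* In the complement y0 has degree one, so by the handshake lemma another vertex l has odd degree,
   that is, a single neighbour p. *)
have [l lW [ly [p lD lp]]] : exists2 l, l \in W F & l != y0 /\ exists2 p, p \in D l & forall v, v \in D l -> v = p.
  apply: contrapT => nol.
  pose R v w := [&& v \in W F, w \in W F, v != w & ~~ G v w].
  have sR : ssrbool.symmetric R.
    by move=> v w; rewrite /R eq_sym adj_sym; case: (v \in _); case: (w \in _).
  have iR : irreflexive R by move=> v; rewrite /R eqxx !andbF.
  have RD w v : w \in W F -> R w v = (v \in D w).
    by move=> wW; rewrite /R wW /D inWU1 eq_sym adj_sym /=; case: (v \in _); rewrite ?andbT ?andbF.
  have := handshake sR iR; rewrite (bigD1 y0) //=.
  have -> : (\sum_y R y0 y = 1)%N.
    rewrite (bigD1 u) //= big1 => [|w wu]; rewrite RD // inWU1.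
      by rewrite uy0 nuy0 uW.
    by have [->//|wy] := eqVneq w y0; case wW: (w \in W F); rewrite ?andbF // adj_sym yN.
  rewrite oddD /= negbK; apply/negP.
  apply: (big_ind (fun k => ~~ odd k)) => // [a b|w wy]; first by rewrite oddD => /negPf -> /negPf ->.
  have [wW|wW] := boolP (w \in W F); last first.
    by rewrite big1 // => v _; rewrite /R; case: (v \in W F) => //; rewrite (negPf wW).
  have [v vD] := D0 w wW; have [v' v'D vv'] : exists2 v', v' \in D w & v != v'.
    apply: contrapT => nv'; apply: nol; exists w => //; split=> //; exists v => // v' v'D.
    by apply/eqP; apply: contraT => vv'; case: nv'; exists v' => //; rewrite eq_sym.
  rewrite (bigD1 v) //= (bigD1 v') 1?eq_sym //= big1 => [|v'' /andP[v1 v2]]; rewrite !RD // ?vD ?v'D //.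
  case: (boolP (v'' \in D w)) => // v''D.
  by have [e|e] := D12 w v v' v'' wW vD v'D v''D vv'; rewrite e eqxx in v1 v2.
have {lD} [pW pl nlp] : [/\ p \in W F, p != l & ~~ G l p].
  by move: lD; rewrite inWU1 adj_sym => /and3P[].
have lN w : w \in W F -> w != l -> w != p -> G l w.
  move=> wW wl wp; apply: contraT => nlw.
  have /lp e : w \in D l by rewrite inWU1 wl adj_sym nlw.
  by rewrite e eqxx in wp.
have ul : u != l.
  apply/eqP => ul.
  have rp : r = p by apply: lp; rewrite -ul inWU1 ru nru rWF.
  have y0p : y0 = p by apply: lp; rewrite -ul; exact: y0Wu.
  by rewrite rp y0p eqxx in ry.
have yp : y0 != p.
  by apply: contraNneq nlp => <-; rewrite adj_sym; apply: yN; rewrite // eq_sym.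
have up : u != p.
  apply/eqP => up.
  have lr : l = r.
    by apply/eqP; apply: contraT => lr; move: nlp; rewrite adj_sym -up nN // eq_sym.
  rewrite {}lr -{}up in lN; pose X := [set w in W F | [|| w == y0, w == u | w == r]].
  have XE w : (w \in X) = (w \in W F) && [|| w == y0, w == u | w == r] by apply: in_sep.
  have [z zW uz] := tF u uW.
  have XW : X \subset W F by apply/subsetP => w; rewrite XE => /andP[].
  have y0X : y0 \in X by rewrite XE y0W eqxx.
  have uX : u \in X by rewrite XE uW eqxx orbT.
  have zX : z \notin X.
    rewrite XE zW; apply: contraL uz => /or3P[] /eqP ->; rewrite ?adj_irr // adj_sym //.
  have [|X1 _] := join_pair iF XW _ uX zW zX; last by move: y0X; rewrite X1 in_set1 eq_sym (negPf uy0).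
  move=> v w; rewrite XE => /andP[_ vX] wW; rewrite XE wW /= => /norP[wy /norP[wu wr]].
  by case/or3P: vX => /eqP ->; [apply: yN | apply: nN | apply: lN].
(* Otherwise {l, p} would be a component of the complement, hence a side of a join. *)
have [q [qW ql qp nqp]] : exists q, [/\ q \in W F, q != l, q != p & ~~ G q p].
  apply: contrapT => noq; pose X := [set w in W F | (w == l) || (w == p)].
  have XE w : (w \in X) = (w \in W F) && ((w == l) || (w == p)) by apply: in_sep.
  have XW : X \subset W F by apply/subsetP => w; rewrite XE => /andP[].
  have lX : l \in X by rewrite XE lW eqxx.
  have pX : p \in X by rewrite XE pW eqxx orbT.
  have uX : u \notin X by rewrite XE uW (negPf ul) (negPf up).
  have [|X1 _] := join_pair iF XW _ lX uW uX; last by move: pX; rewrite X1 in_set1 (negPf pl).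
  move=> v w; rewrite XE => /andP[_ vX] wW; rewrite XE wW /= => /norP[wl wp].
  case/orP: vX => /eqP ->; first exact: lN.
  by apply: contraT => npw; case: noq; exists w; split=> //; rewrite adj_sym.
apply: (pf iF (y := y0) (u := u) (l := l) (p := p) (q := q)) => //.
split=> //; by rewrite eq_sym.
Qed.

Hypothesis noiso : no_isolated G.

Lemma path_free_leafy : leafy.
Proof.
move=> F x iF xW; suff: tight F by apply.
have [k] := ubnP #|F|; elim: k => // k IH in F iF {x xW} *; rewrite ltnS => Fk.
have [->|[f fF]] := set_0Vmem F.
  by move=> x _; have [y xy] := noiso x; exists y => //; apply: inW0.
have iF' : independent G (F :\ f) by apply: independentS iF; apply: subsetDl.
rewrite -(setD1K fF); apply: tightU1 => //.
  by apply: IH => //; rewrite (leq_trans _ Fk) // [in X in (_ < X)%N](cardsD1 f) fF.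
apply/inWP; split=> [|y]; first by rewrite !inE eqxx.
by rewrite !inE => /andP[_ yF]; move/independentP: iF; apply.
Qed.
End Links.

Lemma facet_indep_number (T : finType) (G : sgraph T) (S : {set T}) :
  well_covered G -> maxset (independent G) S -> indep_number G = #|S|.
Proof.
move=> wc mS; apply/eqP; rewrite eqn_leq /indep_number leq_bigmax_cond ?(maxsetp mS) // andbT.
apply/bigmax_leqP => S0 iS0; have [S1 m1 /subset_leq_card] := facet_extend iS0.
by rewrite (wc S1 S).
Qed.

(** * Links and the class W_2 *)

Section DoublyCovered.
Variables (T : finType) (G : sgraph T).
Implicit Types (F S X Y : {set T}) (x y u v w : T).
Local Notation W F := (~: closed_nbhd G F).
Local Notation facet S := (maxset (independent G) S).

Lemma independent_induced (U : {set T}) (S : {set {x | x \in U}}) :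
  independent (induced G U) S = independent G (val @: S).
Proof.
apply/independentP/independentP => h.
  by move=> _ _ /imsetP[x xS ->] /imsetP[y yS ->]; apply: h.
by move=> x y xS yS; apply: h; apply: imset_f.
Qed.

(** A facet of G - v that is not maximal in G has link {v}, in which v is isolated. *)
Lemma del_vertex_facet v (S : {set {x | x \in ~: [set v]}}) : leafy G ->
  maxset (independent (del_vertex G v)) S -> facet (val @: S).
Proof.
move=> lf mS; have iS : independent G (val @: S) by rewrite -independent_induced (maxsetp mS).
apply/facetP; split=> //; apply/eqP/set0Pn => -[x xW].
suff eqv y : y \in W (val @: S) -> y = v.
  by have [y /eqv ->] := lf _ _ iS xW; rewrite (eqv x xW) adj_irr.
move=> yW; apply/eqP; apply: contraT => yv; have yU : y \in ~: [set v] by rewrite !inE.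
pose y' : {x | x \in ~: [set v]} := Sub y yU.
have yS : y' |: S = S.
  apply: (maxsetsup mS); last exact: subsetUr.
  by rewrite /del_vertex independent_induced imsetU1; apply: independentW.
by case/inWP: yW => /negP[]; apply/imsetP; exists y'; rewrite // -yS setU11.
Qed.

Lemma leafy_W2 : well_covered G -> leafy G -> in_W2 G.
Proof.
move=> wc lf; split=> // v.
have card_facet (S : {set {x | x \in ~: [set v]}}) S' : maxset (independent (del_vertex G v)) S -> facet S' -> #|S| = #|S'|.
  by move=> /(del_vertex_facet lf) mS mS'; rewrite -(card_imset _ val_inj); apply: wc.
have [S0 mS0 _] := facet_extend (independent0 G).
have wcv : well_covered (del_vertex G v).
  by move=> S S' /card_facet/(_ mS0) -> /card_facet/(_ mS0) ->.
split=> //; have [S mS _] := facet_extend (independent0 (del_vertex G v)).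
by rewrite (facet_indep_number wc mS0) (facet_indep_number wcv mS) (card_facet S S0).
Qed.

(** If x is isolated in G_F, extend F to a facet S of G - x. A neighbour of x in S would be one in
    G_F, so x can be added to S, and G has larger independence number than G - x. *)
Lemma W2_leafy : in_W2 G -> leafy G.
Proof.
move=> [wc wcv] F x iF xW; apply: contrapT => nex.
have [wcx ex] := wcv x; have [xF xN] := inWP G F x xW.
pose F' : {set {y | y \in ~: [set x]}} := val @^-1: F.
have iF' : independent (del_vertex G x) F'.
  rewrite independent_induced; apply: independentS iF.
  by apply/subsetP => _ /imsetP[y yF ->]; move: yF; rewrite inE.
have [S mS FS] := facet_extend iF'.
have iS : independent G (val @: S) by rewrite -independent_induced (maxsetp mS).
have FvS f : f \in F -> f \in val @: S.
  move=> fF; have fx : f \in ~: [set x] by rewrite !inE; apply: contraNneq xF => <-.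
  by apply/imsetP; exists (Sub f fx); rewrite // (subsetP FS) // inE.
have iS1 : independent G (x |: val @: S).
  rewrite independentU1 iS; apply/forall_inP => y yS; apply/negP => xy; apply: nex; exists y => //.
  apply/inWP; split; first by apply/negP => /xN; rewrite xy.
  by move=> f /FvS fS; move/independentP: iS; apply.
have xS : x \notin val @: S.
  by apply/imsetP => -[y _ xy]; have := valP y; rewrite !inE -xy eqxx.
have [S1 m1 /subset_leq_card] := facet_extend iS1.
rewrite cardsU1 xS (card_imset _ val_inj) -(facet_indep_number wc m1) -ex.
by rewrite (facet_indep_number wcx mS) ltnn.
Qed.
End DoublyCovered.

(** * Independence number two, and at least four *)

Definition cyc m (i j : nat) : bool := (j == i.+1 %% m)%N || (i == j.+1 %% m)%N.

Lemma modS m i : (i < m)%N -> (i.+1 %% m = if i.+1 == m then 0 else i.+1)%N.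
Proof. by move=> im; case: eqVneq => [->|ne]; rewrite ?modnn // modn_small // ltn_neqAle ne. Qed.

Lemma cycE m i j : (i < m)%N -> (j < m)%N ->
  cyc m i j = [|| j == i.+1, i == j.+1, (i.+1 == m) && (j == 0%N) | (j.+1 == m) && (i == 0%N)].
Proof.
by move=> im jm; rewrite /cyc !modS //; case: (i.+1 =P m) => ?; case: (j.+1 =P m) => ?; lia.
Qed.

Section CycleListing.
Variables (T : finType) (G : sgraph T).
Implicit Types (F S X Y : {set T}) (x y u v w : T).
Local Notation W F := (~: closed_nbhd G F).
Local Notation facet S := (maxset (independent G) S).
Hypotheses (jf : join_free G) (lf : leafy G).
Variable F : {set T}.
Hypotheses (iF : independent G F) (F2 : (indep_number G = #|F|.+2)%N).
Let wc : well_covered G := join_free_pure jf.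
Local Notation D w := (W (w |: F)).

Lemma link2_nonadj w v v' : w \in W F -> v \in D w -> v' \in D w -> v != v' -> G v v'.
Proof.
move=> wW vD v'D vv'; apply: contraT => nvv'.
have iv := independentW (independentW iF wW) vD.
have v'D' : v' \in W (v |: (w |: F)) by rewrite inWU1 eq_sym vv' adj_sym nvv'.
have [S mS] := facet_extend (independentW iv v'D').
move/subset_leq_card; rewrite -(facet_indep_number wc mS) F2.
rewrite !cardsU1; case/inWP: v'D' => -> _; case/inWP: vD => -> _; case/inWP: wW => -> _.
by rewrite !add1n !ltnS ltnn.
Qed.

Lemma link2_other w v : w \in W F -> v \in D w -> exists2 v', v' != v & D w = [set v; v'].
Proof.
move=> wW vD; have iwF := independentW iF wW; have [v' v'D vv'] := lf iwF vD.
have v'v : v' != v by apply: contraTneq vv' => ->; rewrite adj_irr.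
have sub1 : [set v] \subset D w by rewrite sub1set.
exists v' => //; have [||//] := join_pair jf iwF sub1 _ (set11 v) v'D; last by rewrite inE.
by move=> a b /set1P -> bW; rewrite in_set1 eq_sym; apply: (@link2_nonadj w).
Qed.

Lemma link2_nonempty w : w \in W F -> exists v, v \in D w.
Proof.
move=> wW; apply/set0Pn; apply: contraT; rewrite negbK => /eqP Dw0.
have fw : facet (w |: F) by apply/facetP; split=> //; apply: independentW.
have := facet_indep_number wc fw; rewrite F2 cardsU1; case/inWP: wW => -> _.
by rewrite add1n => /eqP; rewrite eqSS gtn_eqF.
Qed.

Lemma inD w v : (v \in D w) = [&& v != w, ~~ G v w & v \in W F].
Proof. exact: inWU1. Qed.

Lemma inDC w v : v \in D w -> w \in W F -> w \in D v.
Proof. by rewrite !inD eq_sym adj_sym => /and3P[-> -> _] ->. Qed.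

(** Every vertex of G_F has exactly two non-neighbours there. The walk that always leaves by the
    other one closes up, and its vertices are joined to all others, so there are no others. *)
Lemma cycle_listing : exists c : seq T, [/\ uniq c, c =i W F, (4 <= size c)%N &
  forall x0 i j, (i < size c)%N -> (j < size c)%N ->
    (nth x0 c j \in D (nth x0 c i)) = cyc (size c) i j].
Proof.
have [v0 v0W] : exists v0, v0 \in W F.
  apply/set0Pn; apply: contraT; rewrite negbK => /eqP F0.
  have fF : facet F by apply/facetP.
  have /eqP := facet_indep_number wc fF; rewrite F2.
  by rewrite gtn_eqF.
have [v1 v1D] := link2_nonempty v0W.
have /choice[oth othP] (p : T * T) : exists v', p.2 \in W F -> p.1 \in D p.2 ->
    v' != p.1 /\ D p.2 = [set p.1; v'].
  have [[h1 h2]|n] := pselect (p.2 \in W F /\ p.1 \in D p.2); last by exists v0 => h1 h2; case: n.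
  by have [v' ? ?] := link2_other h1 h2; exists v'.
(* A state is a pair of consecutive vertices; [oth] gives the non-neighbour of the second that is
   not the first. *)
pose st p := (p.2, oth p); pose p k := iter k st (v0, v1); pose x k := (p k).1.
have xS k : (p k).2 = x k.+1 by [].
have xW k : x k \in W F /\ x k.+1 \in D (x k).
  elim: k => [|k [IH1 IH2]]; first by [].
  have kW : x k.+1 \in W F by move: IH2; rewrite inD => /and3P[].
  split=> //; have [_ e] := othP (p k) kW (inDC IH2 IH1).
  by rewrite -/(x k.+1) [D _]e !inE eqxx orbT.
have xne k : x k.+1 != x k by have [_] := xW k; rewrite inD => /and3P[].
have xD k : D (x k.+1) = [set x k; x k.+2] /\ x k.+2 != x k.
  have [IH1 IH2] := xW k; have [IH3 _] := xW k.+1.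
  by have [] := othP (p k) IH3 (inDC IH2 IH1).
have exm : exists m, x m \in mkseq x m.
  apply: contrapT => nm.
  have u k : uniq (mkseq x k).
    elim: k => [|k IH] //; rewrite /mkseq -addn1 iotaD map_cat cat_uniq [uniq _]IH add0n /=.
    by rewrite orbF andbT; apply/negP => h; apply: nm; exists k.
  by have := uniq_leq_size (u #|T|.+1) (s2 := enum T) (fun y _ => mem_enum T y); rewrite size_mkseq -cardE ltnn.
have [m xm mmin] := ex_minnP exm.
pose c := mkseq x m; have uc : uniq c.
  have: forall k, (k <= m)%N -> uniq (mkseq x k); last by apply.
  elim=> [|k IH] // km; rewrite /mkseq -addn1 iotaD map_cat cat_uniq [uniq _]IH 1?ltnW // add0n /=.
  by rewrite orbF andbT; apply/negP => /mmin; rewrite leqNgt km.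
have xinj i j : (i < m)%N -> (j < m)%N -> x i = x j -> i = j.
  move=> im jm e; apply/eqP; rewrite -(nth_uniq v0 (s := c)) ?size_mkseq //.
  by rewrite !nth_mkseq // e.
(* A repeated vertex other than x 0 already has both its places on the walk taken. *)
have xm0 : x m = x 0%N.
  have /mapP[j] := xm; rewrite mem_iota add0n => /andP[_ jm] e.
  case: j => [|j] in jm e *; first by [].
  case: m {mmin xm c uc} => // m in xinj jm e *.
  have : x m \in D (x j.+1) by rewrite -e inDC //; have [] := xW m.
  rewrite (xD j).1 !inE => /orP[] /eqP.
    by move/xinj; rewrite (ltnW jm) ltnSn => /(_ isT isT) mj; rewrite -mj ltnn in jm.
  have [jm'|] := ltnP j.+2 m.+1.
    move/xinj; rewrite ltnSn jm' => /(_ isT isT) mj.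
    by have [_] := xD j.+1; rewrite -mj e eqxx.
  move=> mj; have {mj} jE : m = j.+1 by lia.
  by move=> _; have := xne m; rewrite e -jE eqxx.
have m3 : (2 < m)%N.
  case: m xm0 xm {mmin c uc xinj} => [|[|[|m]]] // h _.
    by have := xne 0%N; rewrite h eqxx.
  by have [_] := xD 0%N; rewrite h eqxx.
have m1 : (1 < m)%N := ltnW m3.
have m0 : (0 < m)%N := ltnW m1.
have nb0 : D (x 0%N) = [set x 1%N; x m.-1].
  have [_ d1] := xW 0%N; have [v' v'1 e] := link2_other v0W d1.
  have : x m.-1 \in D (x 0%N).
    by rewrite -xm0 -[in D (x m)](prednK (ltnW (ltnW m3))) inDC //; have [] := xW m.-1.
  rewrite e !inE => /orP[/eqP|/eqP -> //].
  by move/xinj; rewrite prednK // leqnn m1 => /(_ isT isT) e1; rewrite -e1 in m3; case: m m3 e1 {xm mmin c uc xinj xm0 m1 m0 v'1 e} => [|[|[]]].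
have cE v : v \in c -> exists2 i, (i < m)%N & v = x i.
  by case/mapP=> i; rewrite mem_iota add0n => /andP[_ im] ->; exists i.
have xc i : (i < m)%N -> x i \in c.
  by move=> im; apply/mapP; exists i; rewrite // mem_iota.
have adjc i j : (i < m)%N -> (j < m)%N -> (x j \in D (x i)) = cyc m i j.
  move=> im jm; rewrite cycE //; case: i => [|i] in im *.
    rewrite nb0 !inE; apply/idP/idP => [/orP[] /eqP h|h].
    - by have := xinj _ _ jm (ltnW m3) h; lia.
    - by have := xinj _ _ jm (ltac:(lia) : (m.-1 < m)%N) h; lia.
    have [->|->] : j = 1%N \/ j = m.-1 by lia.
      by rewrite eqxx.
    by rewrite eqxx orbT.
  rewrite (xD i).1 !inE; apply/idP/idP => [/orP[] /eqP h|h].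
  - by have := xinj _ _ jm (ltnW im) h; lia.
  - have [i2|i2] := ltnP i.+2 m; first by have := xinj _ _ jm i2 h; lia.
    have im' : i.+2 = m by lia.
    by rewrite im' xm0 in h; have := xinj j 0%N jm (ltac:(lia)) h; lia.
  have [->|[->|[im' ->]]] : j = i \/ (j = i.+2 \/ i.+2 = m /\ j = 0%N) by lia.
  - by rewrite eqxx.
  - by rewrite eqxx orbT.
  by rewrite im' xm0 eqxx orbT.
exists c; split=> //; rewrite ?size_mkseq //.
- pose X := [set v in c]; move=> v; apply/idP/idP; first by case/cE=> i _ ->; have [] := xW i.
  move=> vW; apply: contraT => vc.
  have XW : X \subset W F by apply/subsetP => y; rewrite inE => /cE[i _ ->]; have [] := xW i.
  have x0X : x 0%N \in X by rewrite inE xc.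
  have vX : v \notin X by rewrite inE.
  have [|X1 _] := join_pair jf iF XW _ x0X vW vX; last first.
    have : x 1%N \in X by rewrite inE xc.
    by rewrite X1 inE (negPf (xne 0%N)).
  move=> a b; rewrite in_set => /cE[i im ->] bW; rewrite in_set => bc.
  apply: contraT => nab; have : b \in D (x i).
    by rewrite inD bW adj_sym nab !andbT; apply: contraNneq bc => ->; apply: xc.
  case: i im {nab} => [|i] im.
    by rewrite nb0 !inE => /orP[] /eqP be; move: bc; rewrite be xc // prednK.
  rewrite (xD i).1 !inE => /orP[] /eqP be; first by move: bc; rewrite be xc // ltnW.
  have [i2|i2] := ltnP i.+2 m; first by rewrite be xc // in bc.
  have im' : i.+2 = m by apply/eqP; rewrite eqn_leq im i2.
  by move: bc; rewrite be im' xm0 xc.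
(* Length three would give x 0 two non-neighbours not adjacent to each other, against
   [link2_nonadj]. *)
- rewrite ltn_neqAle m3 andbT; apply/eqP => m3'.
  have d1 : x 1%N \in D (x 0%N) by rewrite nb0 !inE eqxx.
  have d2 : x 2%N \in D (x 0%N) by rewrite nb0 -m3' !inE eqxx orbT.
  have := link2_nonadj v0W d1 d2; rewrite eq_sym (xne 1%N) => /(_ isT).
  have [_] := xW 1%N; rewrite inD => /and3P[_ /negPf]; by rewrite adj_sym => ->.
by move=> x0 i j im jm; rewrite !nth_mkseq //; apply: adjc.
Qed.
End CycleListing.

Lemma not_triangle_free (T : finType) (G : sgraph T) : ~ triangle_free G ->
  exists x y z, [/\ G x y, G y z & G z x].
Proof.
move=> h; apply: contrapT => n; apply: h => x y z; apply/negP => /and3P[xy yz zx].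
by apply: n; exists x, y, z.
Qed.

(** The bound 6 comes from a triangle of G: its vertices are pairwise non-consecutive on the
    cycle. *)
Lemma cycle_listing_iso (T : finType) (G : sgraph T) (c : seq T) : uniq c -> c =i T -> ~ triangle_free G ->
  (4 <= size c)%N ->
  (forall x0 i j, (i < size c)%N -> (j < size c)%N ->
    ((nth x0 c j != nth x0 c i) && ~~ G (nth x0 c j) (nth x0 c i)) = cyc (size c) i j) ->
  exists2 m : nat, (6 <= m)%N & graph_iso G (compl (cycle_graph m)).
Proof.
move=> uc cT ntf c4 h.
have ic x : (index x c < size c)%N by rewrite index_mem cT.
have hG x y : (x != y) && ~~ G x y = cyc (size c) (index y c) (index x c).
  by rewrite -(h x) // !nth_index ?cT.
exists (size c).
  have [x [y [z [xy yz zx]]]] := not_triangle_free ntf.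
  have ne a b : G a b -> (a != b) && ~~ cyc (size c) (index b c) (index a c).
    move=> ab; rewrite -hG ab andbF andbT; apply: contraTneq ab => ->.
    by rewrite adj_irr.
  have ixy a b : a != b -> index a c != index b c.
    by apply: contra_neq => e; rewrite -(nth_index x (cT a : a \in c)) e nth_index // cT.
  move: (ne x y xy) (ne y z yz) (ne z x zx) => /andP[/ixy + +] /andP[/ixy + +] /andP[/ixy + +].
  rewrite !cycE //; move: (ic x) (ic y) (ic z).
  move: (index x c) (index y c) (index z c) (size c) c4 => i j k m; clear; lia.
pose f x : 'I_(size c) := Ordinal (ic x).
exists f.
  have [x0 _|T0] := pickP (fun x : T => true); last first.
    have x : T by case: (c) c4.
    by have := T0 x.
  exists (fun i : 'I_(size c) => nth x0 c i) => [x|i]; first by rewrite nth_index // cT.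
  by apply: val_inj; rewrite /= index_uniq.
move=> x y; rewrite /compl /= /compl_adj /= /symrel_adj.
have -> : (f x != f y) = (x != y).
  by apply: negb_inj; rewrite !negbK; apply/eqP/eqP => [[e]|-> //]; rewrite -(nth_index x (cT x : x \in c)) e nth_index // cT.
have [->|xy] := eqVneq x y; first by rewrite adj_irr.
by have := hG x y; rewrite xy /cyc /= orbC => <-; rewrite negbK.
Qed.

Lemma alpha2_cycle (T : finType) (G : sgraph T) : join_free G -> leafy G -> indep_number G = 2 ->
  ~ triangle_free G -> exists2 m : nat, (6 <= m)%N & graph_iso G (compl (cycle_graph m)).
Proof.
move=> jf lf a2 ntf; have F2 : indep_number G = (#|(set0 : {set T})|.+2)%N by rewrite cards0.
have [c [uc cW c4 h]] := cycle_listing jf lf (independent0 G) F2.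
apply: (cycle_listing_iso (c := c)) => // [x|x0 i j ic jc]; first by rewrite cW inW0.
by rewrite -(h x0) // inWU1 inW0 andbT.
Qed.

(** * Triangles when the independence number is at least four *)

Section LargeIndependence.
Variables (T : finType) (G : sgraph T).
Implicit Types (F S X Y : {set T}) (x y u v w : T).
Local Notation W F := (~: closed_nbhd G F).
Local Notation facet S := (maxset (independent G) S).
Hypotheses (jf : join_free G) (lf : leafy G) (ltf : locally_triangle_free G).
Let wc : well_covered G := join_free_pure jf.
Variable r : nat.
Hypotheses (alphaE : indep_number G = r.+1) (r3 : (3 <= r)%N).

Lemma dominating x y z v : G x y -> G y z -> G z x -> ~~ G v x -> ~~ G v y -> ~~ G v z -> False.
Proof.
move=> xy yz zx vx vy vz.
have inWv u w : ~~ G v u -> ~~ G v w -> G u w -> u \in W [set v].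
  move=> vu vw uw; apply/inWP; split; last by move=> _ /set1P ->; rewrite adj_sym.
  by apply: contraNN vw; rewrite inE => /eqP <-.
have /negP := ltf (Sub x (inWv x y vx vy xy)) (Sub y (inWv y z vy vz yz)) (Sub z (inWv z x vz vx zx)).
by apply; rewrite /= /induced_adj /= xy yz zx.
Qed.

Lemma independent_card S : independent G S -> (#|S| <= r.+1)%N.
Proof.
by move=> iS; have [S' mS' /subset_leq_card] := facet_extend iS; rewrite -alphaE (facet_indep_number wc mS').
Qed.

Lemma card_notin (S X : {set T}) : (#|X| < #|S|)%N -> exists2 x, x \in S & x \notin X.
Proof.
move=> XS; apply/subsetPn; apply: contraL XS => h; rewrite -leqNgt; exact: subset_leq_card h.
Qed.

(* If abc is a triangle, local triangle-freeness makes c adjacent to all of [far a b]. *)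
Definition far a b : {set T} := [set v | ~~ G v a && ~~ G v b].

Lemma farP a b v : reflect (~~ G v a /\ ~~ G v b) (v \in far a b).
Proof. by rewrite inE; apply: andP. Qed.

Lemma farC a b : far a b = far b a.
Proof. by apply/setP => v; rewrite !inE andbC. Qed.

Definition far_facet a b S := [/\ independent G S, S \subset far a b, S != set0 &
  forall v, v \in far a b -> v \notin S -> exists2 s, s \in S & G v s].

Lemma far_facetC a b S : far_facet a b S -> far_facet b a S.
Proof. by rewrite /far_facet farC. Qed.

Section Edge.
Variables (a b : T) (S : {set T}).
Hypotheses (ab : G a b) (SC : far_facet a b S).

Lemma far_end : a \in W S.
Proof.
have [_ /subsetP SF _ _] := SC; apply/inWP; split.
  by apply/negP => /SF/farP[_]; rewrite ab.
by move=> y /SF/farP[]; rewrite adj_sym.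
Qed.

(** If w is adjacent to a but not b, [leafy] over b |: S gives a neighbour z of w off b. Maximality
    of S makes z adjacent to a, and the triangle a w z misses a vertex of S. If w is adjacent to
    both, a b w does. *)
Lemma far_link_aux w : w \in W S -> w != b -> ~~ G w a.
Proof.
move=> wW wb; have [iS /subsetP SF /set0Pn[s sS] mS] := SC.
have [sa sb] := farP _ _ _ (SF s sS).
have sw v : v \in W S -> ~~ G s v by move=> /inWP[_ h]; rewrite adj_sym h.
apply/negP => wa.
have nwb : ~~ G w b.
  by apply/negP => wb'; apply: (@dominating a b w s) => //; try (by rewrite adj_sym); exact: sw.
have bW : b \in W S.
  by apply/inWP; split=> [|y /SF/farP[_]]; [apply/negP => /SF/farP[]; rewrite adj_sym ab | rewrite adj_sym].
have wW' : w \in W (b |: S) by rewrite inWU1 wb nwb.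
have [z] := lf (independentW iS bW) wW'; rewrite inWU1 => /and3P[zb nzb zW] wz.
have za : G z a.
  apply: contraT => nza; have zF : z \in far a b by apply/farP.
  have /inWP[zS h] := zW; have [s' s'S zs'] := mS z zF zS.
  by have := h s' s'S; rewrite zs'.
by apply: (@dominating a w z s) => //; try (by rewrite adj_sym); exact: sw.
Qed.
End Edge.

Lemma far_link a b S : G a b -> far_facet a b S -> W S = [set a; b] /\ #|S| = r.
Proof.
move=> ab SC; have ba : G b a by rewrite adj_sym.
have SC' := far_facetC SC; have [iS SF _ mS] := SC.
have aW := far_end ab SC; have bW := far_end ba SC'.
have WS : W S = [set a; b].
  apply/setP => w; rewrite in_set2; apply/idP/idP => [wW|/orP[] /eqP -> //].
  have [//|wa] := eqVneq w a; have [//|wb] := eqVneq w b.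
  have wF : w \in far a b by apply/farP; split; [apply: (far_link_aux ab SC) | apply: (far_link_aux ba SC')].
  have /inWP[wS h] := wW; have [s sS ws] := mS w wF wS.
  by have := h s sS; rewrite ws.
split=> //; have fS : facet (a |: S).
  apply/facetP; split; first exact: independentW.
  apply/setP => w; rewrite in_set0 inWU1 WS in_set2; apply/negP => /and3P[wa nwa].
  by rewrite (negPf wa) /= => /eqP wb; move: nwa; rewrite wb ba.
have /eqP := facet_indep_number wc fS; rewrite alphaE cardsU1.
by case/inWP: aW => -> _; rewrite add1n eqSS => /eqP.
Qed.

(** The complement of the link of S - s is the 4-cycle a s b s' here, and the 5-cycle a s b p q for
    [flap]. *)
Definition twin a b S s s' := [/\ s' \in far a b, G s s' & W (S :\ s) = [set a; b; s; s']].
Definition flap a b S s p q :=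
  [/\ [/\ G p a, ~~ G p b & G p s], [/\ G q b, ~~ G q a & G q s], ~~ G p q &
      W (S :\ s) = [set a; b; s; p; q]].

Lemma flapC a b S s p q : flap a b S s p q -> flap b a S s q p.
Proof.
move=> [pP qP pq WE]; split=> //; first by rewrite adj_sym.
by rewrite WE; apply/setP => v; rewrite !inE; case: (v == a); case: (v == b); case: (v == s); case: (v == p); case: (v == q).
Qed.

(** Over S - s, the link of a is the edge s v1 and that of b the edge s v2. No vertex there is
    adjacent to both a and b, as the triangle would miss a vertex of S. Either v1 = v2, or v1 is
    adjacent to b. *)
Lemma far_types a b S s : G a b -> far_facet a b S -> s \in S ->
  (exists s', twin a b S s s') \/ exists p q, flap a b S s p q.
Proof.
move=> ab SC sS; have ba : G b a by rewrite adj_sym.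
have [WS Sr] := far_link ab SC; have [iS /subsetP SF _ mS] := SC.
have [nsa nsb] := farP _ _ _ (SF s sS).
have iS' : independent G (S :\ s) by apply: independentS iS; apply: subsetDl.
have [t tS' _] : exists2 t, t \in S :\ s & t \notin (set0 : {set T}).
  by apply: card_notin; rewrite cards0; move: Sr r3; rewrite (cardsD1 s) sS; lia.
have /setD1P[ts tS] := tS'.
have [nta ntb] := farP _ _ _ (SF t tS).
have WS' v : (v \in W (S :\ s)) = [|| v == a, v == b, v == s | (v \in W (S :\ s)) && G v s].
  have sW : s \in W (S :\ s).
    apply/inWP; split=> [|y /setD1P[_ yS]]; first by rewrite !inE eqxx.
    by move/independentP: iS; apply.
  have WD u : u \in W S -> u \in W (S :\ s) by rewrite -{1}(setD1K sS) inWU1 => /and3P[].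
  have [->|va] := eqVneq v a; first by rewrite WD // WS !inE eqxx.
  have [->|vb] := eqVneq v b; first by rewrite WD // WS !inE eqxx orbT.
  have [->|vs] := eqVneq v s; first by rewrite sW.
  case vW: (v \in W (S :\ s)) => //=; apply/esym; apply: contraFT (negPf va) => nvs.
  have : v \in W S by rewrite -(setD1K sS) inWU1 vs nvs.
  by rewrite WS !inE (negPf vb) orbF.
have nvt v : v \in W (S :\ s) -> ~~ G t v by move=> /inWP[_ h]; rewrite adj_sym h.
have aW' : a \in W (S :\ s) by rewrite WS' eqxx.
have bW' : b \in W (S :\ s) by rewrite WS' eqxx orbT.
have sW' : s \in W (S :\ s) by rewrite WS' eqxx !orbT.
have link1 e e' : G e e' -> ~~ G s e -> ~~ G s e' -> e \in W (S :\ s) ->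
    (forall v, (v \in W (S :\ s)) = [|| v == e, v == e', v == s | (v \in W (S :\ s)) && G v s]) ->
    exists v1, [/\ v1 \in W (S :\ s), ~~ G v1 e, G v1 s &
      forall v, v \in W (S :\ s) -> v != e -> ~~ G v e -> v = s \/ v = v1].
  move=> ee' nse nse' eW WE.
  have sWe : s \in W (e |: (S :\ s)).
    by rewrite inWU1 nse sW' !andbT; apply: contraNneq nse' => ->.
  have ie := independentW iS' eW.
  have [v1 v1W sv1] := lf ie sWe.
  have sub1 : [set s] \subset W (e |: (S :\ s)) by rewrite sub1set.
  have v1s : v1 \notin [set s] by rewrite inE; apply: contraTneq sv1 => ->; rewrite adj_irr.
  exists v1; move: (v1W); rewrite inWU1 => /and3P[v1e nv1e v1W']; split=> //; first by rewrite adj_sym.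
  have [|_ WE1] := join_pair jf ie sub1 _ (set11 s) v1W v1s.
    move=> _ v /set1P ->; rewrite inWU1 => /and3P[ve nve]; rewrite in_set1 WE (negPf ve) /=.
    case/or3P=> [/eqP ve'|/eqP ->|/andP[_]]; rewrite ?eqxx //; last by rewrite adj_sym.
    by move: nve; rewrite ve' adj_sym ee'.
  move=> v vW ve nve; have : v \in W (e |: (S :\ s)) by rewrite inWU1 ve nve.
  by rewrite WE1 !inE => /orP[] /eqP; [left|right].
have [v1 [v1W nv1a v1s v1P]] := link1 a b ab nsa nsb aW' WS'.
have [|v2 [v2W nv2b v2s v2P]] := link1 b a ba nsb nsa bW'.
  by move=> v; rewrite {1}WS' orbCA.
have v1ns : v1 != s by apply: contraTneq v1s => ->; rewrite adj_irr.
have v2ns : v2 != s by apply: contraTneq v2s => ->; rewrite adj_irr.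
have nboth v : v \in W (S :\ s) -> G v a -> G v b -> False.
  by move=> vW va vb; apply: (@dominating a b v t) => //; try (by rewrite adj_sym); exact: nvt.
have v1b' : v1 != b by apply: contraNneq nv1a => ->.
have v2a' : v2 != a by apply: contraNneq nv2b => ->.
have WE v : v \in W (S :\ s) -> [|| v == a, v == b, v == s, v == v1 | v == v2].
  move=> vW; have [//|va] := eqVneq v a; have [//|vb] := eqVneq v b.
  have [gva|gva] := boolP (G v a).
    have [gvb|gvb] := boolP (G v b); first by case: (nboth v).
    by have [->|->] := v2P v vW vb gvb; rewrite eqxx ?orbT.
  by have [->|->] := v1P v vW va gva; rewrite eqxx ?orbT.
have [v1b|v1b] := boolP (G v1 b); last first.
  left; exists v1; split; [by apply/farP | by rewrite adj_sym |].
  have v12 : v1 = v2 by have [e|//] := v2P v1 v1W v1b' v1b; rewrite e eqxx in v1ns.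
  apply/setP => v; rewrite !in_setU !in_set1 -!orbA; apply/idP/idP => [/WE|/or4P[] /eqP -> //].
  by rewrite -v12 orbb.
right; exists v2, v1; split; first split=> //.
- apply: contraT => nv2a; have [e|e] := v1P v2 v2W v2a' nv2a; first by rewrite e eqxx in v2ns.
  by move: nv2b; rewrite e v1b.
- by [].
- apply/negP => v21; apply: (@dominating v2 v1 s t) => //; try (by rewrite adj_sym); exact: nvt.
apply/setP => v; rewrite !in_setU !in_set1 -!orbA; apply/idP/idP => [/WE|].
  by case/or4P=> [->|->|->|/orP[] ->]; rewrite ?orbT.
by case/or4P=> [/eqP -> //|/eqP -> //|/eqP -> //|/orP[] /eqP -> //].
Qed.

Lemma far_facet_card a b S : G a b -> independent G S -> S \subset far a b -> #|S| = r -> far_facet a b S.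
Proof.
move=> ab iS SF Sr; split=> //; first by rewrite -card_gt0 Sr; apply: leq_trans r3.
move=> v vF vS; apply: contrapT => nv.
have iv : independent G (v |: S).
  by rewrite independentU1 iS; apply/forall_inP => s sS; apply/negP => vs; apply: nv; exists s.
have avF : {subset v |: S <= far a b}.
  by move=> u; rewrite in_setU1 => /orP[/eqP -> //|/(subsetP SF)].
have aF : a \notin far a b by apply/negP => /farP[_]; rewrite ab.
have : independent G (a |: (v |: S)).
  by rewrite independentU1 iv; apply/forall_inP => s /avF/farP[+ _]; rewrite adj_sym.
move/independent_card; rewrite !cardsU1 vS Sr.
have -> : a \notin v |: S by apply: contra aF => /avF.
by rewrite !add1n ltnn.
Qed.

Section Transversal.
Variables (a b c : T) (S : {set T}) (p q : T -> T).
Hypotheses (ab : G a b) (SC : far_facet a b S).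

Lemma far_third s s' : s \in S -> s' \in S -> exists2 t, t \in S & t \notin [set s; s'].
Proof.
move=> sS s'S; apply: card_notin; rewrite (far_link ab SC).2 cards2.
by apply: leq_trans r3; case: (_ != _).
Qed.

Lemma flap_notin s : flap a b S s (p s) (q s) -> q s \notin S /\ forall t, t \in S -> t != s -> ~~ G (q s) t.
Proof.
move=> [_ [_ _ qs] _ WE]; have : q s \in W (S :\ s) by rewrite WE !inE eqxx !orbT.
case/inWP=> qS h; split; last by move=> t tS ts; apply: h; rewrite !inE ts.
apply: contra qS => qS; rewrite !inE qS andbT; apply: contraTneq qs => ->.
by rewrite adj_irr.
Qed.

Lemma flap_indep s s' : s \in S -> s' \in S -> flap a b S s (p s) (q s) -> flap a b S s' (p s') (q s') ->
  ~~ G (q s) (q s').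
Proof.
move=> sS s'S fs fs'; have [->|ss'] := eqVneq s s'; first by rewrite adj_irr.
have [t tS] := far_third sS s'S; rewrite !inE => /norP[ts ts'].
have [_ h] := flap_notin fs; have [_ h'] := flap_notin fs'.
have [_ /subsetP SF _ _] := SC; have [_ tb] := farP _ _ _ (SF t tS).
have [_ [qb _ _] _ _] := fs; have [_ [qb' _ _] _ _] := fs'.
apply/negP => qq; apply: (@dominating b (q s) (q s') t) => //; rewrite 1?adj_sym //; auto.
Qed.

(* Swapping s for its flap q s wherever w sees s keeps an independent set. *)
Lemma flap_transversal w : w != a -> ~~ G w a -> w \notin S ->
  (forall s, s \in S -> G w s -> flap a b S s (p s) (q s)) ->
  exists2 s, s \in S & G w s /\ w = q s.
Proof.
move=> wa nwa wS fl; apply: contrapT => nex.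
have [iS /subsetP SF _ _] := SC; have Sr := (far_link ab SC).2.
pose t s := if G w s then q s else s.
have nt s : s \in S -> ~~ G w (t s).
  move=> sS; rewrite /t; case: ifPn => // ws; have [_ [qb qa qs] _ _] := fl s sS ws.
  apply/negP => wq; have [sa _] := farP _ _ _ (SF s sS).
  by apply: (@dominating w s (q s) a); rewrite // 1?adj_sym // adj_sym.
have nta s : s \in S -> ~~ G (t s) a.
  move=> sS; rewrite /t; case: ifPn => ws; first by have [_ []] := fl s sS ws.
  by case/farP: (SF s sS).
have tN s : s \in S -> t s != w.
  move=> sS; rewrite /t; case: ifPn => ws; last by apply: contraNneq wS => <-.
  by apply/eqP => e; apply: nex; exists s.
have ta s : s \in S -> t s != a.
  move=> sS; rewrite /t; case: ifPn => ws.
    by have [_ [_ qa qs] _ _] := fl s sS ws; apply: contraTneq qs => ->; have [] := farP _ _ _ (SF s sS); rewrite adj_sym.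
  by apply: contraTneq (SF s sS) => ->; apply/negP => /farP[_]; rewrite ab.
have ti s s' : s \in S -> s' \in S -> ~~ G (t s) (t s').
  move=> sS s'S; have [->|ss'] := eqVneq s s'; first by rewrite adj_irr.
  rewrite /t; case: ifPn => ws; case: ifPn => ws'.
  - by apply: flap_indep => //; apply: fl.
  - by have [_ h] := flap_notin (fl s sS ws); apply: h; rewrite // eq_sym.
  - by rewrite adj_sym; have [_ h] := flap_notin (fl s' s'S ws'); apply: h.
  by move/independentP: iS; apply.
have tinj : {in S &, injective t}.
  move=> s s' sS s'S; rewrite /t; case: ifPn => ws; case: ifPn => ws' e //.
  - apply/eqP; apply: contraT => ss'; have [_ h] := flap_notin (fl s sS ws).
    by have [_ [_ _]] := fl s' s'S ws'; rewrite -e (negPf (h s' s'S _)) // eq_sym.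
  - by have [] := flap_notin (fl s sS ws); rewrite e s'S.
  - by have [] := flap_notin (fl s' s'S ws'); rewrite -e sS.
(* With a and w the swapped set makes r + 2 independent vertices. *)
have iT : independent G (a |: (w |: [set t s | s in S])).
  rewrite !independentU1; apply/andP; split; first (apply/andP; split).
  - by apply/independentP => _ _ /imsetP[s sS ->] /imsetP[s' s'S ->]; apply: ti.
  - by apply/forall_inP => _ /imsetP[s sS ->]; apply: nt.
  - apply/forall_inP => v; rewrite in_setU1 => /orP[/eqP ->|/imsetP[s sS ->]]; first by rewrite adj_sym.
    by rewrite adj_sym nta.
have := independent_card iT; rewrite !cardsU1 (card_in_imset tinj) Sr.
have -> : w \notin [set t s | s in S].
  by apply/imsetP => -[s sS e]; have := tN s sS; rewrite -e eqxx.
have -> : a \notin w |: [set t s | s in S].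
  rewrite in_setU1 negb_or eq_sym wa; apply/imsetP => -[s sS e].
  by have := ta s sS; rewrite -e eqxx.
by rewrite !add1n ltnn.
Qed.
End Transversal.

(** The vertex y sees exactly one end of each edge inside [far a b], so the vertices unseen by y
    together with those isolated in [far a b] form a maximal independent S there. Then y is a flap
    of some isolated z. Exchanging a twin turns S into S', over which z has two further flaps, and
    all four flaps with the common part of S and S' except z are too many independent vertices. *)
Lemma far_edge_empty a b c x0 x0' y : G a b -> G b c -> G c a ->
  x0 \in far a b -> x0' \in far a b -> G x0 x0' -> ~~ G y a -> ~~ G y c -> False.
Proof.
move=> ab bc ca x0F x0F' xx0 nya nyc; 
have Fc v : v \in far a b -> G v c.
  by move=> /farP[va vb]; apply: contraT => vc; case: (dominating ab bc ca va vb vc).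
have yb : G y b by apply: contraT => nyb; case: (dominating ab bc ca nya nyb nyc).
have E1 x x' : x \in far a b -> x' \in far a b -> G x x' -> G y x -> G y x' -> False.
  move=> /farP[xa _] /farP[xa' _] xx yx yx'.
  by apply: (@dominating y x x' a); rewrite // 1?adj_sym // adj_sym.
have E2 x x' : x \in far a b -> x' \in far a b -> G x x' -> ~~ G y x -> G y x'.
  move=> xF x'F xx yx; apply: contraT => yx'.
  by case: (@dominating x x' c y) => //; [exact: Fc | rewrite adj_sym; apply: Fc].
pose iso x := [forall x' in far a b, ~~ G x x'].
pose S := [set x in far a b | ~~ G y x || iso x].
have SP x : (x \in S) = (x \in far a b) && (~~ G y x || iso x) by rewrite in_sep.
have yF : y \notin far a b by apply/negP => /farP[_]; rewrite yb.
have iS : independent G S.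
  apply/independentP => x x'; rewrite !SP => /andP[xF xS] /andP[xF' xS'].
  apply/negP => xx; case/orP: xS => [nyx|/forall_inP/(_ x' xF')]; last by rewrite xx.
  case/orP: xS' => [nyx'|/forall_inP/(_ x xF)]; last by rewrite adj_sym xx.
  by have := E2 x x' xF xF' xx nyx; rewrite (negPf nyx').
have SC : far_facet a b S.
  split=> //; first by apply/subsetP => x; rewrite SP => /andP[].
    have [yx|nyx] := boolP (G y x0).
      apply/set0Pn; exists x0'; rewrite SP x0F'; apply/orP; left; apply/negP => yx'.
      exact: (E1 x0 x0').
    by apply/set0Pn; exists x0; rewrite SP x0F nyx.
  move=> v vF; rewrite SP vF negb_or negbK => /andP[yv /forall_inPn[x' x'F]].
  rewrite negbK => vx'; exists x' => //; rewrite SP x'F; apply/orP; left; apply/negP => yx'.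
  exact: (E1 v x').
have [WS Sr] := far_link ab SC.
have SF s : s \in S -> s \in far a b by rewrite SP => /andP[].
have yS : y \notin S by apply: contra yF => /SF.
have ya : y != a by apply: contraNneq nyc => ->; rewrite adj_sym.
have isoS S1 z : far_facet a b S1 -> z \in S1 -> iso z -> exists p q, flap a b S1 z p q.
  move=> S1C zS1 /forall_inP zi; have [[s' [s'F zs' _]]|//] := far_types ab S1C zS1.
  by have := zi s' s'F; rewrite zs'.
have /choice[pq pqP] z : exists pq : T * T, z \in S -> iso z -> flap a b S z pq.1 pq.2.
  have [[zS zi]|n] := pselect (z \in S /\ iso z); last by exists (a, a) => h1 h2; case: n.
  by have [p [q ?]] := isoS S z SC zS zi; exists (p, q).
have [z zS [yz yE]] : exists2 s, s \in S & G y s /\ y = (pq s).2.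
  apply: (flap_transversal (p := fun s => (pq s).1) ab SC ya nya yS) => s sS ys; apply: pqP => //.
  by move: sS; rewrite SP ys => /andP[].
have zi : iso z by move: zS; rewrite SP yz => /andP[].
have := pqP z zS zi; rewrite -yE; set p := (pq z).1 => fz.
(* If every s had flaps, [flap_transversal] would make a vertex of [far a b] outside S a flap, hence
   adjacent to b. *)
have [x xS [x' xP]] : exists2 x, x \in S & exists x', twin a b S x x'.
  apply: contrapT => nK.
  have /choice[pq' pq'P] s : exists pq' : T * T, s \in S -> flap a b S s pq'.1 pq'.2.
    have [sS|n] := boolP (s \in S); last by exists (a, a).
    have [K|[p' [q' ?]]] := far_types ab SC sS; first by case: nK; exists s.
    by exists (p', q').
  have [w [wF wS]] : exists w, w \in far a b /\ w \notin S.
    have [x0S|] := boolP (x0 \in S); last by exists x0.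
    exists x0'; split=> //; apply/negP => x0S'; move/independentP: iS => /(_ _ _ x0S x0S').
    by rewrite xx0.
  have [wa wb] := farP _ _ _ wF.
  have wna : w != a by apply: contraNneq wb => ->.
  have [s sS [_ we]] := flap_transversal (p := fun s => (pq' s).1) (q := fun s => (pq' s).2) ab SC wna wa wS (fun s sS _ => pq'P s sS).
  have [_ [qb _ _] _ _] := pq'P s sS; by rewrite we qb in wb.
have [x'F xx' WSx] := xP; have xF := SF x xS.
have nyx : ~~ G y x.
  by move: xS; rewrite SP xF => /orP[//|/forall_inP/(_ x' x'F)]; rewrite xx'.
have yx' := E2 x x' xF x'F xx' nyx.
have xz : x != z by apply: contraNneq nyx => ->.
have [[pa pb pz] [_ _ _] npy WSz] := fz.
have pW : p \in W (S :\ z) by rewrite WSz !inE eqxx !orbT.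
have yW : y \in W (S :\ z) by rewrite WSz !inE eqxx !orbT.
have npx : ~~ G p x by case/inWP: pW => _; apply; rewrite in_setD1 xz.
have px' : G p x'.
  apply: contraT => npx'; have pc : G p c.
    by apply: contraT => npc; case: (@dominating x x' c p) => //; [exact: Fc | by rewrite adj_sym; apply: Fc].
  by case: (@dominating a c p y); rewrite // 1?adj_sym // adj_sym.
have x'W : x' \in W (S :\ x) by rewrite WSx !inE eqxx !orbT.
have iSx : independent G (S :\ x) by apply: independentS iS; apply: subsetDl.
pose S' := x' |: (S :\ x).
have iS' : independent G S' by apply: independentW.
have x'Sx : x' \notin S :\ x by case/inWP: x'W.
have S'r : #|S'| = r by rewrite cardsU1 x'Sx -Sr (cardsD1 x S) xS.
have S'C : far_facet a b S'.
  apply: far_facet_card => //; apply/subsetP => v; rewrite in_setU1 => /orP[/eqP -> //|/setD1P[_ /SF //]].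
have zS' : z \in S' by apply/setU1P; right; apply/setD1P; rewrite eq_sym.
have [p' [q' fz']] := isoS S' z S'C zS' zi.
have [[p'a p'b p'z] [q'b q'a q'z] _ WSz'] := fz'.
have p'W : p' \in W (S' :\ z) by rewrite WSz' !inE eqxx !orbT.
have q'W : q' \in W (S' :\ z) by rewrite WSz' !inE eqxx !orbT.
have x'z : x' != z.
  by apply: contraTneq xx' => ->; rewrite adj_sym; move/forall_inP: zi; apply.
have x'S'z : x' \in S' :\ z by rewrite in_setD1 x'z setU11.
(* The old flaps p and y are adjacent to x', the new ones p' and q' are not. *)
have p'p : p != p'.
  by apply: contraTneq px' => ->; case/inWP: p'W => _; apply.
have q'y : y != q'.
  by apply: contraTneq yx' => ->; case/inWP: q'W => _; apply.
pose S2 := S :\ z :\ x.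
have S2r : (#|S2|.+2 = r)%N.
  have xSz : x \in S :\ z by apply/setD1P.
  by rewrite -Sr (cardsD1 z S) zS (cardsD1 x (S :\ z)) xSz !add1n.
have S2z u : u \in S2 -> u \in S :\ z by case/setD1P.
have S2z' u : u \in S2 -> u \in S' :\ z by move=> /setD1P[ux /setD1P[uz uS]]; rewrite in_setD1 uz in_setU1 in_setD1 ux uS orbT.
have iS2 : independent G S2 by apply: independentS iS; apply/subsetP => u /S2z /setD1P[].
have [t tS2 _] : exists2 t, t \in S2 & t \notin (set0 : {set T}).
  by apply: card_notin; rewrite cards0 -2!ltnS S2r.
have tS : t \in S by case/setD1P: (S2z t tS2).
have tz : ~~ G t z by move/independentP: iS => /(_ t z tS zS).
pose Q := [:: p; p'; y; q'].
have Qz u : u \in Q -> G u z /\ forall v, v \in S2 -> ~~ G u v /\ u != v.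
  have nv (S1 : {set T}) w v : w \in W S1 -> v \in S1 -> ~~ G w v /\ w != v.
    by move=> /inWP[wS h] vS; split; [exact: h | apply: contraNneq wS => ->].
  rewrite !inE => /or4P[] /eqP -> ; split=> // v vS2.
  - exact: (nv _ _ _ pW (S2z _ vS2)).
  - exact: (nv _ _ _ p'W (S2z' _ vS2)).
  - exact: (nv _ _ _ yW (S2z _ vS2)).
  - exact: (nv _ _ _ q'W (S2z' _ vS2)).
have Qi u v : u \in Q -> v \in Q -> ~~ G u v.
  move=> /Qz[uz ut] /Qz[vz vt]; apply/negP => uv.
  have [[ut' _] [vt' _]] := (ut t tS2, vt t tS2).
  by apply: (@dominating u v z t); rewrite // adj_sym.
have step (X : {set T}) u : u \in Q -> independent G X -> (forall v, v \in X -> v \in Q \/ v \in S2) -> u \notin X ->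
    independent G (u |: X) /\ #|u |: X| = #|X|.+1.
  move=> uQ iX XQ uX; rewrite cardsU1 uX; split=> //.
  rewrite independentU1 iX; apply/forall_inP => v /XQ[vQ|vS2]; first exact: Qi.
  by have [_ /(_ v vS2)[]] := Qz u uQ.
have notS2 u : u \in Q -> u \notin S2.
  by move=> /Qz[_ h]; apply/negP => uS2; have [_] := h u uS2; rewrite eqxx.
have Qin : [/\ p \in Q, p' \in Q, y \in Q & q' \in Q] by rewrite !inE !eqxx !orbT.
have [pQ p'Q yQ q'Q] := Qin.
have [i1 c1] := step S2 q' q'Q iS2 (fun v h => or_intror h) (notS2 _ q'Q).
have [||i2 c2] := step (q' |: S2) y yQ i1.
- by move=> v /setU1P[->|]; [left|right].
- by rewrite in_setU1 negb_or q'y notS2.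
have [||i3 c3] := step (y |: (q' |: S2)) p' p'Q i2.
- by move=> v /setU1P[->|/setU1P[->|]]; [left|left|right].
- rewrite !in_setU1 !negb_or notS2 // andbT; apply/andP; split.
    by apply: contraNneq nya => <-.
  by apply: contraNneq q'a => <-.
have [||i4 c4] := step (p' |: (y |: (q' |: S2))) p pQ i3.
- by move=> v /setU1P[->|/setU1P[->|/setU1P[->|]]]; [left|left|left|right].
- rewrite !in_setU1 !negb_or notS2 // andbT p'p /=; apply/andP; split.
    by apply: contraNneq nya => <-.
  by apply: contraNneq q'a => <-.
by have := independent_card i4; rewrite c4 c3 c2 c1 -S2r ltnn.
Qed.
End LargeIndependence.

Definition twin_free_upto n (h : rel nat) :=
  all (fun i => all (fun j => (i == j) || has (fun k => h i k != h j k) (iota 0 n)) (iota 0 n)) (iota 0 n).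

(** A surjection preserving adjacency is injective when no two vertices of its source have equal
    neighbourhoods, which [twin_free_upto] tests. *)
Lemma graph_iso_surj (T : finType) (G : sgraph T) n (H : sgraph 'I_n) (h : rel nat) (f : nat -> T) :
  (forall i j : 'I_n, H i j = h i j) -> twin_free_upto n h ->
  (forall i j, (i < n)%N -> (j < n)%N -> G (f i) (f j) = h i j) ->
  (forall x, exists2 i, (i < n)%N & f i = x) -> graph_iso G H.
Proof.
move=> Hh tf Gh surj.
have finj i j : (i < n)%N -> (j < n)%N -> f i = f j -> i = j.
  move=> lin ljn e; apply/eqP; have mi k : (k < n)%N -> k \in iota 0 n by rewrite mem_iota.
  have /allP/(_ i (mi i lin))/allP/(_ j (mi j ljn))/orP[//|/hasP[k]] := tf.
  by rewrite mem_iota add0n => kn; rewrite -!Gh // e eqxx.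
have /choice[g gP] x : exists i : 'I_n, f i = x.
  by have [i lin <-] := surj x; exists (Ordinal lin).
exists g; last by move=> x y; rewrite Hh -Gh ?gP.
exists (fun i : 'I_n => f i) => [x|i]; first exact: gP.
by apply: val_inj; apply: finj; [exact: ltn_ord | exact: ltn_ord | exact: gP].
Qed.

Definition h12 : rel nat := fun i j =>
  let E := [:: (0,1); (1,2); (2,0); (0,3); (0,4); (0,5); (1,6); (1,7); (1,8); (2,9); (2,10); (2,11);
    (3,9); (9,6); (6,5); (5,11); (11,8); (8,4); (4,10); (10,7); (7,3)]%N in
  (i != j) && (((i, j) \in E) || ((j, i) \in E)).

Lemma Q12E (i j : 'I_12) : Q12 i j = h12 i j.
Proof. by []. Qed.

(* Adjacency of Q12 in the blocks {a,b,c}, {a_i}, {b_i}, {c_i}, numbered 0 to 3. *)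
Definition icos_block (k l i j : nat) : bool := match k, l with
  | 0, 0 => i != j | 0, k.+1 => i == k | k.+1, 0 => j == k
  | 1, 2 => j == i.+1 %% 3 | 2, 1 => i == j.+1 %% 3
  | 1, 1 | 2, 2 | 3, 3 => false | _, _ => i == j end%N.

Lemma icos_blockE k l i j : (k < 4)%N -> (l < 4)%N -> (i < 3)%N -> (j < 3)%N ->
  h12 (k * 3 + i)%N (l * 3 + j)%N = icos_block k l i j.
Proof.
move=> k4 l4 i3 j3; apply/eqP.
have chk : all (fun k => all (fun l => all (fun i => all (fun j =>
  h12 (k * 3 + i)%N (l * 3 + j)%N == icos_block k l i j) (iota 0 3)) (iota 0 3)) (iota 0 4)) (iota 0 4).
  by vm_compute.
have io n m : (n < m)%N -> n \in iota 0 m by rewrite mem_iota.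
by move: chk => /allP/(_ k (io _ _ k4))/allP/(_ l (io _ _ l4))/allP/(_ i (io _ _ i3))/allP/(_ j (io _ _ j3)).
Qed.

Lemma icos_block_sym k l i j : (k < 4)%N -> (l < 4)%N -> (i < 3)%N -> (j < 3)%N ->
  icos_block k l i j = icos_block l k j i.
Proof.
move=> k4 l4 i3 j3; rewrite -!icos_blockE // /h12 eq_sym; congr (_ && _).
exact: orbC.
Qed.

(** * Recognition of Q_12 *)

Section Icosahedral.
Variables (T : finType) (G : sgraph T).
Implicit Types (F S X Y : {set T}) (x y u v w : T).
Local Notation W F := (~: closed_nbhd G F).
Hypotheses (jf : join_free G) (lf : leafy G) (ltf : locally_triangle_free G).
Variable r : nat.
Hypotheses (alphaE : indep_number G = r.+1) (r3 : (3 <= r)%N).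
Local Notation far := (far G).
Local Notation flap := (flap G).
Let dominating := (dominating ltf).

Lemma flap_p a b S s p q : flap a b S s p q -> forall t, t \in S -> t != s -> ~~ G p t /\ p != t.
Proof.
move=> [_ _ _ WE] t tS ts; have : p \in W (S :\ s) by rewrite WE !inE eqxx !orbT.
have tSs : t \in S :\ s by rewrite !inE ts.
by case/inWP=> pS h; split; [exact: h | apply: contraNneq pS => ->].
Qed.

Lemma flap_q a b S s p q : flap a b S s p q -> forall t, t \in S -> t != s -> ~~ G q t /\ q != t.
Proof. by move=> /flapC; apply: flap_p. Qed.

(** An independent [far a b] has no twins, so each s has flaps, and p s and q s agree in adjacency
    to c. If s and t disagree, [leafy] at b over p s, p t and the rest of [far a b] requires a
    neighbour of b that must be some q u, and every u is excluded. *)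
Lemma far_dichotomy a b c : G a b -> G b c -> G c a -> independent G (far a b) -> far a b != set0 ->
  exists p q : T -> T, (forall s, s \in far a b -> flap a b (far a b) s (p s) (q s)) /\
    ((far a c = set0 /\ far b c = set0) \/ (forall s, s \in far a b -> ~~ G (p s) c /\ ~~ G (q s) c)).
Proof.
move=> ab bc ca iC C0; set C := far a b in iC C0 *; have ba : G b a by rewrite adj_sym.
have SC : far_facet G a b C by split=> // v ->.
have SC' := far_facetC SC.
have Cr := (far_link jf lf ltf alphaE ab SC).2.
have /choice[pq pqP] s : exists pq : T * T, s \in C -> flap a b C s pq.1 pq.2.
  have [sC|n] := boolP (s \in C); last by exists (a, a).
  have [[s' [s'C ss' _]]|[p [q ?]]] := far_types jf lf ltf alphaE r3 ab SC sC; last by exists (p, q).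
  by move/independentP: iC => /(_ s s' sC s'C); rewrite ss'.
pose p s := (pq s).1; pose q s := (pq s).2.
have fl s : s \in C -> flap a b C s (p s) (q s) := pqP s.
have fl' s : s \in C -> flap b a C s (q s) (p s) by move/fl/flapC.
exists p, q; split=> //.
have Wa v : v != a -> ~~ G v a -> v \notin C -> exists2 s, s \in C & v = q s.
  move=> va nva vC; have [s sC [_ ->]] := flap_transversal jf lf ltf alphaE r3 ab SC va nva vC (fun s sC _ => fl s sC).
  by exists s.
have Wb v : v != b -> ~~ G v b -> v \notin C -> exists2 s, s \in C & v = p s.
  move=> vb nvb vC; have [s sC [_ ->]] := flap_transversal jf lf ltf alphaE r3 ba SC' vb nvb vC (fun s sC _ => fl' s sC).
  by exists s.
have Cc v : v \in C -> G v c.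
  by move=> /farP[va vb]; apply: contraT => vc; case: (dominating ab bc ca va vb vc).
have pqc s : s \in C -> G (p s) c = G (q s) c.
  move=> sC; have [[pa pb ps] [qb qa qs] npq _] := fl s sC; apply/idP/idP => h; apply: contraT => nh.
    by case: (@dominating a c (p s) (q s)); rewrite // 1?adj_sym // adj_sym.
  by case: (@dominating b c (q s) (p s)); rewrite // 1?adj_sym // adj_sym.
have [all0|ex] := pselect (forall s, s \in C -> ~~ G (p s) c).
  by right=> s sC; split; [|rewrite -pqc //]; apply: all0.
left; have [s sC psc] : exists2 s, s \in C & G (p s) c.
  by apply: contrapT => n; apply: ex => s sC; apply/negP => psc; apply: n; exists s.
have qsc : G (q s) c by rewrite -pqc.
suff all1 t : t \in C -> G (p t) c.
  split; apply/setP => v; rewrite in_set0; apply/negP => /farP[vx vc].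
    have vC : v \notin C by apply: contraNN vc; apply: Cc.
    have va : v != a by apply: contraNneq vc => ->; rewrite adj_sym.
    by have [t tC vE] := Wa v va vx vC; move: vc; rewrite vE -pqc // all1.
  have vC : v \notin C by apply: contraNN vc; apply: Cc.
  have vb : v != b by apply: contraNneq vc => ->.
  by have [t tC vE] := Wb v vb vx vC; move: vc; rewrite vE all1.
move=> tC; apply: contraT => ptc; have qtc : ~~ G (q t) c by rewrite -pqc.
have [[psa psb pss] [qsb qsa qss] nps _] := fl s sC.
have [[pta ptb ptt] [qtb qta qtt] npt _] := fl t tC.
have pq1 : G (q t) (p s).
  by apply: contraT => n; case: (@dominating a c (p s) (q t)); rewrite // adj_sym.
have pq2 : G (p t) (q s).
  by apply: contraT => n; case: (@dominating b c (q s) (p t)); rewrite // adj_sym.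
have st : s != t by apply: contraNneq ptc => <-.
pose C2 := C :\ s :\ t; pose F := p s |: (p t |: C2).
have C2P u : u \in C2 -> [/\ u \in C, u != s & u != t] by move=> /setD1P[ut /setD1P[us uC]].
have iC2 : independent G C2 by apply: independentS iC; apply/subsetP => u /C2P[].
have npp : ~~ G (p s) (p t).
  exact: (flap_indep (p := q) (q := p) jf lf ltf alphaE r3 ba SC' sC tC (fl' s sC) (fl' t tC)).
have iF : independent G F.
  rewrite !independentU1 iC2 /=; apply/andP; split; apply/forall_inP => u.
    by move=> /C2P[uC _ ut]; have [] := flap_p (fl t tC) uC ut.
  rewrite in_setU1 => /orP[/eqP -> //|/C2P[uC us _]].
  by have [] := flap_p (fl s sC) uC us.
have bF : b \in W F.
  apply/inWP; split; last first.
    move=> y; rewrite !in_setU1 => /or3P[/eqP ->|/eqP ->|/C2P[/farP[_ +] _ _]]; by rewrite adj_sym.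
  rewrite !in_setU1 !negb_or; apply/and3P; split.
  - by apply: contraTneq pss => <-; rewrite adj_sym; case/farP: sC.
  - by apply: contraTneq ptt => <-; rewrite adj_sym; case/farP: tC.
  by apply/negP => /C2P[/farP[]]; rewrite ba.
have [w wF bw] := lf iF bF; have [wF' wN] := inWP _ _ _ wF.
have psF : p s \in F by rewrite in_setU1 eqxx.
have ptF : p t \in F by rewrite !in_setU1 eqxx orbT.
have C2F u : u \in C2 -> u \in F by move=> uC; rewrite !in_setU1 uC !orbT.
have [wa|nwa] := boolP (G w a).
  have [u uC] : exists2 u, u \in C & u \notin [set s; t].
    by apply: card_notin; rewrite Cr cards2 st.
  rewrite !inE => /norP[us ut]; have [ua ub] := farP _ _ _ _ uC.
  have uF : u \in F by apply: C2F; apply/setD1P; split=> //; apply/setD1P.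
  by case: (@dominating a b w u); rewrite // adj_sym wN.
have wna : w != a by apply: contraTneq psa => e; rewrite adj_sym -e; apply: wN.
have wC : w \notin C by apply/negP => /farP[_]; rewrite adj_sym bw.
have [u uC wE] := Wa w wna nwa wC.
have [us|us] := eqVneq u s; first by move: (wN _ ptF); rewrite wE us adj_sym pq2.
have [ut|ut] := eqVneq u t; first by move: (wN _ psF); rewrite wE ut pq1.
have uF : u \in F by apply: C2F; apply/setD1P; split=> //; apply/setD1P.
by move: (wN _ uF); rewrite wE; have [_ [_ _ ->]] := fl u uC.
Qed.

(** The flaps p and q map [far a b] bijectively to [far b c] and [far a c]. Comparison with the
    flaps over bc gives a permutation tau with p s adjacent to q t exactly when t = tau s. It has no
    fixed points and r = 3, so it is a 3-cycle. *)
Lemma far_good a b c : G a b -> G b c -> G c a -> far a b != set0 -> far a c != set0 ->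
  far b c != set0 -> graph_iso G Q12.
Proof.
move=> ab bc ca C0 B0 A0; have [ba cb ac] : [/\ G b a, G c b & G a c] by split; rewrite adj_sym.
have indep x y z : G x y -> G y z -> G z x -> far x z != set0 -> independent G (far x y).
  move=> xy yz zx /set0Pn[w /farP[wx wz]]; apply/independentP => u v uF vF; apply/negP => uv.
  exact: (far_edge_empty jf lf ltf alphaE r3 xy yz zx uF vF uv wx wz).
have iC : independent G (far a b) := indep a b c ab bc ca B0.
have iB : independent G (far a c) := indep a c b ac cb ba C0.
have iA : independent G (far b c) by apply: (indep b c a) => //; rewrite farC.
have SC : far_facet G a b (far a b) by split=> // v ->.
have SA : far_facet G b c (far b c) by split=> // v ->.
have SB : far_facet G a c (far a c) by split=> // v ->.
have Cr := (far_link jf lf ltf alphaE ab SC).2.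
have Ar := (far_link jf lf ltf alphaE bc SA).2.
have Br := (far_link jf lf ltf alphaE ac SB).2.
have [p [q [fl [[e _]|pqc]]]] := far_dichotomy ab bc ca iC C0; first by rewrite e eqxx in B0.
have [p' [q' [fl' [[e _]|pqa]]]] := far_dichotomy bc ca ab iA A0.
  by rewrite farC e eqxx in C0.
have pA s : s \in far a b -> p s \in far b c.
  by move=> sC; apply/farP; have [[_ ? _] _ _ _] := fl s sC; have [] := pqc s sC.
have qB s : s \in far a b -> q s \in far a c.
  by move=> sC; apply/farP; have [_ [_ ? _] _ _] := fl s sC; have [] := pqc s sC.
have p'B s : s \in far b c -> p' s \in far a c.
  by move=> sA; apply/farP; have [[_ ? _] _ _ _] := fl' s sA; have [] := pqa s sA.
have onto (X Y : {set T}) (f : T -> T) : #|X| = r -> #|Y| = r -> (forall x, x \in X -> f x \in Y) ->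
    (forall x x', x \in X -> x' \in X -> x' != x -> G (f x) x /\ ~~ G (f x) x') ->
    forall y, y \in Y -> exists2 x, x \in X & f x = y.
  move=> Xr Yr fXY fG; have finj : {in X &, injective f}.
    move=> x x' xX x'X e; apply/eqP; apply: contraT => xx'.
    have [_] := fG x x' xX x'X (contra_neq esym xx'); rewrite e.
    by have [->] := fG x' x x'X xX xx'.
  have fE : f @: X = Y.
    by apply/eqP; rewrite eqEcard (card_in_imset finj) Xr Yr leqnn andbT; apply/subsetP => _ /imsetP[x xX ->]; apply: fXY.
  by move=> y; rewrite -fE => /imsetP[x xX ->]; exists x.
have ontop := onto _ _ p Cr Ar pA.
have {}ontop : forall y, y \in far b c -> exists2 x, x \in far a b & p x = y.
  apply: ontop => s t sC tC ts; have [[_ _ ps] _ _ _] := fl s sC.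
  by split=> //; have [] := flap_p (fl s sC) tC ts.
have ontoq : forall y, y \in far a c -> exists2 x, x \in far a b & q x = y.
  apply: (onto _ _ q Cr Br qB) => s t sC tC ts; have [_ [_ _ qs] _ _] := fl s sC.
  by split=> //; have [] := flap_q (fl s sC) tC ts.
have p'G x x' : x \in far b c -> x' \in far b c -> G (p' x) x' = (x' == x).
  move=> xA x'A; have [[_ _ px] _ _ _] := fl' x xA; have [->//|ne] := eqVneq x' x.
  by apply/negbTE; have [] := flap_p (fl' x xA) x'A ne.
have ontop' : forall y, y \in far a c -> exists2 x, x \in far b c & p' x = y.
  apply: (onto _ _ p' Ar Br p'B) => x x' xA x'A ne.
  by rewrite !p'G // eqxx (negPf ne).
have /choice[tau tauP] s : exists t, s \in far a b -> t \in far a b /\ q t = p' (p s).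
  have [sC|] := boolP (s \in far a b); last by exists s.
  by have [t tC e] := ontoq _ (p'B _ (pA s sC)); exists t.
have Cc v : v \in far a b -> G v c.
  by move=> /farP[va vb]; apply: contraT => vc; case: (dominating ab bc ca va vb vc).
have Aa v : v \in far b c -> G v a.
  by move=> /farP[va vb]; apply: contraT => vc; case: (dominating bc ca ab va vb vc).
have Bb v : v \in far a c -> G v b.
  by move=> /farP[va vb]; apply: contraT => vc; case: (dominating ac cb ba va vb vc).
have Gps s t : s \in far a b -> t \in far a b -> G (p s) t = (t == s).
  move=> sC tC; have [[_ _ ps] _ _ _] := fl s sC; have [->//|ne] := eqVneq t s.
  by apply/negbTE; have [] := flap_p (fl s sC) tC ne.
have Gqs s t : s \in far a b -> t \in far a b -> G (q s) t = (t == s).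
  move=> sC tC; have [_ [_ _ qs] _ _] := fl s sC; have [->//|ne] := eqVneq t s.
  by apply/negbTE; have [] := flap_q (fl s sC) tC ne.
have pinj s t : s \in far a b -> t \in far a b -> p s = p t -> s = t.
  by move=> sC tC e; apply/eqP; rewrite -Gps // -e Gps.
have qinj s t : s \in far a b -> t \in far a b -> q s = q t -> s = t.
  by move=> sC tC e; apply/eqP; rewrite -Gqs // -e Gqs.
have tauC s : s \in far a b -> tau s \in far a b by case/tauP.
have Gqp s t : s \in far a b -> t \in far a b -> G (p s) (q t) = (t == tau s).
  move=> sC tC; have [x xA xE] := ontop' _ (qB t tC).
  rewrite adj_sym -xE p'G ?pA //; apply/eqP/eqP => [e|e].
    by apply: qinj; rewrite ?tauC // (tauP s sC).2 -xE e.
  have e' : p' x = p' (p s) by rewrite xE e (tauP s sC).2.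
  by apply/esym/eqP; rewrite -(p'G (p s)) ?pA // -e' p'G.
have taus s : s \in far a b -> tau s != s.
  by move=> sC; have [_ _ n _] := fl s sC; rewrite eq_sym -Gqp.
have tauI s t : s \in far a b -> t \in far a b -> tau s = tau t -> s = t.
  move=> sC tC e; apply: pinj => //; apply/esym/eqP; rewrite -(p'G (p s)) ?pA //.
  by rewrite -(tauP s sC).2 e (tauP t tC).2 p'G ?pA.
have GAA s t : s \in far a b -> t \in far a b -> G (p s) (p t) = false.
  by move=> sC tC; apply/negbTE; move/independentP: iA; apply; apply: pA.
have GBB s t : s \in far a b -> t \in far a b -> G (q s) (q t) = false.
  by move=> sC tC; apply/negbTE; move/independentP: iB; apply; apply: qB.
have GCC s t : s \in far a b -> t \in far a b -> G s t = false.
  by move=> sC tC; apply/negbTE; move/independentP: iC; apply.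
have qpC v : v != a -> ~~ G v a -> v \notin far a b -> v \in far a c.
  move=> va nva vC.
  have [s sC [_ ->]] := flap_transversal jf lf ltf alphaE r3 ab SC va nva vC (fun s sC _ => fl s sC).
  exact: qB.
have ppC v : v != b -> ~~ G v b -> v \notin far a b -> v \in far b c.
  move=> vb nvb vC.
  have [s sC [_ ->]] := flap_transversal jf lf ltf alphaE r3 ba (far_facetC SC) vb nvb vC
    (fun s sC _ => flapC (fl s sC)).
  exact: pA.
have p'C v : v != c -> ~~ G v c -> v \notin far b c -> v \in far a c.
  move=> vc nvc vA.
  have [s sA [_ ->]] := flap_transversal jf lf ltf alphaE r3 cb (far_facetC SA) vc nvc vA
    (fun s sA _ => flapC (fl' s sA)).
  exact: p'B.
(* The common neighbours of the triangle are joined to all other vertices, so there are none. *)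
pose D := [set v | [&& G v a, G v b & G v c]].
have cov v : v \notin D -> [\/ v \in [set a; b; c], v \in far a b, v \in far a c | v \in far b c].
  move=> vD; have [vabc|] := boolP (v \in [set a; b; c]); first by constructor 1.
  move=> n3; have /norP[/norP[va vb] vc] : ~~ ((v == a) || (v == b) || (v == c)).
    by move: n3; rewrite !inE.
  have [vC|vC] := boolP (v \in far a b); first by constructor 2.
  have [gva|gva] := boolP (G v a); last by constructor 3; apply: qpC.
  have [gvb|gvb] := boolP (G v b); last by constructor 4; apply: ppC.
  have [vA|vA] := boolP (v \in far b c); first by constructor 4.
  have [gvc|gvc] := boolP (G v c); last by constructor 3; apply: p'C.
  by case/negP: vD; rewrite inE gva gvb gvc.
have D0 v : v \notin D.
  apply/negP => vD; pose X := ~: D.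
  have aX : a \in X by rewrite !inE adj_irr.
  have bX : b \in X by rewrite !inE adj_irr andbF.
  have vX : v \notin X by rewrite inE negbK.
  have XW : X \subset W set0 by apply/subsetP => u _; apply: inW0.
  have [|X1 _] := join_pair jf (independent0 G) XW _ aX (inW0 G v) vX; last first.
    by move: bX ba; rewrite X1 inE => /eqP ->; rewrite adj_irr.
  move=> u w uX _ wX; have {wX} wD : w \in D by move: wX; rewrite inE negbK.
  move: wD; rewrite inE => /and3P[wa wb wc].
  move: uX; rewrite inE => /cov[|/farP[ua ub]|/farP[ua uc]|/farP[ub uc]].
  - by rewrite !inE => /orP[/orP[]|] /eqP ->; rewrite adj_sym.
  - by apply: contraT => n; case: (@dominating a b w u); rewrite // adj_sym.
  - by apply: contraT => n; case: (@dominating a c w u); rewrite // adj_sym.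
  - by apply: contraT => n; case: (@dominating b c w u); rewrite // adj_sym.
have {}cov v := cov v (D0 v).
have r3' : r = 3.
  apply/eqP; rewrite eqn_leq r3 andbT leqNgt; apply/negP => r4.
  have [s sC] := set0Pn _ C0.
  have [u0 u0P] : exists u0, forall u, u \in far a b -> tau u = s -> u = u0.
    have [[u0 u0C e]|n] := pselect (exists2 u0, u0 \in far a b & tau u0 = s).
      by exists u0 => u uC e'; apply: tauI; rewrite // e e'.
    by exists s => u uC e'; case: n; exists u.
  (* Such a t makes p s, p t, q s, q t pairwise non-adjacent, and with the rest of [far a b] they
     are r + 2 independent vertices. *)
  have [t tC] : exists2 t, t \in far a b & t \notin s |: (tau s |: [set u0]).
    apply: card_notin; rewrite Cr; apply: leq_ltn_trans r4.
    by rewrite !cardsU1 cards1; case: (_ \notin _); case: (_ \notin _).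
  rewrite !inE => /norP[ts /norP[tts tu]].
  have tauts : tau t != s by apply: contraNneq tu => /(u0P t tC) ->.
  pose C2 := far a b :\ s :\ t.
  have C2P u : u \in C2 -> [/\ u \in far a b, u != s & u != t] by move=> /setD1P[ut /setD1P[us uC]].
  have iC2 : independent G C2 by apply: independentS iC; apply/subsetP => u /C2P[].
  have C2r : (#|C2|.+2 = r)%N.
    by rewrite -Cr (cardsD1 s (far a b)) sC (cardsD1 t (far a b :\ s)) in_setD1 ts tC !add1n.
  have notC u : u \in far a c \/ u \in far b c -> u \notin far a b.
    by move=> uX; apply/negP => /Cc uc; case: uX => /farP[_]; rewrite uc.
  have notAB u : u \in far a c -> u \notin far b c.
    by move=> /Bb ub; apply/negP => /farP[]; rewrite ub.
  have notC2 u : u \in far a c \/ u \in far b c -> u \notin C2.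
    by move=> /notC; apply: contra => /C2P[].
  have C2E u : u \in C2 -> [/\ G (p s) u = false, G (q s) u = false, G (p t) u = false & G (q t) u = false].
    by move=> /C2P[uC us ut]; rewrite !Gps ?Gqs //; split; apply/negbTE.
  have i4 : independent G (p s |: (p t |: (q s |: (q t |: C2)))).
    rewrite !independentU1 iC2 /=; apply/andP; split; [apply/andP; split; [apply/andP; split|]|]; apply/forall_inP => u.
    - by move/C2E=> [_ _ _ ->].
    - by rewrite in_setU1 => /orP[/eqP ->|/C2E[_ -> _ _] //]; rewrite GBB.
    - rewrite !in_setU1 => /or3P[/eqP ->|/eqP ->|/C2E[_ _ -> _] //].
        by rewrite Gqp // eq_sym.
      by rewrite Gqp // eq_sym taus.
    rewrite !in_setU1 => /or4P[/eqP ->|/eqP ->|/eqP ->|/C2E[-> _ _ _] //].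
    - by rewrite GAA.
    - by rewrite Gqp // eq_sym taus.
    by rewrite Gqp.
  have neq (f : T -> T) : (forall u v, u \in far a b -> v \in far a b -> f u = f v -> u = v) -> f s != f t.
    by move=> fi; apply: contraNneq ts => /(fi _ _ sC tC) ->.
  have pq u v : u \in far a b -> v \in far a b -> p u != q v.
    by move=> uC vC; apply: contraTneq (pA u uC) => ->; apply: notAB; apply: qB.
  have := independent_card jf alphaE i4; rewrite !cardsU1 !in_setU1 !negb_or.
  rewrite !pq // (neq p pinj) (neq q qinj) !notC2 ?add1n; try by [left; apply: qB | right; apply: pA].
  by rewrite -C2r ltnn.
have [s0 s0C] := set0Pn _ C0.
have [s1 s1E] : exists s1, tau s0 = s1 by exists (tau s0).
have [s2 s2E] : exists s2, tau s1 = s2 by exists (tau s1).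
have s1C : s1 \in far a b by rewrite -s1E; apply: tauC.
have s2C : s2 \in far a b by rewrite -s2E; apply: tauC.
have s01 : s1 != s0 by rewrite -s1E; apply: taus.
have s12 : s2 != s1 by rewrite -s2E; apply: taus.
(* If tau exchanged s0 and s1 it would fix the third element. *)
have s02 : s2 != s0.
  apply/eqP => e; have [t tC] : exists2 t, t \in far a b & t \notin [set s0; s1].
    by apply: card_notin; rewrite Cr r3' cards2; case: (_ != _).
  rewrite !inE => /norP[t0 t1].
  have CE : far a b = t |: [set s0; s1].
    apply/esym/eqP; rewrite eqEcard !subUset !sub1set tC s0C s1C Cr r3'.
    by rewrite cardsU1 cards2 !inE negb_or t0 t1 eq_sym s01.
  have := tauC t tC; rewrite {1}CE !inE (negPf (taus t tC)) /= => /orP[] /eqP h.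
    by case/eqP: t1; apply: tauI; rewrite // h s2E.
  by case/eqP: t0; apply: tauI; rewrite // h s1E.
have CE : far a b = s2 |: [set s0; s1].
  apply/esym/eqP; rewrite eqEcard !subUset !sub1set s0C s1C s2C Cr r3'.
  by rewrite cardsU1 cards2 !inE negb_or s02 s12 eq_sym s01.
have tau2 : tau s2 = s0.
  have := tauC s2 s2C; rewrite {1}CE !inE (negPf (taus s2 s2C)) /= => /orP[/eqP //|/eqP h].
  by case/eqP: s02; apply: tauI; rewrite // h s1E.
have inC x : x \in far a b -> exists2 i, (i < 3)%N & x = nth s0 [:: s0; s1; s2] i.
  by rewrite CE !inE => /or3P[] /eqP ->; [exists 2 | exists 0%N | exists 1%N].
pose s i := nth s0 [:: s0; s1; s2] i.
have sC i : (i < 3)%N -> s i \in far a b by case: i => [|[|[|]]].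
have sE i j : (i < 3)%N -> (j < 3)%N -> (s i == s j) = (i == j).
  have neg x y : x != y -> ((y == x) = false) * ((x == y) = false).
    by move=> xy; rewrite eq_sym (negPf xy).
  by case: i => [|[|[|i]]] // _; case: j => [|[|[|j]]] // _; rewrite /s /= ?eqxx ?(neg _ _ s01) ?(neg _ _ s12) ?(neg _ _ s02).
have tauE i : (i < 3)%N -> tau (s i) = s (i.+1 %% 3)%N.
  by case: i => [|[|[|i]]].
pose blk k i := match k with
  0 => nth a [:: a; b; c] i | 1 => p (s i) | 2 => q (s i) | _ => s i end.
have blkE k l i j : (k < 4)%N -> (l < 4)%N -> (i < 3)%N -> (j < 3)%N ->
    G (blk k i) (blk l j) = icos_block k l i j.
  wlog kl : k l i j / (k <= l)%N.
    move=> hw k4 l4 i3 j3; have [kl|/ltnW lk] := leqP k l; first exact: hw.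
    by rewrite adj_sym hw // icos_block_sym.
  move=> k4 l4 i3 j3; case: k k4 kl => [|[|[|[|k]]]] // _; case: l l4 => [|[|[|[|l]]]] // _ _;
    rewrite /blk /icos_block.
  - by case: i i3 => [|[|[|i]]] // _; case: j j3 => [|[|[|j]]] // _; rewrite /= ?adj_irr.
  - have h := pA _ (sC j j3); have /farP[/negbTE hb /negbTE hc] := h.
    by rewrite adj_sym; case: i i3 => [|[|[|i]]] //= _; rewrite ?(Aa _ h).
  - have h := qB _ (sC j j3); have /farP[/negbTE ha /negbTE hc] := h.
    by rewrite adj_sym; case: i i3 => [|[|[|i]]] //= _; rewrite ?(Bb _ h).
  - have h := sC j j3; have /farP[/negbTE ha /negbTE hb] := h.
    by rewrite adj_sym; case: i i3 => [|[|[|i]]] //= _; rewrite ?(Cc _ h).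
  - by rewrite GAA ?sC.
  - by rewrite Gqp ?sC // tauE // sE // ltn_mod.
  - by rewrite Gps ?sC // sE // eq_sym.
  - by rewrite GBB ?sC.
  - by rewrite Gqs ?sC // sE // eq_sym.
  - by rewrite GCC ?sC.
have tf : twin_free_upto 12 h12 by vm_compute.
apply: (@graph_iso_surj _ _ _ _ h12 (fun i => blk (i %/ 3)%N (i %% 3)%N) Q12E tf).
  move=> i j i12 j12; rewrite blkE ?ltn_mod ?ltn_divLR //.
  by rewrite -icos_blockE ?ltn_mod ?ltn_divLR // -!divn_eq.
have fin k i : (k < 4)%N -> (i < 3)%N -> exists2 n, (n < 12)%N & blk (n %/ 3)%N (n %% 3)%N = blk k i.
  move=> k4 i3; exists (k * 3 + i)%N; first by rewrite (_ : 12%N = (4 * 3)%N) // -ltn_divLR // divnMDl // divn_small // addn0.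
  by rewrite divnMDl // modnMDl divn_small // addn0 modn_small.
move=> x; case: (cov x) => [|/inC[i i3 ->]|/ontoq[t /inC[i i3 ->] <-]|/ontop[t /inC[i i3 ->] <-]].
- by rewrite !inE => /orP[/orP[]|] /eqP ->; [apply: (fin 0 0)%N | apply: (fin 0 1)%N | apply: (fin 0 2)%N].
- exact: (fin 3 i).
- exact: (fin 2 i).
- exact: (fin 1%N i).
Qed.

Lemma far_set0 a b c : G a b -> G b c -> G c a -> far a b != set0 -> ~ graph_iso G Q12 ->
  far a c = set0 /\ far b c = set0.
Proof.
move=> ab bc ca C0 nQ; have [ba cb ac] : [/\ G b a, G c b & G a c] by split; rewrite adj_sym.
have [iC|/independentPn[x [x' [xC x'C xx']]]] := boolP (independent G (far a b)).
  have [p [q [fl [//|pqc]]]] := far_dichotomy ab bc ca iC C0.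
  have [s sC] := set0Pn _ C0; have [psc qsc] := pqc s sC.
  have [[_ pb _] [_ qa _] _ _] := fl s sC; case: nQ.
  by apply: (far_good ab bc ca C0); apply/set0Pn; [exists (q s) | exists (p s)]; apply/farP.
split; apply/setP => y; rewrite in_set0; apply/negP => /farP[ya yc].
  exact: (far_edge_empty jf lf ltf alphaE r3 ab bc ca xC x'C xx' ya yc).
rewrite farC in xC x'C.
exact: (far_edge_empty jf lf ltf alphaE r3 ba ac cb xC x'C xx' ya yc).
Qed.

(** Otherwise take a triangle with [far a b] nonempty, and let D be the common neighbours of a and
    b. For d in D, [far a d] and [far b d] are empty, so every non-neighbour of d lies in D. Thus D
    is joined to its complement, which contains a and b. *)
Lemma alpha_large_Q12 : ~ triangle_free G -> graph_iso G Q12.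
Proof.
move=> ntf; apply: contrapT => nQ.
have [x [y [z [xy yz zx]]]] := not_triangle_free ntf.
(* If [far x y] is empty, an edge u u' of the link of x forms a triangle with y, and x lies in
   [far u u']. *)
have [a [b [c [ab bc ca C0]]]] : exists a b c, [/\ G a b, G b c, G c a & far a b != set0].
  have [xy0|] := eqVneq (far x y) set0; last by exists x, y, z.
  have ix := independent1 G x.
  have [u ux] : exists u, u \in W [set x].
    apply/set0Pn; apply: contraT; rewrite negbK => /eqP W0.
    have fx : maxset (independent G) [set x] by apply/facetP.
    have := facet_indep_number (join_free_pure jf) fx; rewrite alphaE cards1 => [[r0]].
    by move: (r3); rewrite r0.
  have [u' u'x uu'] := lf ix ux.
  have nx v : v \in W [set x] -> ~~ G v x /\ G v y.
    case/inWP=> _ /(_ x (set11 x)) nvx; split=> //; apply: contraT => nvy.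
    by have : v \in far x y; [apply/farP | rewrite xy0 inE].
  have [nux uy] := nx u ux; have [nux' uy'] := nx u' u'x.
  exists u, u', y; split=> //; first by rewrite adj_sym.
  by apply/set0Pn; exists x; apply/farP; split; rewrite adj_sym.
have ba : G b a by rewrite adj_sym.
pose D := [set d | G d a && G d b]; pose X := ~: D.
have DP d : reflect (G d a /\ G d b) (d \in D) by rewrite inE; apply: andP.
have aX : a \in X by rewrite !inE adj_irr.
have bX : b \in X by rewrite !inE adj_irr andbF.
have cX : c \notin X by rewrite inE negbK; apply/DP; rewrite [G c b]adj_sym.
have XW : X \subset W set0 by apply/subsetP => u _; apply: inW0.
have [|X1 _] := join_pair jf (independent0 G) XW _ aX (inW0 G c) cX; last first.
  by move: bX ba; rewrite X1 inE => /eqP ->; rewrite adj_irr.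
move=> v d vX _ dX; apply: contraT => nvd; move: vX; rewrite inE => /negP[].
have /DP[da db] : d \in D by move: dX; rewrite inE negbK.
have [ad0 bd0] : far a d = set0 /\ far b d = set0 by apply: far_set0; rewrite // adj_sym.
apply/DP; split; apply: contraT => n.
  by have : v \in far a d; [apply/farP | rewrite ad0 inE].
by have : v \in far b d; [apply/farP | rewrite bd0 inE].
Qed.
End Icosahedral.

(** * Independence number three *)

Local Open Scope nat_scope.

(* A partial surface lists, for each vertex named so far, its link cycle as a
   list of names, or [::] if the link is not yet known. *)
Definition lnk (L : seq (seq nat)) i : seq nat := nth [::] L i.

(* [if] rather than [&&] and [all], which are strict under vm_compute. *)
Fixpoint lazy_all (p : pred nat) s := if s is x :: s' then if p x then lazy_all p s' else false else true.

Lemma lazy_allE p s : lazy_all p s = all p s.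
Proof. by elim: s => //= x s ->; case: (p x). Qed.

(** Only necessary conditions, for pruning: links are symmetric, without repetitions, and agree with
    the links already known. *)
Definition consistent (L : seq (seq nat)) :=
  lazy_all (fun v => let l := lnk L v in if nilp l then true else if v \in l then false else
    if lazy_all (fun j => let l' := lnk L j in
         if nilp l' then true else (j \in l) == (v \in l')) (iota 0 (size L)) then
      if uniq l then
        lazy_all (fun a => let la := lnk L (nth 0 l a) in if nilp la then true else
          lazy_all (fun b => (nth 0 l b \in la) == cyc (size l) a b) (iota 0 (size l))) (iota 0 (size l))
      else false
    else false)
    (rev (iota 0 (size L))).

(** Entries of l from [size L] on are new names; each is appended with an unknown link. *)
Definition close_link (L : seq (seq nat)) v l :=
  mkseq (fun i => if i == v then l else lnk L i) (size L + count (leq (size L)) l).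

(** A link is read from w through one common neighbour p to the other, q, leaving one or two unknown
    entries. The next free name is n, and n.+1 may occur only after it, which fixes the order of
    naming. *)
Definition link_candidates n w p q : seq (seq nat) :=
  [seq [:: w; p; x; q] | x <- iota 0 n.+1] ++
  [seq [:: w; p; x; y; q] | x <- iota 0 n.+1, y <- iota 0 (if x == n then n.+2 else n.+1)].

Definition completions (L : seq (seq nat)) v w :=
  let l := lnk L w in let m := size l in let k := index v l in
  [seq close_link L v l' | l' <- link_candidates (size L) w (nth 0 l (k.+1 %% m)) (nth 0 l ((k + m.-1) %% m))].

(** Exhausted fuel counts as failure, so the value true certifies that every branch was finished. *)
Fixpoint surfaces (final : pred (seq (seq nat))) fuel (L : seq (seq nat)) : bool :=
  if fuel is k.+1 then
    if [seq v <- iota 0 (size L) | nilp (lnk L v)] is v :: _ then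
      if [seq w <- iota 0 (size L) | v \in lnk L w] is w :: _ then
        all (surfaces final k) [seq L' <- completions L v w | consistent L']
      else false
    else final L
  else false.

Lemma surfacesS final k L : surfaces final k.+1 L =
  if [seq v <- iota 0 (size L) | nilp (lnk L v)] is v :: _ then
    if [seq w <- iota 0 (size L) | v \in lnk L w] is w :: _ then
      all (surfaces final k) [seq L' <- completions L v w | consistent L']
    else false
  else final L.
Proof. by []. Qed.

Definition relabels m (f : nat -> nat) :=
  all (fun i => (f i < m) && all (fun j => (cyc m (f i) (f j) == cyc m i j) &&
    ((f i == f j) == (i == j))) (iota 0 m)) (iota 0 m).

Lemma relabels_rot m k : 4 <= m <= 5 -> k < m -> relabels m (fun i => (i + k) %% m).
Proof.
have h : all (fun k => relabels 4 (fun i => (i + k) %% 4)) (iota 0 4) &&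
  all (fun k => relabels 5 (fun i => (i + k) %% 5)) (iota 0 5) by vm_compute.
case/andP: h => /allP h4 /allP h5 m45 km; have [e|e] : m = 4 \/ m = 5 by lia.
  by subst m; apply: h4; rewrite mem_iota.
by subst m; apply: h5; rewrite mem_iota.
Qed.

Lemma relabels_rev m : 4 <= m <= 5 -> relabels m (fun i => (m - i) %% m).
Proof. by move=> m45; have [->|->] : m = 4 \/ m = 5 by [lia|]; vm_compute. Qed.

Lemma cyc0 m i : i < m -> cyc m 0 i -> i = 1 \/ i = m.-1.
Proof. by move=> im; rewrite cycE ?(leq_ltn_trans _ im) //; lia. Qed.

Lemma cyc_steps m k : 4 <= m -> k < m ->
  [/\ cyc m k (k.+1 %% m), cyc m k ((k + m.-1) %% m) & k.+1 %% m != (k + m.-1) %% m].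
Proof.
move=> m4 km; have m0 : 0 < m by lia.
have prevE : (k + m.-1) %% m = if k == 0 then m.-1 else k.-1.
  case: eqVneq => [->|k0]; first by rewrite add0n modn_small; lia.
  have -> : k + m.-1 = k.-1 + m by lia.
  by rewrite modnDr modn_small; lia.
rewrite !cycE ?ltn_mod // modS // prevE; case: (k.+1 =P m) => e; case: (k =P 0) => e'; split; lia.
Qed.

Lemma link_candidates_mem (T : eqType) n w p q (s mid : seq T) (f : T -> nat) :
  uniq mid -> 1 <= size mid <= 2 -> (forall z, z \in s -> f z < n) ->
  (forall z, z \notin s -> f z = n + index z [seq z <- mid | z \notin s]) ->
  w :: p :: rcons (map f mid) q \in link_candidates n w p q.
Proof.
move=> um m12 old new; have io k m : (k \in iota 0 m) = (k < m) by rewrite mem_iota.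
rewrite mem_cat; case: mid um m12 new => [|x [|y [|]]] // um _ new; apply/orP; rewrite [map f _]/= [rcons _ _]/=.
  left; apply/mapP; exists (f x) => //; rewrite io ltnS; have [xs|xs] := boolP (x \in s); first exact/ltnW/old.
  by rewrite (new x xs) /= xs /= eqxx addn0.
right; apply/allpairsPdep; exists (f x), (f y); rewrite !io.
have [xs|xs] := boolP (x \in s).
  have fx := old x xs; split=> //; first exact: ltnW.
  rewrite ltn_eqF // ltnS; have [ys|ys] := boolP (y \in s); first exact/ltnW/old.
  by rewrite (new y ys) /= ?xs ?ys /= eqxx addn0.
have fx : f x = n by rewrite (new x xs) /= xs /= eqxx addn0.
split=> //; rewrite fx ?eqxx //; have [ys|ys] := boolP (y \in s).
  by have := old y ys; lia.
have xy : x != y by move: um; rewrite /= inE andbT.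
by rewrite (new y ys) /= ?xs ?ys /= (negPf xy) eqxx addn1.
Qed.

Section Surface.
Variables (T : eqType) (R : rel T).
Hypotheses (sR : ssrbool.symmetric R) (iR : irreflexive R).

Definition is_link v c := [/\ uniq c, forall x, (x \in c) = R v x, 4 <= size c <= 5 &
  forall x0 i j, i < size c -> j < size c -> R (nth x0 c i) (nth x0 c j) = cyc (size c) i j].

Hypothesis links : forall v, exists c, is_link v c.

Lemma is_link_relabel v c f x0 : is_link v c -> relabels (size c) f ->
  is_link v (mkseq (fun i => nth x0 c (f i)) (size c)).
Proof.
move=> [uc cE mc Rc] rf; set m := size c in rf Rc mc *.
have fP i : i < m -> f i < m /\ forall j, j < m -> cyc m (f i) (f j) = cyc m i j /\ (f i == f j) = (i == j).
  move=> im; have io k : k < m -> k \in iota 0 m by rewrite mem_iota.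
  have /allP/(_ i (io i im))/andP[fi /allP h] := rf; split=> // j jm.
  by have /andP[/eqP -> /eqP ->] := h j (io j jm).
have u' : uniq (mkseq (fun i => nth x0 c (f i)) m).
  rewrite map_inj_in_uniq ?iota_uniq // => i j; rewrite !mem_iota !add0n => /andP[_ im] /andP[_ jm] /eqP.
  have [fi h] := fP i im; have [fj _] := fP j jm; have [_ e] := h j jm.
  by rewrite nth_uniq // e => /eqP.
have sub : {subset mkseq (fun i => nth x0 c (f i)) m <= c}.
  by move=> z /mapP[i]; rewrite mem_iota add0n => /andP[_ im] ->; apply: mem_nth; case: (fP i im).
have [_ eqm] := uniq_min_size u' sub (eq_leq (esym (size_mkseq _ _))).
split=> //; [by move=> x; rewrite eqm | by rewrite size_mkseq |].
rewrite size_mkseq => y0 i j im jm; rewrite !nth_mkseq //; have [fi h] := fP i im; have [fj _] := fP j jm; have [e _] := h j jm.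
by rewrite Rc.
Qed.

(* The link of v read off from w, in the direction of a chosen common neighbour p. *)
Lemma is_link_orient v w p : R v w -> R v p -> R w p ->
  exists mid q, is_link v (w :: p :: rcons mid q) /\ 1 <= size mid <= 2.
Proof.
move=> vw vp wp; have [c cl] := links v; have [uc cE mc Rc] := cl.
have wc : w \in c by rewrite cE.
have k_lt : index w c < size c by rewrite index_mem.
have := is_link_relabel w cl (relabels_rot mc k_lt); set c1 := mkseq _ _ => c1l.
have c10 : nth w c1 0 = w.
  by rewrite nth_mkseq ?add0n ?modn_small ?nth_index //; lia.
have [c2 [c2l c20 c21]] : exists c2, [/\ is_link v c2, nth w c2 0 = w & nth w c2 1 = p].
  have [u1 c1E m1 R1] := c1l; have pc : p \in c1 by rewrite c1E.
  pose i := index p c1; have im : i < size c1 by rewrite index_mem.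
  have ip : nth w c1 i = p by rewrite nth_index.
  have m0 : 0 < size c1 by lia.
  have := R1 w 0 i m0 im; rewrite c10 ip wp => /esym /(cyc0 im) [i1|i1].
    by exists c1; split=> //; rewrite -i1.
  exists (mkseq (fun i => nth w c1 ((size c1 - i) %% size c1)) (size c1)); split.
  - exact: is_link_relabel (relabels_rev m1).
  - by rewrite nth_mkseq // subn0 modnn.
  by rewrite nth_mkseq ?modn_small ?subn1 -?i1 //; lia.
have [_ _ m2 _] := c2l; case: c2 c2l c20 c21 m2 => [|x [|y c2]] c2l //= c20 c21 m2.
rewrite c20 c21 in c2l; case/lastP: c2 c2l m2 => [|mid q] c2l m2; first by move: m2.
by exists mid, q; split=> //; move: m2; rewrite size_rcons; lia.
Qed.

Variable x0 : T.

Definition embeds (s : seq T) (L : seq (seq nat)) := [/\ uniq s, size s = size L &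
  forall i, i < size L -> ~~ nilp (lnk L i) ->
    {in lnk L i, forall j, j < size L} /\ is_link (nth x0 s i) (map (nth x0 s) (lnk L i))].

Lemma embeds_mem s L i j : embeds s L -> i < size L -> j < size L -> ~~ nilp (lnk L i) ->
  (j \in lnk L i) = R (nth x0 s i) (nth x0 s j).
Proof.
move=> [us sL h] iL jL ci; have [lt [_ cE _ _]] := h i iL ci; rewrite -cE.
apply/idP/mapP => [jl|[k kl /eqP]]; first by exists j.
by rewrite nth_uniq ?sL ?(lt k) // => /eqP ->.
Qed.

Lemma embeds_consistent s L : embeds s L -> consistent L.
Proof.
move=> em; have [us sL h] := em; rewrite /consistent lazy_allE; apply/allP => v.
rewrite mem_rev mem_iota add0n => /andP[_ vL] /=; case: ifPn => // cv.
have [lt [uc cE mc Rc]] := h v vL cv; rewrite size_map in mc Rc.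
rewrite !lazy_allE (embeds_mem em) // iR; case: ifPn => [_|/allPn[j]]; last first.
  rewrite mem_iota add0n => /andP[_ jL] /=; case: ifPn => // cj.
  by rewrite !(embeds_mem em) // sR eqxx.
rewrite (map_uniq uc); apply/allP => a; rewrite mem_iota add0n => /andP[_ al] /=.
case: ifPn => // ca; rewrite lazy_allE; apply/allP => b; rewrite mem_iota add0n => /andP[_ bl] /=.
have lta i : i < size (lnk L v) -> nth 0 (lnk L v) i < size L by move=> il; apply/lt/mem_nth.
rewrite (embeds_mem em) ?lta //; apply/eqP; have := Rc x0 a b al bl.
by rewrite !(nth_map 0).
Qed.

(** The true link of v, read from w towards p, ends at q, because p and q are the only common
    neighbours of v and w. Numbering new vertices by first occurrence makes it one of the
    candidates. *)
Lemma embeds_completion s L v w : embeds s L -> v < size L -> lnk L v = [::] ->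
  w < size L -> v \in lnk L w ->
  exists2 L', L' \in completions L v w & exists2 s', embeds s' L' & {subset s <= s'}.
Proof.
move=> em vL cv wL vw; have [us sL h] := em.
have cw : ~~ nilp (lnk L w) by case: (lnk L w) vw.
have [lt [uc cE mc Rc]] := h w wL cw; rewrite size_map in mc Rc.
set l := lnk L w in lt uc cE mc Rc vw; set m := size l in mc Rc; pose k := index v l.
have km : k < m by rewrite index_mem.
have kE : nth 0 l k = v by rewrite nth_index.
pose ip := k.+1 %% m; pose iq := (k + m.-1) %% m.
have ipm : ip < m by rewrite ltn_mod; lia.
have iqm : iq < m by rewrite ltn_mod; lia.
pose p := nth 0 l ip; pose q := nth 0 l iq.
have pl : p \in l by apply: mem_nth.
have ql : q \in l by apply: mem_nth.
pose t i := nth x0 s i.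
have Rl i j : i < m -> j < m -> R (t (nth 0 l i)) (t (nth 0 l j)) = cyc m i j.
  by move=> im jm; rewrite -(Rc x0) // !(nth_map 0).
have [next prev ipq] := cyc_steps (proj1 (andP mc)) km.
have vp : R (t v) (t p) by rewrite -kE Rl.
have vq : R (t v) (t q) by rewrite -kE Rl.
have pq : p != q by rewrite nth_uniq ?(map_uniq uc).
have wR j : j \in l -> R (t w) (t j) by move=> jl; have <- := embeds_mem em wL (lt j jl) cw.
have vw' : R (t v) (t w) by rewrite sR wR.
have [mid [q' [cl mid12]]] := is_link_orient vw' vp (wR _ pl).
set c := _ :: _ in cl; have [uc' cE' mc' Rc'] := cl.
have tinj i j : i < size L -> j < size L -> t i = t j -> i = j.
  by move=> iL jL /eqP; rewrite nth_uniq ?sL // => /eqP.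
have qE : q' = t q.
  have sc : size c = (size mid).+3 by rewrite /= size_rcons.
  have qc : t q \in c by rewrite cE'.
  pose i := index (t q) c; have ic : i < size c by rewrite index_mem.
  have ci : nth x0 c i = t q by rewrite nth_index.
  have c0 : 0 < size c by rewrite sc.
  have := Rc' x0 0 i c0 ic; rewrite ci [nth x0 c 0]/(t w) wR // => /esym /(cyc0 ic) [i1|i1].
    by move: ci pq; rewrite i1 /= => /(tinj _ _ (lt _ pl) (lt _ ql)) ->; rewrite eqxx.
  by move: ci; rewrite i1 nth_last /= last_rcons.
pose s' := s ++ [seq z <- c | z \notin s]; pose l' := map (index^~ s') c.
have us' : uniq s'.
  rewrite cat_uniq us filter_uniq // andbT; apply/hasPn => z; by rewrite mem_filter => /andP[].
have cs' : {subset c <= s'}.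
  by move=> z zc; rewrite mem_cat mem_filter zc andbT orbN.
have idx i : i < size L -> index (t i) s' = i.
  by move=> iL; rewrite index_cat mem_nth ?sL // index_uniq ?sL.
have old z : (size L <= index z s') = (z \notin s).
  rewrite index_cat -sL; case: ifP => zs; last by rewrite leq_addr.
  by rewrite leqNgt index_mem zs.
have size' : size s' = size L + count (leq (size L)) l'.
  by rewrite size_cat sL size_filter count_map; congr (_ + _); apply: eq_count => z /=; rewrite old.
have em' : embeds s' (close_link L v l').
  split; rewrite ?size_mkseq // => i iL'.
  have lE : lnk (close_link L v l') i = if i == v then l' else lnk L i by rewrite /lnk nth_mkseq.
  rewrite lE; case: (eqVneq i v) => [->|iv].
    move=> _; split; first by move=> _ /mapP[z zc ->]; rewrite -size' index_mem cs'.
    have -> : nth x0 s' v = t v by rewrite nth_cat sL vL.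
    have e : {in c, nth x0 s' \o (index^~ s') =1 id} by move=> z zc; apply: nth_index; apply: cs'.
    by rewrite -map_comp (map_id_in e).
  move=> ci; have iL : i < size L by rewrite ltnNge; apply: contra ci => iL; rewrite /lnk nth_default.
  have [lti li] := h i iL ci; split; first by move=> j /lti jL; apply: leq_trans jL (leq_addr _ _).
  rewrite nth_cat sL iL; have -> // : map (nth x0 s') (lnk L i) = map (nth x0 s) (lnk L i).
  by apply/eq_in_map => j /lti jL; rewrite nth_cat sL jL.
exists (close_link L v l').
  2: by exists s' => // z zs; rewrite mem_cat zs.
apply: map_f; rewrite -/l -/m -/k -/ip -/iq -/p -/q.
have l'E : l' = w :: p :: rcons (map (index^~ s') mid) q.
  by rewrite /l' /c qE /= map_rcons (idx w wL) (idx p (lt p pl)) (idx q (lt q ql)).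
have ts j : j < size L -> t j \in s by move=> jL; rewrite mem_nth ?sL.
have fE : [seq z <- c | z \notin s] = [seq z <- mid | z \notin s].
  by rewrite /c qE /= filter_rcons (ts w wL) (ts p (lt p pl)) (ts q (lt q ql)).
have sz z : z \in s -> index z s' < size L by move=> zs; rewrite index_cat zs -sL index_mem.
have new z : z \notin s -> index z s' = size L + index z [seq z <- mid | z \notin s].
  by move=> zs; rewrite index_cat (negPf zs) sL fE.
have um : uniq mid.
  by move: uc'; rewrite /c /= rcons_uniq => /and3P[_ _ /andP[_ ->]].
rewrite l'E; exact: (@link_candidates_mem _ _ w p q s mid (index^~ s') um mid12 sz new).
Qed.

Lemma surfaces_complete final fuel s L : surfaces final fuel L -> embeds s L ->
  exists s' L', [/\ embeds s' L', {subset s <= s'}, forall i, i < size L' -> ~~ nilp (lnk L' i) & final L'].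
Proof.
elim: fuel s L => // k IH s L; rewrite surfacesS.
case vE: [seq v <- _ | _] => [|v vs] fin em.
  exists s, L; split=> // i iL; apply/negP => ci.
  have : i \in [seq v <- iota 0 (size L) | nilp (lnk L v)] by rewrite mem_filter ci mem_iota.
  by rewrite vE.
have : v \in [seq v <- iota 0 (size L) | nilp (lnk L v)] by rewrite vE mem_head.
rewrite mem_filter mem_iota add0n => /andP[/nilP cv /andP[_ vL]].
case wE: [seq w <- _ | _] fin => [//|w ws] /allP fin.
have : w \in [seq w <- iota 0 (size L) | v \in lnk L w] by rewrite wE mem_head.
rewrite mem_filter mem_iota add0n => /andP[vw /andP[_ wL]].
have [L' L'c [s' em' ss']] := embeds_completion em vL cv wL vw.
have [|s2 [L2 [em2 s's2 cl2 fin2]]] := IH s' L' _ em'.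
  by apply: fin; rewrite mem_filter (embeds_consistent em').
by exists s2, L2; split=> // z /ss'/s's2.
Qed.
End Surface.

Definition edge_rel (E : seq (nat * nat)) : rel nat :=
  fun i j => (i != j) && (((i, j) \in E) || ((j, i) \in E)).

Definition Q9_edges : seq (nat * nat) :=
  [:: (0,1); (1,2); (2,0); (0,3); (0,4); (1,5); (1,6); (2,7); (2,8);
      (3,7); (7,5); (5,4); (4,8); (8,6); (6,3)].

Definition P10_edges : seq (nat * nat) :=
  [:: (0,1); (0,2); (0,5); (0,3); (0,4); (1,2); (1,6); (1,7); (2,8); (2,9); (3,4); (3,7); (3,8);
      (4,6); (4,9); (5,6); (5,7); (5,8); (5,9); (6,8); (7,9)].

Definition P12_edges : seq (nat * nat) :=
  [:: (0,1); (0,8); (0,2); (0,3); (0,4); (0,5); (1,9); (1,2); (1,3); (1,7); (1,6); (2,4); (2,6);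
      (2,10); (2,11); (3,5); (3,7); (3,10); (3,11); (8,9); (8,6); (8,7); (8,10); (8,11); (9,4);
      (9,5); (9,10); (9,11); (4,5); (4,7); (4,10); (5,6); (5,11); (6,7); (6,10); (7,11)].

Lemma Q9E (i j : 'I_9) : Q9 i j = edge_rel Q9_edges i j. Proof. by []. Qed.
Lemma P10E (i j : 'I_10) : P10 i j = edge_rel P10_edges i j. Proof. by []. Qed.
Lemma P12E (i j : 'I_12) : P12 i j = edge_rel P12_edges i j. Proof. by []. Qed.

(* The graph whose complement is the 1-skeleton of a closed surface. *)
Definition co_skeleton (L : seq (seq nat)) : rel nat := fun i j => (i != j) && (j \notin lnk L i).

Definition triangle_free_upto n (g : rel nat) :=
  all (fun i => all (fun j => all (fun k => ~~ [&& g i j, g j k & g k i]) (iota 0 n)) (iota 0 n)) (iota 0 n).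

(** Breadth-first search for isomorphisms: l sends i to its i-th entry, and an extension is kept if
    it respects adjacency to the earlier entries. *)
Definition extensions n (g h : rel nat) (ls : seq (seq nat)) : seq (seq nat) :=
  flatten [seq [seq rcons l x | x <- iota 0 n & if x \in l then false else
    lazy_all (fun i => g (nth 0 l i) x == h i (size l)) (iota 0 (size l))] | l <- ls].

Definition is_numbering n (g h : rel nat) (l : seq nat) :=
  [&& size l == n, uniq l, all (fun i => i < n) l &
    all (fun i => all (fun j => g (nth 0 l i) (nth 0 l j) == h i j) (iota 0 n)) (iota 0 n)].

Definition isomorphic_upto n (g h : rel nat) :=
  has (is_numbering n g h) (iter n (extensions n g h) [:: [::]]).

Definition sporadic (L : seq (seq nat)) :=
  let n := size L in let g := co_skeleton L in
  if triangle_free_upto n g then true else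
  if n == 9 then isomorphic_upto 9 g (edge_rel Q9_edges) else
  if n == 10 then isomorphic_upto 10 g (edge_rel P10_edges) else
  if n == 12 then isomorphic_upto 12 g (edge_rel P12_edges) else false.

(** On a connected closed surface the sum of 6 - degree is six times the Euler characteristic, at
    most 12, so degrees 4 and 5 allow at most 12 vertices. Fuel 13 ends every branch of the
    search. *)
Lemma surfaces_sporadic m : 4 <= m <= 5 -> surfaces sporadic 13 (iota 1 m :: nseq m [::]).
Proof.
by move=> m45; have [->|->] : m = 4 \/ m = 5 by lia.
Qed.

Lemma numbering_iso (T : finType) (G : sgraph T) n (H : sgraph 'I_n) (h g : rel nat) (s : seq T) :
  (forall i j : 'I_n, H i j = h i j) -> twin_free_upto n h -> size s = n -> uniq s -> s =i T ->
  (forall x0 i j, i < n -> j < n -> G (nth x0 s i) (nth x0 s j) = g i j) ->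
  isomorphic_upto n g h -> T -> graph_iso G H.
Proof.
move=> Hh tf sn us sT Gg /hasP[l _ /and4P[/eqP ln ul /allP lt chk]] x0.
have io i : i < n -> i \in iota 0 n by rewrite mem_iota.
apply: (@graph_iso_surj _ _ _ _ h (fun i => nth x0 s (nth 0 l i)) Hh tf) => [i j lin ljn|x].
  rewrite Gg; [| by apply/lt/mem_nth; rewrite ln..].
  by apply/eqP; move: chk => /allP/(_ i (io i lin))/allP/(_ j (io j ljn)).
have xs : index x s < n by rewrite -sn index_mem sT.
have lE : l =i iota 0 n.
  have sub : {subset l <= iota 0 n} by move=> i /lt; rewrite mem_iota.
  by have [] := uniq_min_size ul sub (eq_leq (etrans (size_iota _ _) (esym ln))).
have xl : index x s \in l by rewrite lE io.
by exists (index (index x s) l); rewrite ?nth_index ?sT // -ln index_mem.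
Qed.

Lemma cyc_hexagon m : 6 <= m -> [/\ ~~ cyc m 0 2, ~~ cyc m 2 4 & ~~ cyc m 4 0].
Proof. by move=> m6; rewrite !cycE; try lia; split; lia. Qed.

Lemma alpha3_sporadic (T : finType) (G : sgraph T) : join_free G -> leafy G ->
  locally_triangle_free G -> indep_number G = 3 -> ~ triangle_free G ->
  graph_iso G Q9 \/ graph_iso G P10 \/ graph_iso G P12.
Proof.
move=> jf lf ltf a3 ntf; pose R : rel T := fun x y => (x != y) && ~~ G x y.
have sR : ssrbool.symmetric R by move=> x y; rewrite /R eq_sym adj_sym.
have iR : irreflexive R by move=> x; rewrite /R eqxx.
have RW v x : (x \in ~: closed_nbhd G [set v]) = R v x.
  by rewrite -[[set v]]setU0 inWU1 inW0 andbT /R eq_sym adj_sym.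
have links v : exists c, is_link R v c.
  have F2 : indep_number G = #|[set v]|.+2 by rewrite cards1.
  have [c [uc cW c4 h]] := cycle_listing jf lf (independent1 G v) F2.
  have cR x i j : i < size c -> j < size c -> R (nth x c i) (nth x c j) = cyc (size c) i j.
    move=> ic jc; rewrite -(h x) // inWU1 -cW mem_nth // andbT /R eq_sym adj_sym.
    by [].
  exists c; split=> //; first by move=> x; rewrite cW RW.
  (* In a longer link the entries 0, 2 and 4 would form a triangle of G missing v. *)
  rewrite c4 /= leqNgt; apply/negP => c6.
  have [x xc] : exists x, x \in c by case: (c) c4 => // x c' _; exists x; rewrite mem_head.
  have ci i : i < size c -> nth x c i \in ~: closed_nbhd G [set v] by move=> ic; rewrite -cW mem_nth.
  have adjc i j : i < size c -> j < size c -> i != j -> ~~ cyc (size c) i j -> G (nth x c i) (nth x c j).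
    by move=> ic jc ij; rewrite -(cR x) // /R nth_uniq // ij negbK.
  have [l0 l2 l4] : [/\ 0 < size c, 2 < size c & 4 < size c] by split; apply: leq_trans c6.
  have [c02 c24 c40] := cyc_hexagon c6.
  have /negP := ltf v (Sub (nth x c 0) (ci 0 l0)) (Sub (nth x c 2) (ci 2 l2)) (Sub (nth x c 4) (ci 4 l4)); apply.
  by rewrite /= /induced_adj /= !adjc.
have [v0 [y0 [z0 [vy0 _ _]]]] := not_triangle_free ntf.
have [c [uc cE mc Rc]] := links v0.
have em : embeds R v0 (v0 :: c) (iota 1 (size c) :: nseq (size c) [::]).
  split; first by rewrite /= uc cE iR.
    by rewrite /= size_nseq.
  case=> [|i] iL; last by rewrite /lnk /= nth_nseq if_same.
  move=> _; rewrite /lnk [nth [::] _ 0]/=; split.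
    by move=> j; rewrite mem_iota /= size_nseq add1n => /andP[].
  have -> : map (nth v0 (v0 :: c)) (iota 1 (size c)) = c; last by split.
  apply: (@eq_from_nth _ v0); rewrite size_map size_iota // => i ic.
  by rewrite (nth_map 0) ?size_iota // nth_iota.
have [s [L [emL sub cL fin]]] := surfaces_complete sR iR links (surfaces_sporadic mc) em.
have [us sL h] := emL.
have GL x0 i j : i < size L -> j < size L -> G (nth x0 s i) (nth x0 s j) = co_skeleton L i j.
  move=> iL jL; rewrite (set_nth_default v0) ?sL // [nth x0 s j](set_nth_default v0) ?sL //.
  rewrite /co_skeleton (embeds_mem emL) ?cL // /R nth_uniq ?sL // negb_and !negbK.
  by case: eqVneq => [->|]; rewrite ?adj_irr.
have closedS x y : x \in s -> R x y -> y \in s.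
  move=> xs xy; have ix : index x s < size L by rewrite -sL index_mem.
  have [lt [_ mE _ _]] := h _ ix (cL _ ix); rewrite nth_index // in mE.
  by move: (xy); rewrite -mE => /mapP[j /lt jL ->]; rewrite mem_nth ?sL.
have v0s : v0 \in s by apply: sub; rewrite mem_head.
(* The vertices reached are closed under adjacency in the complement, so any others would be joined
   to them. *)
have sT : s =i T.
  move=> y; suff -> : y \in s by []. apply: contraT => ys; pose X := [set x in s].
  have XE x : (x \in X) = (x \in s) by rewrite inE.
  have XW : X \subset ~: closed_nbhd G set0 by apply/subsetP => x _; apply: inW0.
  have [|||X1 _] := join_pair jf (independent0 G) XW (x := v0) (y := y) _ _ (inW0 G y).
  - move=> x w; rewrite !XE => xs _ ws; apply: contraT => nxw.
    case/negP: (ws); apply: (closedS x) => //; rewrite /R nxw andbT; apply: contraTneq xs => ->; exact: ws.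
  - by rewrite XE.
  - by rewrite XE.
  have [x xc] : exists x, x \in c by case: (c) mc => // x c' _; exists x; rewrite mem_head.
  have : x \in X by rewrite XE; apply: sub; rewrite inE xc orbT.
  by rewrite X1 inE => /eqP e; move: xc; rewrite cE e iR.
move: fin; rewrite /sporadic; case: ifPn => [tfL _|_].
  case: ntf => x y z; apply/negP => /and3P[xy yz zx].
  have io u : index u s \in iota 0 (size L) by rewrite mem_iota -sL index_mem sT.
  have GI u w : G u w -> co_skeleton L (index u s) (index w s).
    by move=> uw; rewrite -(GL v0) -?sL ?index_mem ?sT // !nth_index ?sT.
  move: tfL => /allP/(_ _ (io x))/allP/(_ _ (io y))/allP/(_ _ (io z)).
  by rewrite !GI.
case: eqP => [n9 iso|_]; last case: eqP => [n10 iso|_]; last case: eqP => [n12 iso|//].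
- left; apply: (numbering_iso Q9E _ _ us sT _ iso v0); [by vm_compute | by rewrite sL | by rewrite -n9].
- right; left; apply: (numbering_iso P10E _ _ us sT _ iso v0); [by vm_compute | by rewrite sL | by rewrite -n10].
- right; right; apply: (numbering_iso P12E _ _ us sT _ iso v0); [by vm_compute | by rewrite sL | by rewrite -n12].
Qed.

Lemma locally_triangle_free_classification (T : finType) (G : sgraph T) :
  join_free G -> leafy G -> locally_triangle_free G -> ~ triangle_free G ->
  (exists2 m : nat, (6 <= m)%N & graph_iso G (compl (cycle_graph m))) \/
  graph_iso G Q9 \/ graph_iso G Q12 \/ graph_iso G P10 \/ graph_iso G P12.
Proof.
move=> jf lf ltf ntf; have wc := join_free_pure jf.
have alpha_ge S : independent G S -> (#|S| <= indep_number G)%N.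
  by move=> iS; have [S' mS' /subset_leq_card] := facet_extend iS; rewrite -(facet_indep_number wc mS').
have [x [y [z [xy yz zx]]]] := not_triangle_free ntf.
case a: (indep_number G) alpha_ge => [|[|[|[|r]]]] alpha_ge.
- by have := alpha_ge _ (independent1 G x); rewrite cards1.
(* With independence number one, G is complete, and [join_pair] leaves only two vertices. *)
- have complete u v : u != v -> G u v.
    move=> uv; apply: contraT => nuv.
    have i2 : independent G [set u; v].
      by rewrite independentU1 independent1; apply/forall_inP => w /set1P ->.
    by have := alpha_ge _ i2; rewrite cards2 uv.
  have yx : y \notin [set x] by rewrite inE; apply: contraTneq xy => ->; rewrite adj_irr.
  have xW : [set x] \subset ~: closed_nbhd G set0 by rewrite sub1set inW0.
  have [|_ E] := join_pair jf (independent0 G) xW _ (set11 x) (inW0 G y) yx.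
    by move=> u v /set1P -> _; rewrite inE eq_sym; apply: complete.
  have := inW0 G z; rewrite E !inE => /orP[] /eqP e; first by rewrite e adj_irr in zx.
  by rewrite e adj_irr in yz.
- by left; apply: alpha2_cycle.
- by right; have [h|[h|h]] := alpha3_sporadic jf lf ltf a ntf; auto.
by right; right; left; apply: (alpha_large_Q12 jf lf ltf a _ ntf).
Qed.

Lemma gorenstein_necessary (K : fieldType) n (G : sgraph 'I_n) :
  no_isolated G -> locally_triangle_free G -> gorenstein_graph K G ->
  (triangle_free G /\ in_W2 G) \/
   ((exists2 m : nat, (6 <= m)%N & graph_iso G (compl (cycle_graph m))) \/
    graph_iso G Q9 \/ graph_iso G Q12 \/ graph_iso G P10 \/ graph_iso G P12).
Proof.
move=> iso ltf gor.
have jf : join_free G by move=> F X Y iF; apply: (gorenstein_join iF gor).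
have pf : path_free G by move=> F y u l p q iF; apply: (gorenstein_no_path iF gor).
have lf := path_free_leafy jf pf iso.
have [tf|ntf] := pselect (triangle_free G).
  by left; split=> //; apply: leafy_W2 lf; apply: join_free_pure.
by right; apply: locally_triangle_free_classification.
Qed.

(** * Certificates of the graphs in the list *)

Lemma certificate_iso (T T' : finType) (G : sgraph T) (H : sgraph T') fam :
  graph_iso G H -> gorenstein_certificate H fam ->
  exists fam', gorenstein_certificate G fam'.
Proof.
move=> [f [g fK gK] fG] [cf cs]; have fi := can_inj fK.
have fE (U : {set T}) x : (f x \in f @: U) = (x \in U) by apply: mem_imset.
have fS (U : {set T}) y : (y \in f @: U) = (g y \in U) by rewrite -{1}(gK y) fE.
have GG y y' : G (g y) (g y') = H y y' by rewrite -fG !gK.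
have fI (U : {set T}) : independent H (f @: U) = independent G U.
  apply/independentP/independentP => h x y xU yU.
    by rewrite -fG; apply: h; rewrite fE.
  by rewrite -GG; apply: h; rewrite -fS.
have fD (U : {set T}) t : f @: (U :\ t) = (f @: U) :\ f t.
  by apply/setP => y; rewrite !inE !fS !inE -(can_eq gK) fK.
have fN (U : {set T}) t : f @: (U :|: nb G t) = f @: U :|: nb H (f t).
  by apply/setP => y; rewrite !inE !fS !inE -GG fK.
have fdom (D U : {set T}) : dominates H (f @: D) (f @: U) = dominates G D U.
  apply/dominatesP/dominatesP => h u uU.
    have [|d dD ud] := h (f u); first by rewrite fE.
    by exists (g d); rewrite -?fS // -fG gK.
  have [|d dD ud] := h (g u); first by rewrite -fS.
  by exists (f d); rewrite ?fE // -GG fK.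
exists (fun U : {set T} => fam (f @: U)); split=> [S mS|U famU U0].
  have -> : f @: (~: S) = ~: (f @: S) by apply/setP => y; rewrite inE !fS inE.
  apply: cf; apply/maxsetP; split; first by rewrite fI (maxsetp mS).
  move=> B iB SB; apply/eqP; rewrite eqEsubset SB andbT; apply/subsetP => y yB.
  have BE : B = f @: (g @: B) by apply/setP => z; rewrite fS mem_imset //; apply: can_inj gK.
  rewrite fS -(maxsetsup mS (B := g @: B)) ?mem_imset //; first exact: can_inj gK.
    by rewrite -fI -BE.
  by apply/subsetP => x xS; rewrite -(fK x); apply: imset_f; apply: (subsetP SB); rewrite fE.
have [t [tU ft1 ft2 lift]] := cs _ famU (etrans (congr1 negb (imset_eq0 f U)) U0).
rewrite -(gK t) -fD in ft1 ft2 lift; rewrite fS in tU; exists (g t); split=> //.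
  by rewrite fN.
move=> D iD; rewrite -fdom fN => dom; have [|tD dD] := lift (f @: D) _ dom; first by rewrite fI.
by rewrite -[g t \in D]fE -fdom fD.
Qed.

(** * Triangle-free graphs in W_2 *)

Section TriangleFreeCertificate.
Variables (T : finType) (G : sgraph T).
Hypotheses (tf : triangle_free G) (lf : leafy G).
Implicit Types (F D U X : {set T}).
Local Notation W F := (~: closed_nbhd G F).

Definition link_family U := exists F X, [/\ independent G F, independent G X, X \subset W F & U = X :|: nbhd G F].

Lemma nbhdP F x : independent G F -> reflect (exists2 f, f \in F & G x f) (x \in nbhd G F).
Proof.
move=> iF; rewrite inE; apply: (iffP andP) => [[_ /exists_inP[f fF xf]]|[f fF xf]].
  by exists f; rewrite // adj_sym.
split; last by apply/exists_inP; exists f; rewrite // adj_sym.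
by apply/negP => xF; move/independentP: iF => /(_ x f xF fF); rewrite xf.
Qed.

(** If X is empty, drop some f from F: the vertices of N(F) whose only neighbour in F is f are
    independent, since G is triangle-free, and become the new X. *)
Lemma link_family_nonempty U : link_family U -> U != set0 -> exists F X,
  [/\ independent G F, independent G X, X \subset W F, U = X :|: nbhd G F & X != set0].
Proof.
move=> [F [X [iF iX XW UE]]] U0; have [k] := ubnP #|F|; elim: k => // k IH in F X iF iX XW UE *.
rewrite ltnS => Fk; have [X0|X0] := eqVneq X set0; last by exists F, X.
have [x] := set0Pn _ U0; rewrite {1}UE X0 set0U => /(nbhdP _ iF)[f fF xf].
have iF' : independent G (F :\ f) by apply: independentS iF; apply: subsetDl.
pose P := nbhd G F :\: nbhd G (F :\ f).
have PP y : y \in P -> G y f /\ forall f', f' \in F -> f' != f -> ~~ G y f'.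
  rewrite in_setD => /andP[yF' /(nbhdP _ iF)[f' f'F yf']].
  have no f2 : f2 \in F -> f2 != f -> ~~ G y f2.
    move=> f2F ne; apply: contra yF' => yf2; apply/(nbhdP _ iF'); exists f2 => //.
    by rewrite !inE ne.
  by split=> //; have [<- //|ne] := eqVneq f' f; move: (no f' f'F ne); rewrite yf'.
have iP : independent G P.
  apply/independentP => y z /PP[yf _] /PP[zf _]; apply/negP => yz.
  by have := tf y z f; rewrite yz zf adj_sym yf.
have PW : P \subset W (F :\ f).
  apply/subsetP => y yP; have [yf yN] := PP y yP; apply/inWP; split.
    by apply/negP => /setD1P[_ yF]; move/independentP: iF => /(_ y f yF fF); rewrite yf.
  by move=> f' /setD1P[ne f'F]; apply: yN.
have UE' : U = P :|: nbhd G (F :\ f).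
  apply/setP => y; rewrite UE X0 set0U in_setU in_setD.
  have [yF'|yF'] := boolP (y \in nbhd G (F :\ f)); last by rewrite orbF.
  rewrite orbT; have [f' /setD1P[_ f'F] yf'] := elimT (nbhdP _ iF') yF'.
  by apply/(nbhdP _ iF); exists f'.
have lt : (#|F :\ f| < k)%N by apply: leq_trans Fk; rewrite [in X in (_ < X)%N](cardsD1 f) fF.
exact: IH iF' iP PW UE' lt.
Qed.

Lemma leafy_certificate : gorenstein_certificate G link_family.
Proof.
split=> [S /facetP[iS WS]|U famU U0].
  exists S, set0; split; rewrite ?sub0set ?independent0 // set0U.
  apply/setP => x; have : x \notin W S by rewrite WS inE.
  rewrite in_setC negbK in_setU in_setC => xS; apply/idP/idP => [/negPf xS'|].
    by move: xS; rewrite xS'.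
  by rewrite inE => /andP[].
have [F [X [iF iX XW UE /set0Pn[t tX]]]] := link_family_nonempty famU U0.
have tW := subsetP XW t tX; have itF := independentW iF tW.
have tN : t \notin nbhd G F.
  by apply/negP => /(nbhdP _ iF)[f fF tf']; have /inWP[_ /(_ f fF)] := tW; rewrite tf'.
have tF : t \notin F by case/inWP: tW.
have UtE : U :\ t = (X :\ t) :|: nbhd G F.
  by apply/setP => y; rewrite UE !inE; case: eqVneq => //= ->; apply/esym/negbTE; move: tN; rewrite inE.
have nbE : nbhd G (t |: F) = nbhd G F :|: nb G t.
  apply/setP => y; rewrite in_setU (in_set (fun w => G t w)); apply/(nbhdP _ itF)/orP => [[f]|[/(nbhdP _ iF)[f fF yf]|ty]].
  - by move=> /setU1P[->|fF] yf; [right; rewrite adj_sym | left; apply/(nbhdP _ iF); exists f].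
  - by exists f => //; rewrite inE fF orbT.
  by exists t; rewrite ?setU11 // adj_sym.
have iXt : independent G (X :\ t) by apply: independentS iX; apply: subsetDl.
exists t; split.
- by rewrite UE inE tX.
- by exists F, (X :\ t); split=> //; apply: subset_trans XW; apply: subsetDl.
- exists (t |: F), (X :\ t); split=> //; last by rewrite UtE nbE setUA.
  apply/subsetP => y /setD1P[yt yX]; rewrite inWU1 yt (subsetP XW) // andbT /=.
  by move/independentP: iX; apply.
move=> D iD /dominatesP dom.
(* No vertex of D is dominated by D, so D misses N(F + t). A vertex of F + t outside D would be in
   the link of D, and by [leafy] have a neighbour there, which is in N(F + t) but not dominated. *)
have DN y : y \in nbhd G (t |: F) -> y \notin D.
  move=> yN; apply/negP => yD; have [|d dD yd] := dom y.
    by move: yN; rewrite nbE UtE !in_setU => /orP[] ->; rewrite ?orbT.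
  by move/independentP: iD => /(_ y d yD dD); rewrite yd.
have FD f : f \in t |: F -> f \in D.
  move=> fF; apply: contraT => fD.
  have fW : f \in W D.
    apply/inWP; split=> // d dD; apply/negP => fd; have := DN d; rewrite dD; case/(_ _)/negP => //.
    by apply/(nbhdP _ itF); exists f; rewrite // adj_sym.
  have [y yW fy] := lf iD fW.
  have yN : y \in nbhd G (t |: F) by apply/(nbhdP _ itF); exists f; rewrite // adj_sym.
  have [|d dD yd] := dom y; first by move: yN; rewrite nbE UtE !in_setU => /orP[] ->; rewrite ?orbT.
  by have /inWP[_ /(_ d dD)] := yW; rewrite yd.
split; first by apply: FD; rewrite setU11.
apply/dominatesP => u; rewrite UtE in_setU => /orP[/setD1P[ut uX]|/(nbhdP _ iF)[f fF uf]].
  have [|d dD ud] := dom u; first by rewrite UtE !in_setU !inE ut uX.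
  exists d => //; rewrite !inE dD andbT; apply: contraTneq ud => ->.
  by move/independentP: iX; apply.
exists f => //; rewrite !inE FD ?inE ?fF ?orbT // andbT.
by apply: contraNneq tF => <-.
Qed.
End TriangleFreeCertificate.

(** * Complements of cycles *)

Section CycleComplement.
Variable m : nat.
Hypothesis m4 : 4 <= m.
Local Notation G := (compl (cycle_graph m)).

(** Distance from a to x around the cycle in increasing direction. *)
Definition offset (a x : nat) := if a <= x then x - a else x + m - a.

Definition co_interval_family (U : {set 'I_m}) := exists a k, [/\ a < m, 2 <= k <= m &
  forall x : 'I_m, (x \in U) = (k <= offset a x)].

Lemma co_cycleE (x y : 'I_m) : G x y =
  ~~ [|| x == y :> nat, y == x.+1 :> nat, x == y.+1 :> nat, (x.+1 == m) && (y == 0 :> nat) | (y.+1 == m) && (x == 0 :> nat)].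
Proof.
have := cycE (ltn_ord x) (ltn_ord y).
rewrite /= /compl_adj /= /symrel_adj -/(cyc m x y) -val_eqE /= => ->.
by case: (_ == _ :> nat).
Qed.

Lemma shift_ord (t j : nat) : t < m -> j < m ->
  exists u : 'I_m, u = (if t + j < m then t + j else t + j - m) :> nat.
Proof.
move=> tm jm; have um : (if t + j < m then t + j else t + j - m) < m by case: ifP => //; lia.
by exists (Ordinal um).
Qed.

Lemma co_cycle_facet S : maxset (independent G) S -> co_interval_family (~: S).
Proof.
move=> mS; have /independentP iS := maxsetp mS.
have ext (t : 'I_m) : (forall s, s \in S -> ~~ G t s) -> t \in S.
  move=> tS; have i : independent G (t |: S).
    by rewrite independentU1 (maxsetp mS); apply/forall_inP.
  by rewrite -(maxsetsup mS i (subsetUr _ _)) setU11.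
have m0 : 0 < m by lia.
have [s sS] : exists s, s \in S.
  have [S0|[s sS]] := set_0Vmem S; last by exists s.
  by exists (Ordinal m0); apply: ext => s; rewrite S0 inE.
have [s1 s1E] := @shift_ord s 1 (ltn_ord s) (ltac:(lia)).
have pair (a b : 'I_m) : a \in S -> b \in S -> b = (if a + 1 < m then a + 1 else a + 1 - m) :> nat ->
    co_interval_family (~: S).
  move=> aS bS bE; exists a, 2; split; [exact: ltn_ord | lia |] => x.
  have E : (x \in S) = (x == a) || (x == b).
    apply/idP/orP => [xS|[] /eqP -> //].
    move: (iS x a xS aS) (iS x b xS bS); rewrite !co_cycleE -!val_eqE /= !negbK.
    by move: (ltn_ord x) (ltn_ord a) (ltn_ord b) bE; clear -m4; case: ifP; lia.
  rewrite inE E -!val_eqE /= /offset.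
  by move: (ltn_ord x) (ltn_ord a) (ltn_ord b) bE; clear -m4; do 2 case: ifP; lia.
have [s1S|s1S] := boolP (s1 \in S); first exact: (pair s s1).
have [u uS us] : exists2 u, u \in S & G s1 u.
  apply: contrapT => nu; case/negP: s1S; apply: ext => u uS; apply/negP => h.
  by apply: nu; exists u.
apply: (pair u s) => //; move: (iS s u sS uS) us; rewrite !co_cycleE negbK.
by move: (ltn_ord s) (ltn_ord u) (ltn_ord s1) s1E; clear -m4; do 2 case: ifP; lia.
Qed.

Lemma co_cycle_certificate : gorenstein_certificate G co_interval_family.
Proof.
split=> [S|U [a [k [am /andP[k2 km] UE]]] /set0Pn[x0]]; first exact: co_cycle_facet.
rewrite UE => kx; have {x0 kx} km' : k < m.
  by move: kx (ltn_ord x0); rewrite /offset; clear -am; case: ifP; lia.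
have [t tE] := shift_ord am km'.
have tk : offset a t = k.
  by move: tE (ltn_ord t); rewrite /offset; clear -am km'; do 2 case: ifP; lia.
have UtE (x : 'I_m) : (x \in U :\ t) = (k.+1 <= offset a x).
  rewrite !inE UE -val_eqE /=; move: tk (ltn_ord x) (ltn_ord t); rewrite /offset.
  by clear -am; do 2 case: ifP; lia.
exists t; split.
- by rewrite UE tk.
- by exists a, k.+1; split=> //; rewrite km' ltnW.
(* The non-neighbours of t are t - 1, t and t + 1. The last is in the enlarged interval only when
   that is the whole cycle, which gives length 3 in place of 2. *)
- have [b bE] := @shift_ord t m.-1 (ltn_ord t) (ltac:(lia)).
  exists b, (if k.+1 == m then 3 else 2); split; [exact: ltn_ord | by case: ifP; lia |] => x.
  rewrite in_setU UtE inE co_cycleE.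
  move: tE bE (ltn_ord x) (ltn_ord t) (ltn_ord b); rewrite /offset; clear -am km' k2 m4.
  by case: (k.+1 =P m); do 4 case: ifP; lia.
move=> D /independentP iD /dominatesP dom.
have DN d : d \in D -> offset a d <= k /\ ~~ G t d.
  move=> dD; have h : d \notin U :\ t :|: nb G t.
    by apply/negP => /dom[d' d'D]; apply/negP; apply: iD.
  move: h; rewrite in_setU UtE inE => /norP[]; by rewrite -leqNgt.
have [u1 u1E] := @shift_ord t 2 (ltn_ord t) (ltac:(lia)).
have [u2 u2E] := @shift_ord t (m - 2) (ltn_ord t) (ltac:(lia)).
have [t1 t1E] := @shift_ord t 1 (ltn_ord t) (ltac:(lia)).
have nbdom u : G t u -> exists2 d, d \in D & G u d.
  by move=> tu; apply: dom; rewrite in_setU; apply/orP; right; rewrite inE.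
(* D lies in {t - 1, t, t + 1}. Without t, dominating t + 2 takes t - 1 and dominating t - 2 takes t
   + 1, and these two are adjacent. *)
have tD : t \in D.
  apply: contraT => tD.
  have [d1 d1D d1N] : exists2 d, d \in D & G u1 d.
    apply: nbdom; rewrite co_cycleE; move: u1E (ltn_ord t) (ltn_ord u1).
    by clear -m4; case: ifP; lia.
  have [d2 d2D d2N] : exists2 d, d \in D & G u2 d.
    apply: nbdom; rewrite co_cycleE; move: u2E (ltn_ord t) (ltn_ord u2).
    by clear -m4; case: ifP; lia.
  have [[_ n1] [_ n2]] := (DN d1 d1D, DN d2 d2D).
  have [e1 e2] : d1 != t /\ d2 != t by split; apply: contraNneq tD => <-.
  have d1E : d1 = (if t + m.-1 < m then t + m.-1 else t + m.-1 - m) :> nat.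
    move: n1 e1 d1N; rewrite !co_cycleE negbK -val_eqE /=.
    move: u1E (ltn_ord t) (ltn_ord u1) (ltn_ord d1); move: (t : nat) (u1 : nat) (d1 : nat) => x y w.
    by clear -m4; do 2 case: ifP; lia.
  have d2E : d2 = (if t + 1 < m then t + 1 else t + 1 - m) :> nat.
    move: n2 e2 d2N; rewrite !co_cycleE negbK -val_eqE /=.
    move: u2E (ltn_ord t) (ltn_ord u2) (ltn_ord d2); move: (t : nat) (u2 : nat) (d2 : nat) => x y w.
    by clear -m4; do 2 case: ifP; lia.
  move: (iD d1 d2 d1D d2D); rewrite co_cycleE negbK d1E d2E; move: (ltn_ord t); move: (t : nat) => x.
  by clear -m4; do 2 case: ifP; lia.
split=> //; apply/dominatesP => u; rewrite UtE => uk.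
(* Since U - t is nonempty it contains t + 1. The member of D dominating t + 1 can only be t - 1,
   and this is adjacent to all of U - t. *)
have t1U : t1 \in U :\ t.
  rewrite UtE; move: uk tE t1E (ltn_ord u) (ltn_ord t) (ltn_ord t1); rewrite /offset.
  by clear -m4 am km'; do 4 case: ifP; lia.
have [|d dD t1d] := dom t1; first by rewrite in_setU t1U.
have [dk nd] := DN d dD.
have dt : d = (if t + m.-1 < m then t + m.-1 else t + m.-1 - m) :> nat.
  move: t1d nd; rewrite !co_cycleE negbK; move: t1E (ltn_ord t) (ltn_ord t1) (ltn_ord d).
  by clear -m4; do 2 case: ifP; lia.
exists d.
  rewrite !inE dD andbT -val_eqE /=; move: dt (ltn_ord t) (ltn_ord d).
  by clear -m4; case: ifP; lia.
rewrite co_cycleE; move: uk tE dt (ltn_ord u) (ltn_ord t) (ltn_ord d); rewrite /offset.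
by clear -m4 am km' k2; do 3 case: ifP; lia.
Qed.
End CycleComplement.

(** * Certificates verified by computation *)

Fixpoint bits_of n k : bitseq := if n is n'.+1 then odd k :: bits_of n' k./2 else [::].
Fixpoint all_bits n : seq bitseq :=
  if n is n'.+1 then map (cons true) (all_bits n') ++ map (cons false) (all_bits n') else [:: [::]].

Definition zip_bits (f : bool -> bool -> bool) (l l' : bitseq) : bitseq := [seq f p.1 p.2 | p <- zip l l'].
Definition sub_bits (l l' : bitseq) := all (fun p => p.1 ==> p.2) (zip l l').

Section Checker.
Variables (n : nat) (h : rel nat).

Definition row t : bitseq := [seq h t j | j <- iota 0 n].
Definition rows : seq bitseq := [seq row t | t <- iota 0 n].
Definition dom_bits (rs : seq bitseq) (l : bitseq) : bitseq := [seq has id (zip_bits andb l r) | r <- rs].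
Definition del_bit t (l : bitseq) := zip_bits andb l [seq j != t | j <- iota 0 n].
Definition face_bits rs : seq (bitseq * bitseq) :=
  [seq p <- [seq (l, dom_bits rs l) | l <- all_bits n] | ~~ has id (zip_bits andb p.1 p.2)].

(* [if] rather than [&&], which is strict under vm_compute. *)
Definition liftable_bits rs faces (U : bitseq) t :=
  all (fun p => if sub_bits (zip_bits orb U (nth [::] rs t)) p.2 then
         nth false p.1 t && sub_bits U (dom_bits rs (del_bit t p.1)) else true) faces.

(** The first clause recognizes facets as the independent sets that, with the vertices they
    dominate, exhaust the graph. *)
Definition certifies_with rs faces (fam : seq bitseq) :=
  all (fun p => if all id (zip_bits orb p.1 p.2) then map negb p.1 \in fam else true) faces &&
  all (fun U => if has id U then has (fun t =>
         if nth false U t then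
           if del_bit t U \in fam then
             if zip_bits orb (del_bit t U) (nth [::] rs t) \in fam then liftable_bits rs faces (del_bit t U) t
             else false else false else false) (iota 0 n) else true) fam.

(** The applied abstractions let [rows] and [face_bits] be evaluated once for the whole check. *)
Definition certifies (fam : seq bitseq) :=
  (fun rs => (fun faces => certifies_with rs faces fam) (face_bits rs)) rows.
End Checker.

Section CheckerSound.
Variables (n : nat) (H : sgraph 'I_n) (h : rel nat).
Hypothesis Hh : forall i j : 'I_n, H i j = h i j.
Local Notation e := (enum 'I_n).

Definition bits (U : {set 'I_n}) : bitseq := [seq i \in U | i <- e].

Lemma zip_bits_map (T : Type) f (s : seq T) (p q : T -> bool) :
  zip_bits f (map p s) (map q s) = [seq f (p x) (q x) | x <- s].
Proof. by rewrite /zip_bits; elim: s => //= x s ->. Qed.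

Lemma sub_bits_map (T : Type) (s : seq T) (p q : T -> bool) :
  sub_bits (map p s) (map q s) = all (fun x => p x ==> q x) s.
Proof. by rewrite /sub_bits; elim: s => //= x s ->. Qed.

Lemma iota_map (T : Type) (f : nat -> T) : [seq f j | j <- iota 0 n] = [seq f (j : 'I_n) | j <- e].
Proof. by rewrite -val_enum_ord -map_comp. Qed.

Lemma nth_bits (p : pred 'I_n) (t : 'I_n) : nth false [seq p i | i <- e] t = p t.
Proof. by rewrite (nth_map t) ?size_enum_ord // nth_ord_enum. Qed.

Lemma all_e (p : pred 'I_n) : reflect (forall i, p i) (all p e).
Proof. by apply: (iffP allP) => hp i; [apply: hp; rewrite mem_enum | move=> _; apply: hp]. Qed.

Lemma has_e (p : pred 'I_n) : reflect (exists i, p i) (has p e).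
Proof. by apply: (iffP hasP) => -[i]; [exists i | move=> pi; exists i; rewrite ?mem_enum]. Qed.

Lemma row_bits (t : 'I_n) : row n h t = bits (nb H t).
Proof. by rewrite /row iota_map; apply: eq_map => j; rewrite inE Hh. Qed.

Lemma nth_rows (t : 'I_n) : nth [::] (rows n h) t = bits (nb H t).
Proof. by rewrite /rows (nth_map 0) ?size_iota // nth_iota // add0n row_bits. Qed.

Lemma bitsD1 U (t : 'I_n) : del_bit n t (bits U) = bits (U :\ t).
Proof.
by rewrite /del_bit iota_map zip_bits_map; apply: eq_map => j; rewrite !inE andbC.
Qed.

Lemma bitsU U X : zip_bits orb (bits U) (bits X) = bits (U :|: X).
Proof. by rewrite zip_bits_map; apply: eq_map => j; rewrite inE. Qed.

Lemma bitsC U : map negb (bits U) = bits (~: U).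
Proof. by rewrite -map_comp; apply: eq_map => j /=; rewrite inE. Qed.

Lemma dom_bitsE D : dom_bits (rows n h) (bits D) = [seq [exists f in D, H i f] | i <- e].
Proof.
rewrite /dom_bits /rows iota_map -map_comp; apply: eq_map => i /=; rewrite row_bits zip_bits_map has_map.
by apply/has_e/exists_inP => -[f]; [move=> /andP[fD]; rewrite inE; exists f | exists f; rewrite /= inE; apply/andP].
Qed.

Lemma dominates_bits U D : sub_bits (bits U) (dom_bits (rows n h) (bits D)) = dominates H D U.
Proof.
rewrite dom_bitsE sub_bits_map; apply/all_e/forall_inP => hd u; first by apply/implyP; apply: hd.
by apply/implyP => /hd.
Qed.

Lemma mem_all_bits (l : bitseq) : l \in all_bits (size l).
Proof.
by elim: l => //= b l IH; rewrite mem_cat; case: b; rewrite map_f ?orbT.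
Qed.

Lemma mem_face_bits D : independent H D -> (bits D, dom_bits (rows n h) (bits D)) \in face_bits n (rows n h).
Proof.
move=> /independentP iD; rewrite mem_filter map_f ?andbT; last first.
  by rewrite -[n in all_bits n](size_enum_ord n) -(size_map (mem D)) mem_all_bits.
rewrite /= dom_bitsE zip_bits_map has_map.
apply/has_e => -[i /andP[iiD /exists_inP[j jD ij]]].
by have := iD i j iiD jD; rewrite ij.
Qed.

Lemma certifies_sound fam : certifies n h fam -> exists fam', gorenstein_certificate H fam'.
Proof.
case/andP=> /allP cf /allP cs; exists (fun U : {set 'I_n} => bits U \in fam); split.
  move=> S /facetP[iS WS]; have := cf _ (mem_face_bits iS); rewrite /= bitsC; case: ifPn => // /negP[].
  rewrite dom_bitsE zip_bits_map all_map; apply/all_e => i /=.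
  case: (boolP (i \in S)) => //= iS'; have : i \notin ~: closed_nbhd H S by rewrite WS inE.
  by rewrite inW iS' /= => /forall_inPn[j jS]; rewrite negbK => ij; apply/exists_inP; exists j.
move=> U famU /set0Pn[x xU]; have := cs _ famU; rewrite has_map.
have -> : has (preim (fun i => i \in U) id) e by apply/has_e; exists x.
case/hasP=> t; rewrite mem_iota add0n => /andP[_ tn].
have -> : t = Ordinal tn by []; move: (Ordinal tn) => {tn}t.
rewrite nth_bits nth_rows bitsD1 bitsU; do 3 case: ifPn => // ?.
move=> /allP lift; exists t; split=> // D iD.
have := lift _ (mem_face_bits iD); rewrite /= nth_rows bitsU dominates_bits => + dom.
by rewrite dom bitsD1 dominates_bits nth_bits => /andP[].
Qed.
End CheckerSound.

(* Each number lists a vertex set (bit i stands for vertex i).  The families were found by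
   computer as greatest fixed points of the closure condition of [gorenstein_certificate],
   starting from all vertex sets. *)
Definition Q9_family : seq nat :=
  [:: 0; 2; 18; 26; 30; 32; 36; 44; 64; 80; 84; 94; 96; 100; 101; 116; 124; 125; 126; 128; 130;
      146; 154; 158; 192; 193; 194; 210; 211; 215; 222; 225; 229; 245; 256; 257; 258; 259; 266;
      267; 274; 282; 286; 288; 291; 292; 300; 302; 303; 318; 321; 353; 357; 365; 384; 385; 386;
      387; 394; 395; 402; 403; 410; 411; 414; 419; 427; 449; 451; 467; 481; 483; 485].

Definition P10_family : seq nat :=
  [:: 0; 2; 8; 34; 50; 58; 62; 72; 104; 108; 128; 144; 176; 180; 190; 192; 196; 197; 228; 244;
      252; 253; 254; 256; 258; 290; 298; 306; 314; 318; 384; 385; 401; 434; 435; 439; 446; 449;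
      453; 465; 469; 501; 512; 513; 514; 515; 520; 546; 547; 552; 554; 555; 562; 570; 574; 616;
      619; 620; 623; 638; 641; 705; 709; 713; 717; 749; 768; 769; 770; 771; 802; 810; 811; 818;
      819; 826; 827; 830; 875; 897; 899; 913; 947; 961; 963; 965; 969; 971; 973; 977; 979; 981].

Definition Q12_family : seq nat :=
  [:: 0; 64; 72; 76; 128; 144; 148; 256; 288; 292; 308; 316; 318; 320; 328; 332; 404; 412; 446;
      476; 508; 509; 510; 512; 544; 546; 562; 570; 574; 640; 641; 672; 674; 675; 691; 702; 705;
      768; 800; 802; 830; 896; 897; 916; 917; 931; 949; 951; 958; 961; 965; 997; 1013; 1024;
      1025; 1026; 1027; 1034; 1056; 1058; 1066; 1082; 1086; 1088; 1096; 1100; 1281; 1283; 1291;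
      1312; 1316; 1317; 1323; 1342; 1380; 1388; 1390; 1391; 1406; 1409; 1473; 1477; 1509; 1517;
      1536; 1537; 1538; 1546; 1547; 1562; 1570; 1594; 1598; 1665; 1667; 1699; 1729; 1792; 1793;
      1794; 1795; 1802; 1803; 1827; 1828; 1830; 1834; 1838; 1839; 1854; 1921; 1923; 1955; 1959;
      1985; 1989; 2021; 2048; 2064; 2066; 2098; 2106; 2112; 2113; 2120; 2124; 2128; 2130; 2131;
      2136; 2140; 2142; 2143; 2174; 2176; 2192; 2196; 2198; 2271; 2302; 2369; 2377; 2381; 2497;
      2501; 2517; 2525; 2560; 2561; 2562; 2594; 2595; 2618; 2622; 2625; 2627; 2723; 2739; 2743;
      2750; 2753; 2769; 2773; 2775; 2881; 3009; 3013; 3029; 3072; 3073; 3074; 3075; 3082; 3090;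
      3091; 3122; 3130; 3134; 3136; 3137; 3144; 3148; 3154; 3155; 3162; 3166; 3167; 3198; 3329;
      3331; 3339; 3393; 3395; 3403; 3407; 3457; 3521; 3525; 3533; 3584; 3585; 3586; 3587; 3595;
      3602; 3603; 3618; 3619; 3627; 3634; 3635; 3642; 3643; 3646; 3649; 3651; 3659; 3675; 3713;
      3715; 3731; 3763; 3777; 3779; 3795; 3841; 3843; 3851; 3875; 3883; 3907; 3915; 3969; 3971;
      4003; 4033; 4035; 4037].

Definition P12_family : seq nat :=
  [:: 0; 2; 18; 128; 160; 274; 306; 310; 318; 512; 520; 536; 640; 672; 676; 704; 712; 716; 717;
      792; 830; 856; 860; 932; 940; 958; 972; 1004; 1020; 1021; 1022; 1024; 1025; 1026; 1042;
      1089; 1152; 1154; 1282; 1298; 1314; 1330; 1334; 1342; 1442; 1446; 1447; 1458; 1462; 1470;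
      1601; 1664; 1666; 1672; 1676; 1698; 1702; 1703; 1708; 1709; 1729; 1737; 1741; 1773; 1958;
      1966; 1967; 1982; 2029; 2048; 2049; 2050; 2064; 2066; 2067; 2112; 2131; 2177; 2306; 2307;
      2322; 2323; 2338; 2354; 2358; 2366; 2386; 2387; 2394; 2395; 2430; 2624; 2640; 2643; 2648;
      2651; 2689; 2753; 2761; 2765; 2769; 2777; 2781; 2904; 2907; 2908; 2911; 2942; 3037; 3072;
      3073; 3074; 3330; 3346; 3362; 3378; 3379; 3382; 3390; 3410; 3418; 3442; 3443; 3450; 3451;
      3454; 3490; 3494; 3495; 3506; 3507; 3510; 3511; 3518; 3571; 3585; 3649; 3665; 3673; 3675;
      3713; 3745; 3747; 3749; 3777; 3779; 3785; 3789; 3793; 3795; 3801; 3803; 3805; 3809; 3811;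
      3813; 3815; 3821; 3827; 3931; 4007].

Lemma Q9_certificate : exists fam, gorenstein_certificate Q9 fam.
Proof.
apply: (certifies_sound Q9E (fam := map (bits_of 9) Q9_family)).
by vm_cast_no_check (erefl true).
Qed.

Lemma P10_certificate : exists fam, gorenstein_certificate P10 fam.
Proof.
apply: (certifies_sound P10E (fam := map (bits_of 10) P10_family)).
by vm_cast_no_check (erefl true).
Qed.

Lemma Q12_certificate : exists fam, gorenstein_certificate Q12 fam.
Proof.
apply: (certifies_sound Q12E (fam := map (bits_of 12) Q12_family)).
by vm_cast_no_check (erefl true).
Qed.

Lemma P12_certificate : exists fam, gorenstein_certificate P12 fam.
Proof.
apply: (certifies_sound P12E (fam := map (bits_of 12) P12_family)).
by vm_cast_no_check (erefl true).
Qed.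

Lemma certificate_iso_gorenstein (K : fieldType) n (G : sgraph 'I_n) (T : finType) (H : sgraph T) :
  graph_iso G H -> (exists fam, gorenstein_certificate H fam) -> gorenstein_graph K G.
Proof.
by move=> iso [fam cert]; have [fam' cert'] := certificate_iso iso cert; apply: certificate_gorenstein cert'.
Qed.

Theorem theorem4p1 (K : fieldType) (n : nat) (G : sgraph 'I_n)
    (hisol : no_isolated G) (hltf : locally_triangle_free G) :
  gorenstein_graph K G <->
  ((triangle_free G /\ in_W2 G) \/
   ((exists2 m : nat, (6 <= m)%N & graph_iso G (compl (cycle_graph m))) \/
    graph_iso G Q9 \/ graph_iso G Q12 \/ graph_iso G P10 \/ graph_iso G P12)).
Proof.
split; first exact: gorenstein_necessary.
case=> [[tf /W2_leafy lf]|[[m m6 iso]|[iso|[iso|[iso|iso]]]]].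
- exact: certificate_gorenstein (leafy_certificate tf lf).
- apply: certificate_iso_gorenstein iso _.
  by exists (@co_interval_family m); apply: co_cycle_certificate; apply: leq_trans m6.
- exact: certificate_iso_gorenstein iso Q9_certificate.
- exact: certificate_iso_gorenstein iso Q12_certificate.
- exact: certificate_iso_gorenstein iso P10_certificate.
- exact: certificate_iso_gorenstein iso P12_certificate.
Qed.
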